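(* Let $K$ be a field of characteristic $p>0$ and $\Lambda=K[x][y;\delta:=f\frac{d}{dx}]$ where $f\in K[x]\setminus K$. Let $f=p_1^{n_1}\cdots p_s^{n_s}$ be the unique (up to permutation) product of irreducible polynomials of $K[x]$ (with $p_1,\ldots,p_s$ pairwise co-prime). Then: 1. The map $\mathrm{Max}(\Lambda)\to\widehat{\Lambda}$, $\mathfrak{M}\mapsto L(\mathfrak{M})$, is a bijection with inverse $[M]\mapsto\mathrm{ann}_\Lambda(M)$, where $L(\mathfrak{M})$ is the unique (up to isomorphism) simple direct summand/submodule/factor module of the (simple) matrix algebra $\Lambda/\mathfrak{M}$. In particular, for all $\mathfrak{m}\in\mathrm{Max}(Z(\Lambda))\setminus V(f^p)$, $\dim_K(L(\Lambda\mathfrak{m}))=p\cdot\dim_K(Z(\Lambda)/\mathfrak{m})<\infty$. 2. For each maximal ideal $(p_i,q_i)$ of $\Lambda$, where $i=1,\ldots,s$ and $q_i\in\mathrm{Irr}_m(F_i[y])$, $$L(p_i,q_i)=\Lambda/(p_i,q_i)\simeq K[y]/(q_i)$$ and $\dim_K(L(p_i,q_i))=\dim_K(K[y]/(q_i))=\deg_y(q_i)<\infty$. 3. Suppose that the field $K$ is algebraically closed. For each maximal ideal $\Lambda\mathfrak{m}$ of $\Lambda$, where $\mathfrak{m}\in\mathrm{Max}(Z(\Lambda))\setminus V(f^p)$, $$L(\Lambda\mathfrak{m})\simeq\Lambda/\Lambda(\mathfrak{m},x-\sqrt[p]{\xi})=\bigoplus_{i=0}^{p-1}Ky^i\bar 1\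 \simeq\ A_{1,f^p}/A_{1,f^p}(\mathfrak{m},x-\sqrt[p]{\xi})=\bigoplus_{i=0}^{p-1}K\partial^i\hat 1,$$ where $x^p-\xi\in\mathfrak{m}$ for a unique element $\xi\in K$, $\bar1=1+\Lambda(\mathfrak{m},x-\sqrt[p]{\xi})$, $\hat1=1+A_{1,f^p}(\mathfrak{m},x-\sqrt[p]{\xi})$, and $\dim_KL(\Lambda\mathfrak{m})=p<\infty$.
   Context: Modules are left modules. $\Lambda=K\langle x,y\mid yx-xy=f\rangle=\bigoplus_{i\ge0}K[x]y^i$ is identified with a subalgebra of the Weyl algebra $A_1=K\langle x,\partial\mid\partial x-x\partial=1\rangle$ via $x\mapsto x$, $y\mapsto f\partial$; its centre is $Z(\Lambda)=K[x^p,f^p\partial^p]$, which contains $f^p$, and $A_{1,f^p}$ is the localization of $A_1$ at the powers of the central element $f^p$ (it equals the localization of $\Lambda$ at the powers of $f^p$). $\widehat{\Lambda}$ is the set of isomorphism classes $[M]$ of simple left $\Lambda$-modules; $\mathrm{Max}(R)$ is the set of maximal two-sided ideals of $R$; $V(f^p)$ is the set of prime ideals containing $f^p$; $\mathrm{ann}_\Lambda(M)$ is the annihilator of $M$. $A(a_1,\ldots,a_n)$ denotes the left ideal of $A$ generated by the listed elements (or sets). $F_i:=K[x]/(p_i)$ is a field and $\mathrm{Irr}_m(F_i[y])$ is the set of monic irreducible polynomials of the polynomial algebra $F_i[y]$. One has $\Lambda/\Lambda p_i\simeq F_i[y]$, and $(p_i,q_i)$ is the two-sided ideal of $\Lambda$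 containing $p_i$ whose image in $F_i[y]$ is generated by $q_i$. The maximal ideals of $\Lambda$ are the ideals $(p_i,q_i)$ ($1\le i\le s$, $q_i\in\mathrm{Irr}_m(F_i[y])$) and $\Lambda\mathfrak m$ with $\mathfrak m\in\mathrm{Max}(Z(\Lambda))\setminus V(f^p)$.
   Formalization: In 1, dim_K L(Λm)=p·dim_K(Z(Λ)/m) is asserted when K is perfect or Λ/Λm is not a division ring; in 2, K[y]/(q_i) becomes F_i[y]/(q_i) with dim_K L=deg(p_i)·deg_y(q_i), the printed form kept if deg p_i=1; the p_i are monic and f=c·∏p_i^{n_i}, c in K^*. *)

(* Defs.v *)
From HB Require Import structures.
From mathcomp Require Import all_boot all_order all_algebra all_field.
From mathcomp Require Import boolp classical_sets functions.

Set Implicit Arguments.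
Unset Strict Implicit.
Unset Printing Implicit Defensive.

Import GRing.Theory.
Local Open Scope ring_scope.
Local Open Scope classical_set_scope.

(* K[x][y; f d/dx]: the polynomial \sum_i a_i 'X^i over K[x] stands for
   \sum_i a_i y^i, with the coefficients a_i on the left. *)
Record ore (K : fieldType) (f : {poly K}) := Ore { ore_poly : {poly {poly K}} }.
Arguments ore {K} f.
Arguments Ore {K} f ore_poly.

Section OreExtension.
Variables (K : fieldType) (f : {poly K}).

Definition delta (g : {poly K}) : {poly K} := f * g^`().

Lemma delta_is_zmod : zmod_morphism delta.
Proof. by move=> a b; rewrite /delta derivB mulrBr. Qed.
HB.instance Definition _ :=
  GRing.isZmodMorphism.Build {poly K} {poly K} delta delta_is_zmod.

Lemma deltaM a b : delta (a * b) = delta a * b + a * delta b.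
Proof. by rewrite /delta derivM mulrDr !mulrA (mulrC f a). Qed.

Lemma deltaC c : delta c%:P = 0.
Proof. by rewrite /delta derivC mulr0. Qed.

Local Notation L := (ore f).

HB.instance Definition _ := [isNew for @ore_poly K f].
HB.instance Definition _ := [Choice of L by <:].

Definition ore_zero : L := Ore f 0.
Definition ore_opp (a : L) : L := Ore f (- ore_poly a).
Definition ore_add (a b : L) : L := Ore f (ore_poly a + ore_poly b).

Lemma ore_inj : injective (@ore_poly K f). Proof. exact: val_inj. Qed.

Lemma ore_addA : associative ore_add.
Proof. by move=> a b c; apply: ore_inj; rewrite /= addrA. Qed.
Lemma ore_addC : commutative ore_add.
Proof. by move=> a b; apply: ore_inj; rewrite /= addrC. Qed.
Lemma ore_add0 : left_id ore_zero ore_add.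
Proof. by move=> a; apply: ore_inj; rewrite /= add0r. Qed.
Lemma ore_addN : left_inverse ore_zero ore_opp ore_add.
Proof. by move=> a; apply: ore_inj; rewrite /= addNr. Qed.
HB.instance Definition _ :=
  GRing.isZmodule.Build L ore_addA ore_addC ore_add0 ore_addN.

Lemma ore_poly_is_zmod : zmod_morphism (@ore_poly K f). Proof. by []. Qed.
HB.instance Definition _ :=
  GRing.isZmodMorphism.Build L {poly {poly K}} (@ore_poly K f) ore_poly_is_zmod.

(* left multiplication by y: y * (\sum_j b_j y^j)
   = \sum_j b_j y^(j+1) + \sum_j delta(b_j) y^j *)
Definition ymul (b : {poly {poly K}}) : {poly {poly K}} :=
  b * 'X + map_poly delta b.

Definition pmul (a b : {poly {poly K}}) : {poly {poly K}} :=
  \sum_(i < size a) a`_i *: iter i ymul b.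

Definition ore_mul (a b : L) : L := Ore f (pmul (ore_poly a) (ore_poly b)).
Definition ore_one : L := Ore f 1.
Definition ore_scale (c : K) (a : L) : L := Ore f (c%:P *: ore_poly a).

Lemma ymul_is_zmod : zmod_morphism ymul.
Proof. by move=> a b; rewrite /ymul mulrBl raddfB opprD addrACA. Qed.
HB.instance Definition _ := GRing.isZmodMorphism.Build
  {poly {poly K}} {poly {poly K}} ymul ymul_is_zmod.

Lemma ymulZ c b : ymul (c *: b) = c *: ymul b + delta c *: b.
Proof.
rewrite /ymul scalerDr -scalerAl -addrA; congr (_ + _).
by apply/polyP => i; rewrite !(coefD, coefZ, coef_map) /= deltaM addrC.
Qed.

Lemma iter_ymul_is_zmod i : zmod_morphism (iter i ymul).
Proof. by elim: i => // i IH a b; rewrite !iterS IH raddfB. Qed.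
HB.instance Definition _ i := GRing.isZmodMorphism.Build
  {poly {poly K}} {poly {poly K}} (iter i ymul) (iter_ymul_is_zmod i).

Lemma pmul_wide n (a b : {poly {poly K}}) : (size a <= n)%N ->
  pmul a b = \sum_(i < n) a`_i *: iter i ymul b.
Proof.
move=> le_an; rewrite /pmul (big_ord_widen n (fun i => a`_i *: iter i ymul b)) //.
rewrite big_mkcond; apply: eq_bigr => i _; case: ltnP => // /(nth_default 0) ->.
by rewrite scale0r.
Qed.

Lemma pmulDl (a b c : {poly {poly K}}) : pmul (a + b) c = pmul a c + pmul b c.
Proof.
pose n := maxn (size a) (size b).
rewrite !(@pmul_wide n) ?leq_maxl ?leq_maxr ?size_polyD // -big_split /=.
by apply: eq_bigr => i _; rewrite coefD scalerDl.
Qed.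

Lemma pmulDr a b c : pmul a (b + c) = pmul a b + pmul a c.
Proof.
rewrite /pmul -big_split /=; apply: eq_bigr => i _.
by rewrite (raddfD (iter i ymul)) scalerDr.
Qed.

Lemma pmul0l b : pmul 0 b = 0.
Proof. by rewrite /pmul size_poly0 big_ord0. Qed.

Lemma pmul_suml (I : Type) (r : seq I) (F : I -> {poly {poly K}}) b :
  pmul (\sum_(i <- r) F i) b = \sum_(i <- r) pmul (F i) b.
Proof.
elim: r => [|i r IH]; first by rewrite !big_nil pmul0l.
by rewrite !big_cons pmulDl IH.
Qed.

Lemma pmulZ c a b : pmul (c *: a) b = c *: pmul a b.
Proof.
rewrite (@pmul_wide (size a)) ?size_scale_leq // scaler_sumr.
by apply: eq_bigr => i _; rewrite coefZ scalerA.
Qed.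

Lemma pmul_ymul a b : pmul (ymul a) b = ymul (pmul a b).
Proof.
rewrite {1}/ymul pmulDl.
rewrite (@pmul_wide (size a).+1) ?size_polyMleq //; last first.
  by apply: leq_trans (size_polyMleq _ _) _; rewrite size_polyX addnC.
rewrite (@pmul_wide (size a) (map_poly _ _)) ?size_poly //.
rewrite big_ord_recl coefMX eqxx scale0r add0r -big_split /=.
rewrite /pmul raddf_sum; apply: eq_bigr => i _ /=.
by rewrite ymulZ coefMX /= coef_map.
Qed.

Lemma pmul_iter i (a b : {poly {poly K}}) : pmul (iter i ymul a) b = iter i ymul (pmul a b).
Proof. by elim: i => // i IH; rewrite !iterS pmul_ymul IH. Qed.

Lemma pmulA : associative pmul.
Proof.
move=> a b c; rewrite [pmul a b]/pmul pmul_suml [LHS]/pmul.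
by apply: eq_bigr => i _; rewrite pmulZ pmul_iter.
Qed.

Lemma pmulC1 c b : pmul c%:P b = c *: b.
Proof.
by rewrite (@pmul_wide 1) ?size_polyC_leq1 // big_ord1 coefC eqxx.
Qed.

Lemma iter_ymul1 i : iter i ymul 1 = 'X^i.
Proof.
elim: i => [|i IH]; first by rewrite expr0.
rewrite iterS IH /ymul exprSr -[RHS]addr0; congr (_ + _).
apply/polyP => j; rewrite coef_map coefXn coef0 /=.
by case: eqP => _; rewrite -?polyC1 -?polyC0 deltaC.
Qed.

Lemma pmul1r : right_id 1 pmul.
Proof.
move=> a; rewrite /pmul -[RHS]coefK poly_def.
by apply: eq_bigr => i _; rewrite iter_ymul1.
Qed.

Lemma ore_mulA : associative ore_mul.
Proof. by move=> a b c; apply: ore_inj; rewrite /= pmulA. Qed.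
Lemma ore_mul1l : left_id ore_one ore_mul.
Proof. by move=> a; apply: ore_inj; rewrite /= pmulC1 scale1r. Qed.
Lemma ore_mul1r : right_id ore_one ore_mul.
Proof. by move=> a; apply: ore_inj; rewrite /= pmul1r. Qed.
Lemma ore_mulDl : left_distributive ore_mul +%R.
Proof. by move=> a b c; apply: ore_inj; rewrite /= pmulDl. Qed.
Lemma ore_mulDr : right_distributive ore_mul +%R.
Proof. by move=> a b c; apply: ore_inj; rewrite /= pmulDr. Qed.
Lemma ore_one_neq0 : ore_one != 0.
Proof. by rewrite -(inj_eq ore_inj) /= oner_eq0. Qed.
HB.instance Definition _ := GRing.Zmodule_isNzRing.Build L
  ore_mulA ore_mul1l ore_mul1r ore_mulDl ore_mulDr ore_one_neq0.

Lemma ore_scaleA a b v : ore_scale a (ore_scale b v) = ore_scale (a * b) v.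
Proof. by apply: ore_inj; rewrite /= scalerA -polyCM. Qed.
Lemma ore_scale1 : left_id 1 ore_scale.
Proof. by move=> v; apply: ore_inj; rewrite /= scale1r. Qed.
Lemma ore_scaleDr : right_distributive ore_scale +%R.
Proof. by move=> a u v; apply: ore_inj; rewrite /= scalerDr. Qed.
Lemma ore_scaleDl v : {morph ore_scale^~ v : a b / a + b}.
Proof. by move=> a b; apply: ore_inj; rewrite /= polyCD scalerDl. Qed.
HB.instance Definition _ := GRing.Zmodule_isLmodule.Build K L
  ore_scaleA ore_scale1 ore_scaleDr ore_scaleDl.

Lemma ore_scaleAl (c : K) (a b : L) : c *: (a * b) = (c *: a) * b.
Proof. by apply: ore_inj; rewrite /= pmulZ. Qed.
HB.instance Definition _ := GRing.Lmodule_isLalgebra.Build K L ore_scaleAl.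

Lemma iter_ymulC i (c : K) b :
  iter i ymul (c%:P *: b) = c%:P *: iter i ymul b.
Proof. by elim: i => // i IH; rewrite !iterS IH ymulZ deltaC scale0r addr0. Qed.

Lemma ore_scaleAr (c : K) (a b : L) : c *: (a * b) = a * (c *: b).
Proof.
apply: ore_inj; rewrite /= /pmul scaler_sumr; apply: eq_bigr => i _.
by rewrite iter_ymulC !scalerA mulrC.
Qed.
HB.instance Definition _ := GRing.Lalgebra_isAlgebra.Build K L ore_scaleAr.

Definition oreC (g : {poly K}) : L := Ore f g%:P.
Definition oreY : L := Ore f 'X.

Lemma oreC_is_zmod : zmod_morphism oreC.
Proof. by move=> a b; apply: ore_inj; rewrite /= polyCB. Qed.
HB.instance Definition _ := GRing.isZmodMorphism.Build {poly K} L oreC oreC_is_zmod.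
Lemma oreC_is_monoid : monoid_morphism oreC.
Proof.
by split=> [|a b]; apply: ore_inj; rewrite //= pmulC1 -mul_polyC polyCM.
Qed.
HB.instance Definition _ :=
  GRing.isMonoidMorphism.Build {poly K} L oreC oreC_is_monoid.

Lemma pmulX b : pmul 'X b = ymul b.
Proof.
rewrite /pmul size_polyX big_ord_recl big_ord1 !coefX /=.
by rewrite scale0r scale1r add0r.
Qed.

Lemma oreY_oreC g : oreY * oreC g = oreC g * oreY + oreC (delta g).
Proof.
apply: ore_inj; rewrite /= pmulX pmulC1 /ymul mul_polyC; congr (_ + _).
by apply/polyP=> i; rewrite coef_map !coefC /=; case: eqP; rewrite ?raddf0.
Qed.

End OreExtension.

Arguments oreC {K} f g.
Arguments oreY {K} f.
Arguments delta {K} f g.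
Arguments ymul {K} f b.
Notation Weyl K := (ore (1 : {poly K})).

Section Embedding.
Variables (K : fieldType) (f : {poly K}).

Definition fd : Weyl K := oreC 1 f * oreY 1.

(* x |-> x, y |-> f d, where d = oreY 1 *)
Definition to_weyl (a : ore f) : Weyl K :=
  (map_poly (oreC 1) (ore_poly a)).[fd].

Lemma to_weyl_is_zmod : zmod_morphism to_weyl.
Proof. by move=> a b; rewrite /to_weyl !raddfB hornerD hornerN. Qed.
HB.instance Definition _ :=
  GRing.isZmodMorphism.Build (ore f) (Weyl K) to_weyl to_weyl_is_zmod.

Lemma fd_oreC g : fd * oreC 1 g = oreC 1 g * fd + oreC 1 (delta f g).
Proof.
rewrite /fd -mulrA oreY_oreC mulrDr !mulrA -!rmorphM /= (mulrC f g).
by rewrite /delta mul1r.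
Qed.

Lemma to_weylZ g b :
  to_weyl (Ore f (g *: b)) = oreC 1 g * to_weyl (Ore f b).
Proof. by rewrite /to_weyl /= map_polyZ hornerZ. Qed.

Lemma to_weyl_ymul b : to_weyl (Ore f (ymul f b)) = fd * to_weyl (Ore f b).
Proof.
have deltaX q c : map_poly (delta f) (q * 'X + c%:P) =
    map_poly (delta f) q * 'X + (delta f c)%:P.
  apply/polyP => i; rewrite coef_map !coefD !coefMX !coefC coef_map raddfD /=.
  by congr (_ + _); case: eqP => _; rewrite ?raddf0.
have toX q (c : {poly K}) : (map_poly (oreC 1) (q * 'X + c%:P)).[fd] =
    (map_poly (oreC 1) q).[fd] * fd + oreC 1 c.
  by rewrite rmorphD rmorphM /= map_polyX map_polyC hornerD hornerMX hornerC.
have toD q r : (map_poly (oreC 1) (q + r)).[fd] =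
    (map_poly (oreC 1) q).[fd] + (map_poly (oreC 1) r).[fd].
  by rewrite rmorphD hornerD.
have toX0 q : (map_poly (oreC 1) (q * 'X)).[fd] = (map_poly (oreC 1) q).[fd] * fd.
  by rewrite rmorphM /= map_polyX hornerMX.
rewrite /to_weyl /= /ymul.
elim/poly_ind: b => [|q c IH].
  by rewrite mul0r !raddf0 addr0 /= map_poly0 horner0 mulr0.
rewrite toD toX0 deltaX !toX; move: IH; rewrite toD toX0 => IH.
rewrite mulrDr [fd * (_ * fd)]mulrA -IH fd_oreC !mulrDl -!addrA; congr (_ + _).
by rewrite addrCA.
Qed.

Lemma to_weyl_is_monoid : monoid_morphism to_weyl.
Proof.
split=> [|a b]; first by rewrite /to_weyl rmorph1 hornerC.
have iterE i c : to_weyl (Ore f (iter i (ymul f) c)) = fd ^+ i * to_weyl (Ore f c).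
  by elim: i => [|i IH]; rewrite ?mul1r // iterS to_weyl_ymul IH exprS mulrA.
have -> : a * b = \sum_(i < size (ore_poly a))
    Ore f ((ore_poly a)`_i *: iter i (ymul f) (ore_poly b)).
  by apply: ore_inj; rewrite raddf_sum.
rewrite raddf_sum /= [to_weyl a]/to_weyl.
rewrite (@horner_coef_wide _ (size (ore_poly a))) ?size_poly //.
rewrite mulr_suml; apply: eq_bigr => i _.
by rewrite to_weylZ iterE coef_map /= mulrA; case: (b).
Qed.
HB.instance Definition _ :=
  GRing.isMonoidMorphism.Build (ore f) (Weyl K) to_weyl to_weyl_is_monoid.

End Embedding.

Section Modules.
Variable R : nzRingType.
Implicit Types (V W N : lmodType R).

Definition submodule V (S : set V) : Prop :=
  S 0 /\ forall (a : R) u v, S u -> S v -> S (a *: u + v).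

Definition lspan V (X : set V) : set V :=
  [set v | exists n (a : 'I_n -> R) (e : 'I_n -> V),
    (forall i, X (e i)) /\ v = \sum_i a i *: e i].

Lemma lspan_submodule V (X : set V) : submodule (lspan X).
Proof.
split; first by exists 0, (fun=> 0), (fun=> 0); rewrite big_ord0; split=> // -[].
move=> c _ _ [n [a [e [Xe ->]]]] [m [b [g [Xg ->]]]].
exists (n + m)%N.
exists (fun i => match fintype.split i with inl j => c * a j | inr j => b j end).
exists (fun i => match fintype.split i with inl j => e j | inr j => g j end).
split=> [i|]; first by case: fintype.split.
rewrite big_split_ord /= scaler_sumr; congr (_ + _); apply: eq_bigr => i _.
  by rewrite -/(unsplit (inl i)) unsplitK scalerA.
by rewrite -/(unsplit (inr i)) unsplitK.
Qed.

Definition lspanb V (X : set V) : V -> bool := fun v => `[< lspan X v >].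

Lemma lspanb_zmod V (X : set V) : zmod_closed (lspanb X).
Proof.
have [S0 SD] := lspan_submodule X.
split=> [|u v /asboolP Su /asboolP Sv]; first exact/asboolP.
by apply/asboolP; rewrite addrC -scaleN1r; apply: SD.
Qed.
HB.instance Definition _ V (X : set V) :=
  GRing.isZmodClosed.Build V (lspanb X) (lspanb_zmod X).

Definition lspan_closed V (X : set V) : zmodClosed V :=
  GRing.ZmodClosed.clone V (lspanb X) _.

(* X is an arbitrary set: the quotient is by the submodule that it generates *)
Definition quotmod V (X : set V) : Type := Quotient.quot (lspan_closed X).

HB.instance Definition _ V (X : set V) := GRing.Zmodule.on (quotmod X).

Definition cls V (X : set V) (v : V) : quotmod X :=
  (\pi_(Quotient.quot (lspan_closed X)) v)%qT.

Lemma clsE V (X : set V) (u v : V) : cls X u = cls X v <-> lspan X (u - v).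
Proof.
split=> [/eqP|h]; first by rewrite -Quotient.idealrBE => /asboolP.
by apply/eqP; rewrite -Quotient.idealrBE; apply/asboolP.
Qed.

Definition quot_scale V (X : set V) (a : R) (q : quotmod X) : quotmod X :=
  cls X (a *: repr (q : Quotient.quot (lspan_closed X))).

Lemma cls_repr V (X : set V) (q : quotmod X) :
  cls X (repr (q : Quotient.quot (lspan_closed X))) = q.
Proof. exact: reprK. Qed.

Lemma cls_is_zmod V (X : set V) : zmod_morphism (cls X).
Proof. exact: (@raddfB V (Quotient.quot (lspan_closed X)) \pi%qT). Qed.
HB.instance Definition _ V (X : set V) :=
  GRing.isZmodMorphism.Build V (quotmod X) (cls X) (@cls_is_zmod V X).

Lemma quot_scale_cls V (X : set V) a v :
  quot_scale a (cls X v) = cls X (a *: v).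
Proof.
have [S0 SD] := lspan_submodule X.
apply/clsE; rewrite -scalerBr -[_ *: _]addr0; apply: SD => //.
by apply/clsE; rewrite cls_repr.
Qed.

Lemma quot_scaleA V (X : set V) a b (q : quotmod X) :
  quot_scale a (quot_scale b q) = quot_scale (a * b) q.
Proof. by rewrite -[q]cls_repr !quot_scale_cls scalerA. Qed.
Lemma quot_scale1 V (X : set V) : left_id 1 (@quot_scale V X).
Proof. by move=> q; rewrite -[q]cls_repr !quot_scale_cls scale1r. Qed.
Lemma quot_scaleDr V (X : set V) : right_distributive (@quot_scale V X) +%R.
Proof.
move=> a q r; rewrite -[q]cls_repr -[r]cls_repr -raddfD !quot_scale_cls.
by rewrite scalerDr raddfD.
Qed.
Lemma quot_scaleDl V (X : set V) (q : quotmod X) :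
  {morph (@quot_scale V X)^~ q : a b / a + b}.
Proof.
by move=> a b; rewrite -[q]cls_repr !quot_scale_cls scalerDl raddfD.
Qed.
HB.instance Definition _ V (X : set V) :=
  GRing.Zmodule_isLmodule.Build R (quotmod X)
    (@quot_scaleA V X) (@quot_scale1 V X) (@quot_scaleDr V X) (@quot_scaleDl V X).

Definition iso V W : Prop := exists g : {linear V -> W}, bijective g.

Definition simple N : Prop :=
  (exists v : N, v != 0) /\
  forall S : set N, submodule S -> S = [set 0] \/ S = setT.

Definition is_submodule_of N V : Prop := exists g : {linear N -> V}, injective g.
Definition is_factor_of N V : Prop :=
  exists g : {linear V -> N}, forall w, exists v, g v = w.
Definition is_summand_of N V : Prop := exists N' : lmodType R, iso V (N * N')%type.

Definition ann N : set R := [set a | forall v : N, a *: v = 0].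

(* A class of R-modules is a predicate on lmodType R (a type that lives too
   high in the universe hierarchy for [set]), and two classes are compared
   extensionally. *)
Definition same_class (C D : lmodType R -> Prop) : Prop := forall N, C N <-> D N.

Definition is_simple_class (C : lmodType R -> Prop) : Prop :=
  exists2 N, simple N & same_class C (iso N).

Definition is_basis (V : lmodType R) (d : nat) (e : 'I_d -> V) : Prop :=
  forall v, exists! c : 'rV[R]_d, v = \sum_i c 0 i *: e i.

End Modules.

(* R / R(X), with R(X) the left ideal generated by X *)
Notation lquot R X := (@quotmod R R^o X).

(* restriction of scalars along g; K-dimensions of A-modules are taken along
   K -> A *)
Definition restr (R S : nzRingType) (g : {rmorphism R -> S}) (N : lmodType S) :
  Type := N.

Section Restriction.
Variables (R S : nzRingType) (g : {rmorphism R -> S}) (N : lmodType S).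

HB.instance Definition _ := GRing.Zmodule.on (restr g N).

Definition restr_scale (a : R) (v : restr g N) : restr g N := g a *: (v : N).

Lemma restr_scaleA a b (v : restr g N) :
  restr_scale a (restr_scale b v) = restr_scale (a * b) v.
Proof. by rewrite /restr_scale scalerA rmorphM. Qed.
Lemma restr_scale1 : left_id 1 restr_scale.
Proof. by move=> v; rewrite /restr_scale rmorph1 scale1r. Qed.
Lemma restr_scaleDr : right_distributive restr_scale +%R.
Proof. by move=> a u v; rewrite /restr_scale scalerDr. Qed.
Lemma restr_scaleDl (v : restr g N) : {morph restr_scale^~ v : a b / a + b}.
Proof. by move=> a b; rewrite /restr_scale rmorphD scalerDl. Qed.
HB.instance Definition _ := GRing.Zmodule_isLmodule.Build R (restr g N)
  restr_scaleA restr_scale1 restr_scaleDr restr_scaleDl.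

End Restriction.

Definition has_dim (K : nzRingType) (V : lmodType K) (d : nat) : Prop :=
  exists e : 'I_d -> V, is_basis e.

Definition has_dimK (K : fieldType) (A : algType K) (N : lmodType A) (d : nat) :
  Prop := has_dim (restr (in_alg A) N) d.

Section Ideals.
Variable R : nzRingType.

Definition two_sided (I : set R) : Prop :=
  [/\ I 0, forall a b, I a -> I b -> I (a + b) &
      forall a b, I b -> I (a * b) /\ I (b * a)].

Definition Max : set (set R) := [set I | two_sided I /\ ~ I 1 /\
  forall J, two_sided J -> ~ J 1 -> I `<=` J -> J = I].

(* R / I is isomorphic to a full matrix ring over a division ring *)
Definition matrix_quotient (I : set R) : Prop :=
  exists (D : unitRingType) (n : nat) (g : {rmorphism R -> 'M[D]_n.+1}),
    [/\ forall d : D, d != 0 -> d \is a GRing.unit,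
        forall b, exists a, g a = b & forall a, g a = 0 <-> I a].

Definition division_quotient (I : set R) : Prop :=
  forall a, ~ I a -> exists b, I (b * a - 1) /\ I (a * b - 1).

(* the class of L(I) *)
Definition Lclass (I : set R) (N : lmodType R) : Prop :=
  simple N /\ is_submodule_of N (lquot R I).

(* iota : R -> S is the localization of R at the powers of the central
   element c *)
Definition is_localization (S : nzRingType) (c : R) (iota : {rmorphism R -> S}) :
  Prop :=
  [/\ exists u, u * iota c = 1 /\ iota c * u = 1,
      forall b, exists n a, b * iota c ^+ n = iota a &
      forall a, iota a = 0 <-> exists n, c ^+ n * a = 0].

End Ideals.

Arguments Max {R}.

Definition prime_ideal (Z : comNzRingType) (P : set Z) : Prop :=
  [/\ two_sided P, ~ P 1 & forall a b, P (a * b) -> P a \/ P b].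

Section Centre.
Variables (K : fieldType) (A : algType K).

Definition centralb : {pred A} := fun z => `[< forall a, z * a = a * z >].

Lemma centralbP z : reflect (forall a, z * a = a * z) (z \in centralb).
Proof. exact: asboolP. Qed.

Lemma central_subalg : subalg_closed centralb.
Proof.
split=> [|c u v /centralbP hu /centralbP hv|u v /centralbP hu /centralbP hv].
- by apply/centralbP => a; rewrite mul1r mulr1.
- apply/centralbP => a.
  by rewrite mulrDl mulrDr -scalerAl -scalerAr hu hv.
- by apply/centralbP => a; rewrite -mulrA hv mulrA hu mulrA.
Qed.
HB.instance Definition _ := GRing.isSubalgClosed.Build K A centralb central_subalg.

Record centre := Centre { centre_val :> A; centre_valP : centre_val \in centralb }.

HB.instance Definition _ := [isSub for centre_val].
HB.instance Definition _ := [Choice of centre by <:].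
HB.instance Definition _ := [SubChoice_isSubAlgebra of centre by <:].

Lemma centre_mulC : @commutative centre centre *%R.
Proof. by move=> u v; apply/val_inj/centralbP/centre_valP. Qed.
HB.instance Definition _ := GRing.PzRing_hasCommutativeMul.Build centre centre_mulC.

(* V(a), for an element a of A that lies in the centre *)
Definition Vset (a : A) : set (set centre) :=
  [set P | prime_ideal P /\ (val @` P) a].

(* A m; a two-sided ideal, since m is central *)
Definition extend (m : set centre) : set A := lspan (val @` m : set A^o).

End Centre.

Section Reduction.
Variables (K : fieldType) (f p : {poly K}) (hp : monic_irreducible_poly p).

(* the map from K[x][y; f d/dx] to F[y], F = K[x]/(p), for p dividing f *)
Definition reduce (a : ore f) : {poly {poly %/ p with hp}} :=
  map_poly (in_qpoly p : {poly K} -> {poly %/ p with hp}) (ore_poly a).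

(* the ideal (p, q), as the preimage of the ideal of F[y] generated by q *)
Definition pq_ideal (q : {poly {poly %/ p with hp}}) : set (ore f) :=
  [set a | q %| reduce a].

End Reduction.

(* Main.v *)
(* Idea.  In characteristic p the elements x^p and w = y^p - e y, with
   e = (delta^(p-1) x)', are central, and Lambda is generated by the p^2 monomials
   y^j x^i over its centre.  Hence simple modules are finite dimensional, by Zariski's
   lemma for two generators, proved with the determinant trick.  A finite dimensional
   simple module N with a minimal family v_1, ..., v_n separating Lambda / ann N gives
   Lambda / ann N = N^n, so that a simple module is determined by its annihilator.

   Let m be a maximal ideal of the centre not containing f^p, so that f is invertible
   modulo Lambda m.  Commutators with x and y lower degrees and isolate leading
   coefficients: a two-sided ideal containing Lambda m and a combination of the
   monomials contains its coefficients.  So Lambda m is maximal and the monomials form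
   a basis of Lambda / Lambda m over Z / m.  If N has dimension r over Z / m then
   n r = p^2; here r <> 1, since f would act as a commutator of scalars, and n = 1
   only for a division ring, which is excluded over a perfect field because x - w is
   nilpotent when x^p = w^p. *)
Require Import Defs.
From HB Require Import structures.
From mathcomp Require Import all_boot all_order all_algebra all_field.
From mathcomp Require Import boolp classical_sets functions.

Set Implicit Arguments.
Unset Strict Implicit.
Unset Printing Implicit Defensive.

Import GRing.Theory.
Local Open Scope ring_scope.
Local Open Scope classical_set_scope.

(** * Submodules, quotients and simple modules *)

(** The centre is never computed. Besides [x^p] and [w] only [e] is needed for spanning, and [e] is
    a polynomial in [x^p] because its derivative vanishes. Freeness of the monomials is shown only
    modulo ideals that make [f] invertible: [[y, x] = f], so each lowering of degree costs a factor
    [f] and an integer below [p]. The same lowering serves two-sided ideals and, for the explicit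
    module with a root of the central character, a left ideal stable under commutation with [x].
    That [Z / m] is finite over [K] is deduced from its action on a finite dimensional simple
    module. If [Lambda / Lambda m] is a division ring, its simple module is the whole quotient, of
    dimension [p^2 d] instead of [p d]; this occurs for [K = F_p(s,t)], [f = x] and [m] generated by
    [x^p - s] and [x^p d^p - s t] (with [d] the derivation of the Weyl algebra), whence the
    alternative in the dimension formula. Likewise the dimension over [K] at [(p_i, q_i)] carries
    the factor [deg p_i = [F_i : K]], and equals [deg q_i] when [p_i] is linear. *)

Lemma inj_surj_bij (A B : Type) (g : A -> B) :
  injective g -> (forall b, exists a, g a = b) -> bijective g.
Proof.
by move=> gI /choice[h gK]; exists h => // a; apply: gI; rewrite gK.
Qed.

Section ModuleTheory.
Variable R : nzRingType.
Implicit Types (V W N : lmodType R).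

Lemma submoduleZ V (S : set V) a v : submodule S -> S v -> S (a *: v).
Proof. by move=> [S0 SD] Sv; rewrite -[_ *: _]addr0; apply: SD. Qed.

Lemma submoduleD V (S : set V) u v : submodule S -> S u -> S v -> S (u + v).
Proof. by move=> [_ SD] Su Sv; rewrite -[u]scale1r; apply: SD. Qed.

Lemma submoduleB V (S : set V) u v : submodule S -> S u -> S v -> S (u - v).
Proof.
by move=> SS Su Sv; apply: submoduleD => //; rewrite -scaleN1r; apply: submoduleZ.
Qed.

Lemma submodule_sum V (S : set V) (I : Type) (r : seq I) (F : I -> V) :
  submodule S -> (forall i, S (F i)) -> S (\sum_(i <- r) F i).
Proof. by move=> SS SF; elim/big_ind: _ => // [|u v]; [case: SS|exact: submoduleD]. Qed.

Lemma lspan_sub V (X : set V) : X `<=` lspan X.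
Proof.
by move=> v Xv; exists 1%N, (fun=> 1), (fun=> v); rewrite big_ord1 scale1r.
Qed.

Lemma lspan_min V (X S : set V) : submodule S -> X `<=` S -> lspan X `<=` S.
Proof.
move=> SS XS _ [n [a [e [Xe ->]]]]; apply: submodule_sum => // i.
by apply: submoduleZ => //; apply: XS.
Qed.

Lemma lspan_id V (S : set V) : submodule S -> lspan S = S.
Proof. by move=> SS; apply/seteqP; split; [exact: lspan_min|exact: lspan_sub]. Qed.

Lemma cls_eq0 V (X : set V) v : cls X v = 0 <-> lspan X v.
Proof. by rewrite -[v in lspan _ v]subr0 -clsE raddf0. Qed.

Lemma clsZ V (X : set V) a v : cls X (a *: v) = a *: cls X v.
Proof. by rewrite -quot_scale_cls. Qed.

HB.instance Definition _ V (X : set V) :=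
  GRing.isScalable.Build R V (quotmod X) *:%R (cls X) (@clsZ V X).

Lemma cls_surj V (X : set V) (q : quotmod X) : exists v, cls X v = q.
Proof. by exists (repr (q : Quotient.quot (lspan_closed X))); rewrite cls_repr. Qed.

Lemma quot_lift V W (X : set V) (g : {linear V -> W}) : (forall v, X v -> g v = 0) ->
  exists h : {linear quotmod X -> W}, forall v, h (cls X v) = g v.
Proof.
move=> gX.
have ker : forall v, lspan X v -> g v = 0.
  by apply: lspan_min => //; split=> [|a u v gu gv]; rewrite ?raddf0 // linearP gu gv scaler0 addr0.
pose h (q : quotmod X) := g (repr (q : Quotient.quot (lspan_closed X))).
have hE v : h (cls X v) = g v.
  apply/eqP; rewrite -subr_eq0 -raddfB; apply/eqP/ker/clsE; exact: cls_repr.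
have hlin : linear h.
  move=> a q r; have [u <-] := cls_surj q; have [v <-] := cls_surj r.
  by rewrite -linearP !hE linearP.
pose H := GRing.isLinear.Build _ _ _ _ h hlin.
pose h' : {linear quotmod X -> W} := HB.pack h H.
by exists h'.
Qed.

Lemma quot_iso V W (X : set V) (g : {linear V -> W}) :
  (forall v, g v = 0 <-> lspan X v) -> (forall w, exists v, g v = w) ->
  exists h : {linear quotmod X -> W}, bijective h /\ forall v, h (cls X v) = g v.
Proof.
move=> gX gs; have [v Xv|h hE] := @quot_lift V W X g.
  by apply/gX/lspan_sub.
exists h; split => //; apply: inj_surj_bij => [q r|w]; last first.
  by have [v <-] := gs w; exists (cls X v).
have [u <-] := cls_surj q; have [v <-] := cls_surj r.
by rewrite !hE => /eqP; rewrite -subr_eq0 -raddfB => /eqP/gX/clsE.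
Qed.

Lemma iso_sym V W : iso V W -> iso W V.
Proof.
case=> g [h gK hK].
have hlin : linear h by move=> a u v; apply: (can_inj gK); rewrite linearP !hK.
pose H := GRing.isLinear.Build _ _ _ _ h hlin.
by exists (HB.pack h H : {linear W -> V}); exists g.
Qed.

Lemma iso_trans V W N : iso V W -> iso W N -> iso V N.
Proof. by case=> g gb [h hb]; exists (h \o g); apply: bij_comp. Qed.

Lemma cyclic_submodule V (v : V) : submodule [set u | exists a : R, u = a *: v].
Proof.
split=> [|a _ _ [b ->] [c ->]]; first by exists 0; rewrite scale0r.
by exists (a * b + c); rewrite scalerDl scalerA.
Qed.

Lemma simple_gen N (v : N) : simple N -> v != 0 -> forall u, exists a : R, u = a *: v.
Proof.
move=> [_ sN] v0 u; have [S0|ST] := sN _ (cyclic_submodule v).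
  have : [set u | exists a : R, u = a *: v] v by exists 1; rewrite scale1r.
  by rewrite S0 => /eqP; rewrite (negPf v0).
by have : [set: N] u by []; rewrite -ST.
Qed.

Lemma simple_cyclic N : (exists v : N, v != 0) ->
  (forall v : N, v != 0 -> forall u, exists a : R, u = a *: v) -> simple N.
Proof.
move=> N0 gen; split=> // S SS; case: (pselect (exists2 v, S v & v != 0)).
  move=> [v Sv /gen vg]; right; apply/seteqP; split=> // u _.
  by have [a ->] := vg u; apply: submoduleZ.
move=> nS; left; apply/seteqP; split=> [v Sv|_ ->]; last by case: SS.
by apply/eqP/negPn/negP => v0; apply: nS; exists v.
Qed.

Lemma schur N W (g : {linear N -> W}) : simple N -> simple W ->
  (exists v, g v != 0) -> bijective g.
Proof.
move=> sN sW [v gv0]; apply: inj_surj_bij => [x y|w]; last first.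
  by have [a ->] := simple_gen sW gv0 w; exists (a *: v); rewrite linearZ.
move/eqP; rewrite -subr_eq0 -raddfB => gxy.
apply/eqP; rewrite -subr_eq0; apply/negP => /negP xy0.
have [a va] := simple_gen sN xy0 v.
by move: gv0; rewrite va linearZ /= (eqP gxy) scaler0 eqxx.
Qed.

Lemma iso_simple V W : iso V W -> simple V -> simple W.
Proof.
move=> [g [h gK hK]] sV; have [[v v0] _] := sV; apply: simple_cyclic.
  by exists (g v); apply: contra v0 => /eqP gv0; rewrite -(gK v) gv0 -(raddf0 g) gK.
move=> w w0 u; have hw : h w != 0.
  by apply: contra w0 => /eqP h0; rewrite -(hK w) h0 raddf0.
by have [a ha] := simple_gen sV hw (h u); exists a; rewrite -[u]hK ha linearZ hK.
Qed.

Lemma two_sided_submodule (I : set R) : two_sided I -> submodule (I : set R^o).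
Proof. by case=> I0 ID IM; split=> // a u v Iu Iv; apply: ID => //; have [] := IM a u Iu. Qed.

Lemma ann_two_sided N : two_sided (ann N).
Proof.
split=> [v|a b Ia Ib v|a b Ib]; first by rewrite scale0r.
  by rewrite scalerDl Ia Ib addr0.
by split=> v; rewrite -scalerA Ib ?scaler0.
Qed.

Lemma ann_quot (I : set R) : two_sided I -> I `<=` ann (lquot R I).
Proof.
move=> tI a Ia q; have [v <-] := cls_surj q; rewrite -clsZ; apply/cls_eq0/lspan_sub.
by case: tI => _ _ /(_ v a Ia)[].
Qed.

Lemma ann_simple_max (M : set R) N : Max M -> simple N -> M `<=` ann N -> ann N = M.
Proof.
move=> [_ [_ maxM]] [[v v0] _] MN; apply: maxM => //; first exact: ann_two_sided.
by move=> /(_ v); rewrite scale1r; apply/eqP.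
Qed.

Lemma max_left_ideal (I : set R) : submodule (I : set R^o) -> ~ I 1 ->
  exists J : set R^o, [/\ submodule J, ~ J 1, I `<=` J &
    forall J' : set R^o, submodule J' -> ~ J' 1 -> J `<=` J' -> J' = J].
Proof.
move=> sI I1.
(* [Zorn_bigcup] also asks about the empty chain, whose union is [set0]; the first disjunct admits
   it. A maximal [J] is not [set0], which lies properly inside [I]. *)
pose P (J : set R^o) := J = set0 \/ [/\ submodule J, ~ J 1 & I `<=` J].
have [F FP Ftot|J [PJ Jmax]] := @Zorn_bigcup R^o P.
  case: (pselect (exists2 J, F J & J !=set0)) => [[J0 FJ0 J0n]|nF]; last first.
    left; apply/seteqP; split=> // v [J FJ Jv]; case: nF.
    by exists J => //; exists v.
  have FP' J : F J -> J !=set0 -> [/\ submodule J, ~ J 1 & I `<=` J].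
    by move=> /FP[->|//] [].
  right; have [[J00 _] _ IJ0] := FP' _ FJ0 J0n; split.
  - split=> [|a u v [J FJ Ju] [J' FJ' J'v]]; first by exists J0.
    have [JJ|JJ] := Ftot _ _ FJ FJ'.
      by exists J' => //; have [[_ h] _ _] := FP' J' FJ' (ex_intro _ v J'v); apply: h => //; apply: JJ.
    by exists J => //; have [[_ h] _ _] := FP' J FJ (ex_intro _ u Ju); apply: h => //; apply: JJ.
  - by move=> [J FJ J1]; have [_ h _] := FP' J FJ (ex_intro _ 1 J1).
  - by move=> v /IJ0; exists J0.
have nJ : J != set0.
  apply/negP => /eqP J0; apply: (Jmax I); last by right; split.
  rewrite J0 properEneq; split; last by [].
  by apply/eqP => I0; case: sI => h _; rewrite -I0 in h.
case: PJ => [/eqP|[sJ J1 IJ]]; first by rewrite (negPf nJ).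
exists J; split => // J' sJ' J'1 JJ'; apply: contrapT => neq.
apply: (Jmax J'); first by rewrite properEneq; split => //; apply/eqP => h; apply: neq.
by right; split => //; apply: subset_trans JJ'.
Qed.

(** Divide by a maximal left ideal above [I]: since [I] is two-sided, [I] times any element falls
    back into [I]. *)
Lemma exists_simple (I : set R) : two_sided I -> ~ I 1 ->
  exists N : lmodType R, simple N /\ I `<=` ann N.
Proof.
move=> tI I1; have [J [sJ J1 IJ Jmax]] := max_left_ideal (two_sided_submodule tI) I1.
exists (lquot R J); split.
  apply: simple_cyclic.
    exists (cls J 1); apply/eqP => /cls_eq0; by rewrite lspan_id.
  move=> q q0 r; have [v vq] := cls_surj q; have [u <-] := cls_surj r.
  (* [J'] is the left ideal [R v + J]. By maximality of [J] it contains 1, so the class of [v]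
     generates the quotient. *)
  rewrite -vq in q0 *; pose J' := [set w | exists a j, J j /\ w = a * v + j].
  have sJ' : submodule (J' : set R^o).
    split=> [|a _ _ [b [j [Jj ->]]] [b' [j' [Jj' ->]]]].
      by exists 0, 0; rewrite mul0r addr0; case: sJ.
    exists (a * b + b'), (a *: j + j'); split; first by case: sJ => _; apply.
    by rewrite scalerDr mulrDl !addrA -mulrA; congr (_ + _); rewrite -!addrA; congr (_ + _); rewrite addrC.
  case: (pselect (J' 1)) => [[a [j [Jj E]]]|J'1].
    exists (u * a); rewrite -clsZ; apply/clsE; rewrite lspan_id //.
    have -> : u - (u * a) *: v = u *: j.
      by rewrite -[u in u - _]mulr1 E mulrDr !mulrA addrAC subrr add0r.
    exact: submoduleZ.
  have JJ' : J `<=` J' by move=> j Jj; exists 0, j; rewrite mul0r add0r.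
  have := Jmax _ sJ' J'1 JJ' => E; case/eqP: q0; apply/cls_eq0.
  by rewrite lspan_id // -E; exists 1, 0; rewrite mul1r addr0; case: sJ.
move=> a Ia q; have [v <-] := cls_surj q; rewrite -clsZ; apply/cls_eq0/lspan_sub.
by apply: IJ; case: tI => _ _ /(_ v a Ia)[].
Qed.

End ModuleTheory.

(** * Density *)

Section Density.
Variable R : nzRingType.
Implicit Types (V W N : lmodType R).

(** This is the only form in which finiteness of [N] enters the density arguments, so that they make
    sense over any ring. *)
Definition separates N n (v : 'I_n -> N) : Prop :=
  forall a : R, (forall i, a *: v i = 0) -> ann N a.

Definition dense_in N n (v : 'I_n -> N) : Prop :=
  forall u : 'I_n -> N, exists a : R, forall i, a *: v i = u i.

(** Take a separating family of least length. For an index [j], the multiples [a v_j] by elements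
    [a] killing the other vectors form a submodule, hence 0 or all of [N]. It is not 0, for
    otherwise the family without [v_j] would still separate. So each coordinate can be prescribed
    independently of the others. *)
Lemma dense_family N : simple N -> (exists n (v : 'I_n -> N), separates v) ->
  exists n (v : 'I_n.+1 -> N), separates v /\ dense_in v.
Proof.
move=> sN [n0 sep0].
have Pex : exists n, `[< exists v : 'I_n -> N, separates v >].
  by exists n0; apply/asboolP.
case: (ex_minnP Pex) => -[|n] /asboolP[v sepv] nmin.
  have [[w /eqP w0] _] := sN; case: w0.
  have /(_ w) : ann N (1 : R) by apply: sepv => -[].
  by rewrite scale1r.
exists n, v; split=> // u.
have unit_row j : exists a : R, forall i, a *: v i = if i == j then u j else 0.
  pose S := [set w | exists a : R, (forall i, i != j -> a *: v i = 0) /\ w = a *: v j].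
  have sS : submodule S.
    split=> [|a _ _ [b [bv ->]] [c [cv ->]]].
      by exists 0; split=> [i _|]; rewrite scale0r.
    exists (a * b + c); split=> [i ij|]; last by rewrite scalerDl scalerA.
    by rewrite scalerDl -scalerA bv // cv // scaler0 addr0.
  have [_ /(_ S sS)[S0|ST]] := sN; last first.
    have : S (u j) by rewrite ST.
    case=> a [av ->]; exists a => i; case: eqP => [->//|/eqP]; exact: av.
  suff : (n.+1 <= n)%N by rewrite ltnn.
  apply: nmin; apply/asboolP; exists (v \o lift j) => a av; apply: sepv => i.
  have [->|ij] := eqVneq i j; last first.
    by rewrite eq_sym in ij; have [k -> _] := unlift_some ij; exact: (av k).
  have : S (a *: v j).
    exists a; split=> // k kj; rewrite eq_sym in kj.
    by have [l -> _] := unlift_some kj; exact: (av l).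
  by rewrite S0.
have [a aE] := choice unit_row; exists (\sum_j a j) => i.
rewrite scaler_suml (bigD1 i) //= aE eqxx big1 ?addr0 // => j ji.
by rewrite aE eq_sym (negPf ji).
Qed.

Definition eval_family N n (v : 'I_n -> N) (a : R^o) : {ffun 'I_n -> N} :=
  [ffun i => (a : R) *: v i].

Lemma eval_family_linear N n (v : 'I_n -> N) : linear (eval_family v).
Proof. by move=> a b c; apply/ffunP => i; rewrite !ffunE scalerDl scalerA. Qed.

HB.instance Definition _ N n (v : 'I_n -> N) :=
  GRing.isLinear.Build R R^o {ffun 'I_n -> N} _ (eval_family v) (eval_family_linear v).

Lemma quot_ann_iso N n (v : 'I_n -> N) : separates v -> dense_in v ->
  iso (lquot R (ann N)) {ffun 'I_n -> N}.
Proof.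
move=> sv dv; have [a|w|h [hb _]] := @quot_iso R R^o _ (ann N) (eval_family v).
- rewrite lspan_id; last exact/two_sided_submodule/ann_two_sided.
  split=> [a0|aN]; last by apply/ffunP => i; rewrite !ffunE aN.
  by apply: sv => i; move/ffunP/(_ i): a0; rewrite !ffunE.
- by have [a aE] := dv w; exists a; apply/ffunP => i; rewrite ffunE aE.
- by exists h.
Qed.

Definition coord_inj N n (j : 'I_n) (w : N) : {ffun 'I_n -> N} :=
  [ffun i => if i == j then w else 0].

Lemma coord_inj_linear N n (j : 'I_n) : linear (@coord_inj N n j).
Proof.
by move=> a b c; apply/ffunP => i; rewrite !ffunE; case: ifP; rewrite // scaler0 addr0.
Qed.

HB.instance Definition _ N n (j : 'I_n) :=
  GRing.isLinear.Build R N {ffun 'I_n -> N} _ (@coord_inj N n j) (@coord_inj_linear N n j).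

Lemma sum_coord_inj N n (w : {ffun 'I_n -> N}) : w = \sum_j coord_inj j (w j).
Proof.
apply/ffunP => i; rewrite sum_ffunE (bigD1 i) //= ffunE eqxx big1 ?addr0 // => j ji.
by rewrite ffunE eq_sym (negPf ji).
Qed.

Definition coord_proj N n (j : 'I_n) (w : {ffun 'I_n -> N}) : N := w j.

Lemma coord_proj_linear N n (j : 'I_n) : linear (@coord_proj N n j).
Proof. by move=> a b c; rewrite /coord_proj !ffunE. Qed.

HB.instance Definition _ N n (j : 'I_n) :=
  GRing.isLinear.Build R {ffun 'I_n -> N} N _ (@coord_proj N n j) (@coord_proj_linear N n j).

Definition uncons N n (w : {ffun 'I_n.+1 -> N}) : N * {ffun 'I_n -> N} :=
  (w ord0, [ffun i => w (lift ord0 i)]).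

Lemma uncons_linear N n : linear (@uncons N n).
Proof.
move=> a b c; rewrite /uncons !ffunE; congr (_, _).
by apply/ffunP => i; rewrite !ffunE.
Qed.

HB.instance Definition _ N n :=
  GRing.isLinear.Build R {ffun 'I_n.+1 -> N} (N * {ffun 'I_n -> N})%type _
    (@uncons N n) (@uncons_linear N n).

Lemma uncons_iso N n : iso {ffun 'I_n.+1 -> N} (N * {ffun 'I_n -> N})%type.
Proof.
exists (@uncons N n); apply: inj_surj_bij => [w w' [E0 /ffunP E]|[x w]].
  apply/ffunP => i; case: (unliftP ord0 i) => [j|] -> //.
  by have := E j; rewrite !ffunE.
exists [ffun i => if unlift ord0 i is Some j then w j else x].
rewrite /= /uncons; congr (_, _); first by rewrite ffunE unlift_none.
by apply/ffunP => i; rewrite !ffunE liftK.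
Qed.

Section SimpleQuotient.
Variables (N : lmodType R) (sN : simple N).
Hypothesis finN : exists n (v : 'I_n -> N), separates v.

Lemma simple_power : exists n, iso (lquot R (ann N)) {ffun 'I_n.+1 -> N}.
Proof.
by have [n [v [sv dv]]] := dense_family sN finN; exists n; apply: quot_ann_iso dv.
Qed.

Lemma simple_submodule : is_submodule_of N (lquot R (ann N)).
Proof.
have [n /iso_sym[g gb]] := simple_power; exists (g \o @coord_inj N n.+1 ord0).
by move=> x y /(bij_inj gb) /ffunP/(_ ord0); rewrite /= /coord_inj !ffunE eqxx.
Qed.

Lemma simple_summand : is_summand_of N (lquot R (ann N)).
Proof.
have [n ni] := simple_power; exists {ffun 'I_n -> N}.
exact: iso_trans ni (uncons_iso N n).
Qed.

Lemma simple_factor : is_factor_of N (lquot R (ann N)).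
Proof.
have [n [g [h _ hK]]] := simple_power; exists (@coord_proj N n.+1 ord0 \o g) => w.
exists (h [ffun=> w]); by rewrite /= hK /coord_proj ffunE.
Qed.

(** A nonzero vector of [N'] gives a nonzero map from [R / ann N], a power of [N], to [N']. It is
    nonzero on some coordinate copy of [N], where Schur's lemma applies. *)
Lemma simple_iso N' : simple N' -> ann N `<=` ann N' -> iso N N'.
Proof.
move=> sN' NN'; have [n /iso_sym[g [h gK hK]]] := simple_power.
have [[w w0] _] := sN'.
pose f (a : R^o) : N' := (a : R) *: w.
have f_lin : linear f by move=> a b c; rewrite /f scalerDl scalerA.
pose F : {linear R^o -> N'} := HB.pack f (GRing.isLinear.Build _ _ _ _ f f_lin).
have [a aN|k kE] := @quot_lift R R^o _ (ann N) F; first exact: NN'.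
have [j kj] : exists j, exists x, k (g (coord_inj j x)) != 0.
  apply: contrapT => nj; case/eqP: w0; rewrite -[w]scale1r -[LHS](kE 1).
  rewrite -[cls _ 1]hK [h _]sum_coord_inj !raddf_sum big1 // => j _ /=.
  apply/eqP/negPn/negP => x0; apply: nj; exists j; by eexists; exact: x0.
by exists (k \o (g \o @coord_inj N n.+1 j)); apply: schur.
Qed.

(** Modulo [ann N] the ring is a matrix ring. From one element of [J] acting nontrivially, density
    manufactures inside [J] the projections to the vectors of the family, and these add up to 1. *)
Lemma ann_max : Max (ann N).
Proof.
split; first exact: ann_two_sided.
split=> [h|J tJ J1 NJ].
  by have [[v /eqP v0] _] := sN; apply: v0; rewrite -[v]scale1r h.
have [n [v [sv dv]]] := dense_family sN finN.
apply/seteqP; split=> // a Ja; apply: contrapT => aN.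
have [w aw] : exists w : N, a *: w != 0.
  apply: contrapT => h; apply: aN => w; apply/eqP/negPn/negP => aw; apply: h.
  by exists w.
have [_ JD JM] := tJ.
have Jv i : exists b, J b /\ forall j, b *: v j = if j == i then v j else 0.
  have vi0 : v i != 0.
    apply/eqP => vi0; have [[x /eqP x0] _] := sN; apply: x0.
    by have [b /(_ i)] := dv (fun=> x); rewrite vi0 scaler0.
  have [b wb] := simple_gen sN vi0 w.
  have [c cE] := simple_gen sN aw (v i).
  have [e eE] := dv (fun j => if j == i then v i else 0).
  (* Read from the right: [e] keeps only the [i]-th vector, [b] moves it to [w], [a] does not kill
     it, and [c] brings it back to [v i]. *)
  exists (c * a * b * e); split=> [|j]; first by apply: (JM _ _ _).2; apply: (JM _ _ _).2; apply: (JM _ _ _).1.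
  rewrite -!scalerA eE; case: eqP => [->|_]; last by rewrite !scaler0.
  by rewrite -wb -cE.
have [b bJ] := choice Jv; apply: J1; have bE i := (bJ i).2.
have -> : 1 = (1 - \sum_i b i) + \sum_i b i by rewrite subrK.
apply: (JD) => //; last first.
  by elim/big_rec: _ => [|i x _ Jx]; [case: tJ|apply: (JD) => //; case: (bJ i)].
(* [\sum_i b i] is the identity on the separating family, hence congruent to 1 modulo [ann N]. *)
apply/NJ/sv => j; rewrite scalerBl scale1r scaler_suml (bigD1 j) //= bE eqxx.
by rewrite big1 ?addr0 ?subrr // => i ij; rewrite bE eq_sym (negPf ij).
Qed.

End SimpleQuotient.

End Density.

(** * Matrix quotients and classes of simple modules *)

(* The nonzero vector makes the endomorphism ring nontrivial, as unitRingType requires. *)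
Record endo (R : nzRingType) (N : lmodType R) (N0 : exists v : N, v != 0) :=
  Endo { endo_fun :> N -> N; endo_linear : linear endo_fun }.

Section EndomorphismRing.
Variables (R : nzRingType) (N : lmodType R) (N0 : exists v : N, v != 0).
Local Notation D := (endo N0).

HB.instance Definition _ := gen_eqMixin D.
HB.instance Definition _ := gen_choiceMixin D.

Lemma endoP (g h : D) : (forall v, g v = h v) -> g = h.
Proof.
case: g h => [g gl] [h hl] /= /funext E; case: _ / E hl => hl.
by congr Endo; apply: Prop_irrelevance.
Qed.

Lemma endo_zero_linear : linear (fun _ : N => 0 : N).
Proof. by move=> a u v; rewrite scaler0 addr0. Qed.
Lemma endo_opp_linear (g : D) : linear (fun v => - g v).
Proof. by move=> a u v; rewrite endo_linear opprD scalerN. Qed.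
Lemma endo_add_linear (g h : D) : linear (fun v => g v + h v).
Proof. by move=> a u v; rewrite !endo_linear scalerDr addrACA. Qed.
Lemma endo_one_linear : linear (fun v : N => v).
Proof. by []. Qed.
Lemma endo_mul_linear (g h : D) : linear (fun v => h (g v)).
Proof. by move=> a u v; rewrite !endo_linear. Qed.

Definition endo_zero : D := Endo N0 endo_zero_linear.
Definition endo_opp (g : D) : D := Endo N0 (endo_opp_linear g).
Definition endo_add (g h : D) : D := Endo N0 (endo_add_linear g h).
Definition endo_one : D := Endo N0 endo_one_linear.
(* The product is reversed, since R acts on the left. *)
Definition endo_mul (g h : D) : D := Endo N0 (endo_mul_linear g h).

Lemma endo_addA : associative endo_add.
Proof. by move=> g h k; apply: endoP => v /=; rewrite addrA. Qed.
Lemma endo_addC : commutative endo_add.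
Proof. by move=> g h; apply: endoP => v /=; rewrite addrC. Qed.
Lemma endo_add0 : left_id endo_zero endo_add.
Proof. by move=> g; apply: endoP => v /=; rewrite add0r. Qed.
Lemma endo_addN : left_inverse endo_zero endo_opp endo_add.
Proof. by move=> g; apply: endoP => v /=; rewrite addNr. Qed.
HB.instance Definition _ :=
  GRing.isZmodule.Build D endo_addA endo_addC endo_add0 endo_addN.

Lemma endo_mulA : associative endo_mul.
Proof. by move=> g h k; apply: endoP. Qed.
Lemma endo_mul1l : left_id endo_one endo_mul.
Proof. by move=> g; apply: endoP. Qed.
Lemma endo_mul1r : right_id endo_one endo_mul.
Proof. by move=> g; apply: endoP. Qed.
Lemma endo_mulDl : left_distributive endo_mul +%R.
Proof.
move=> g h k; apply: endoP => v.
by have := endo_linear k 1 (g v) (h v); rewrite !scale1r.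
Qed.
Lemma endo_mulDr : right_distributive endo_mul +%R.
Proof. by move=> g h k; apply: endoP. Qed.
Lemma endo_one_neq0 : endo_one != 0.
Proof.
apply/eqP => E; have [v /eqP[]] := N0.
exact: (congr1 (fun g : D => g v) E).
Qed.
HB.instance Definition _ := GRing.Zmodule_isNzRing.Build D
  endo_mulA endo_mul1l endo_mul1r endo_mulDl endo_mulDr endo_one_neq0.

Definition endo_invertible (g h : D) : Prop := h * g = 1 /\ g * h = 1.
Definition endo_unit : {pred D} := fun g => `[< exists h, endo_invertible g h >].
Definition endo_inv (g : D) : D :=
  if pselect (exists h, endo_invertible g h) is left e then projT1 (cid e) else g.

Lemma endo_invP g : g \in endo_unit -> endo_invertible g (endo_inv g).
Proof.
move=> /asboolP gu; rewrite /endo_inv; case: pselect => // e.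
by case: cid.
Qed.
Lemma endo_mulVr : {in endo_unit, left_inverse 1 endo_inv *%R}.
Proof. by move=> g /endo_invP[]. Qed.
Lemma endo_divrr : {in endo_unit, right_inverse 1 endo_inv *%R}.
Proof. by move=> g /endo_invP[]. Qed.
Lemma endo_unitP g h : h * g = 1 /\ g * h = 1 -> g \in endo_unit.
Proof. by move=> gh; apply/asboolP; exists h. Qed.
Lemma endo_inv_out : {in [predC endo_unit], endo_inv =1 id}.
Proof.
move=> g /negP gu; rewrite /endo_inv; case: pselect => // e.
by case: gu; apply/asboolP.
Qed.
HB.instance Definition _ := GRing.NzRing_hasMulInverse.Build D
  endo_mulVr endo_divrr endo_unitP endo_inv_out.

HB.instance Definition _ (g : D) :=
  GRing.isLinear.Build R N N *:%R (endo_fun g) (endo_linear g).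

Lemma endo_sumE (I : Type) (r : seq I) (F : I -> D) v :
  (\sum_(i <- r) F i) v = \sum_(i <- r) F i v.
Proof. by elim: r => [|i r IH]; rewrite ?(big_nil, big_cons) //= -IH. Qed.

Lemma simple_endo_unit (g : D) : simple N -> g != 0 -> g \is a GRing.unit.
Proof.
move=> sN g0; have [|h gK hK] := @schur R N N g sN sN.
  apply: contrapT => nv; case/eqP: g0; apply: endoP => v.
  by apply/eqP/negPn/negP => gv; apply: nv; exists v.
have hl : linear h by move=> a u v; apply: (can_inj gK); rewrite linearP !hK.
apply/asboolP; exists (Endo N0 hl); split; apply: endoP => v /=; [exact: hK|exact: gK].
Qed.

End EndomorphismRing.

(** Under [a |-> (a v_k)_k] the quotient [R / ann N] becomes a power of [N], on which right
    multiplication by [a] is a linear endomorphism. The matrix lists its components: [b i u]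
    represents the vector with [u] at place [i], so the entry from copy [i] to copy [j] sends [u] to
    [(b i u * a) v_j]. The reversed product of [endo] turns composition into matrix
    multiplication. *)
Lemma simple_matrix_quotient (R : nzRingType) (N : lmodType R) : simple N ->
  (exists n (v : 'I_n -> N), separates v) -> matrix_quotient (ann N).
Proof.
move=> sN finN; have [n [v [sv dv]]] := dense_family sN finN.
have N0 := sN.1; pose D := endo N0.
have [b bE] : exists b : 'I_n.+1 -> N -> R,
    forall i u k, b i u *: v k = if k == i then u else 0.
  have [b bE] := choice (fun iu : 'I_n.+1 * N => dv (fun k => if k == iu.1 then iu.2 else 0)).
  by exists (fun i u => b (i, u)) => i u k; rewrite bE.
have agree (a a' : R) : (forall k, a *: v k = a' *: v k) -> forall w : N, a *: w = a' *: w.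
  move=> aa' w; apply/eqP; rewrite -subr_eq0 -scalerBl; apply/eqP/sv => k.
  by rewrite scalerBl aa' subrr.
have glin i j (a : R) : linear (fun u => (b i u * a) *: v j).
  move=> c u u'; rewrite -!scalerA (scalerA c (b i u)) -scalerDl; apply: agree => k.
  by rewrite scalerDl -scalerA !bE; case: eqP; rewrite // scaler0 addr0.
pose g (a : R) : 'M[D]_n.+1 := \matrix_(i, j) Endo N0 (glin i j a).
have g_zmod : zmod_morphism g.
  move=> a a'; apply/matrixP => i j; rewrite !mxE; apply: endoP => u /=.
  by rewrite mulrBr scalerBl.
have g_monoid : monoid_morphism g.
  split=> [|a a']; apply/matrixP => i j; rewrite !mxE; apply: endoP => u.
    by rewrite /= mulr1 bE eq_sym; case: eqP.
  rewrite endo_sumE /= mulrA -[LHS]scalerA.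
  under eq_bigr do rewrite !mxE /= -scalerA.
  rewrite -scaler_suml; apply: agree => k; rewrite scaler_suml (bigD1 k) //=.
  by rewrite bE eqxx big1 ?addr0 // => l lk; rewrite bE eq_sym (negPf lk).
pose G : {rmorphism R -> 'M[D]_n.+1} := HB.pack g
  (GRing.isZmodMorphism.Build _ _ g g_zmod) (GRing.isMonoidMorphism.Build _ _ g g_monoid).
exists D, n, G; split=> [d d0|B|a]; first exact: simple_endo_unit.
  (* Column [j] of a matrix tells where [v_j] must go, because [a v_j] is the sum over [i] of the
     images of the [v_i]. *)
  have [a aE] := dv (fun j => \sum_i (B i j : D) (v i)).
  exists a; apply/matrixP => i j; rewrite !mxE; apply: endoP => u /=.
  rewrite -scalerA aE scaler_sumr (bigD1 i) //= -linearZ bE eqxx big1 ?addr0 // => k ki.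
  by rewrite -linearZ bE (negPf ki) raddf0.
split=> [/matrixP a0|aN]; last first.
  by apply/matrixP => i j; rewrite !mxE; apply: endoP => u /=; rewrite -scalerA aN scaler0.
apply: sv => j; have -> : a *: v j = (\sum_i b i (v i)) *: (a *: v j).
  rewrite -[LHS]scale1r; apply: agree => k; rewrite scale1r scaler_suml (bigD1 k) //=.
  by rewrite bE eqxx big1 ?addr0 // => l lk; rewrite bE eq_sym (negPf lk).
rewrite scaler_suml big1 // => i _; move: (a0 i j); rewrite !mxE scalerA.
exact: (congr1 (fun d : D => d (v i))).
Qed.

Section SimpleClasses.
Variable R : nzRingType.
Implicit Types (M : set R) (N : lmodType R).

Hypothesis finN : forall N, simple N -> exists n (v : 'I_n -> N), separates v.

Lemma submodule_ann M N : two_sided M -> is_submodule_of N (lquot R M) -> M `<=` ann N.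
Proof.
move=> tM [g gI] a Ma v; apply: gI; rewrite linearZ raddf0; exact: ann_quot.
Qed.

Lemma factor_ann M N : two_sided M -> is_factor_of N (lquot R M) -> M `<=` ann N.
Proof.
move=> tM [g gs] a Ma v; have [u <-] := gs v.
by rewrite -linearZ (ann_quot tM) // raddf0.
Qed.

Lemma summand_ann M N : two_sided M -> is_summand_of N (lquot R M) -> M `<=` ann N.
Proof.
move=> tM [N' [g [h gK hK]]] a Ma v.
have : g (a *: h (v, 0)) = 0 by rewrite (ann_quot tM) // raddf0.
by rewrite linearZ /= hK => -[].
Qed.

(** The annihilator is the common invariant: a simple submodule, summand or factor of [R / M] is
    killed by [M], and maximality of [M] forces equality. The converse is the decomposition of
    [R / ann N] as a power of [N]. *)
Lemma LclassE M N : Max M -> Lclass M N <-> simple N /\ ann N = M.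
Proof.
move=> mM; split=> -[sN h]; split=> //.
  by apply: ann_simple_max => //; apply: submodule_ann => //; case: mM.
by rewrite -h; apply: simple_submodule => //; apply: finN.
Qed.

Lemma summand_classE M N : Max M ->
  simple N /\ is_summand_of N (lquot R M) <-> simple N /\ ann N = M.
Proof.
move=> mM; split=> -[sN h]; split=> //.
  by apply: ann_simple_max => //; apply: summand_ann => //; case: mM.
by rewrite -h; apply: simple_summand => //; apply: finN.
Qed.

Lemma factor_classE M N : Max M ->
  simple N /\ is_factor_of N (lquot R M) <-> simple N /\ ann N = M.
Proof.
move=> mM; split=> -[sN h]; split=> //.
  by apply: ann_simple_max => //; apply: factor_ann => //; case: mM.
by rewrite -h; apply: simple_factor => //; apply: finN.
Qed.

Lemma max_exists_simple M : Max M -> exists2 N, simple N & ann N = M.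
Proof.
move=> mM; have [tM [M1 _]] := mM; have [N [sN MN]] := exists_simple tM M1.
by exists N => //; apply: ann_simple_max.
Qed.

Lemma iso_ann (V W : lmodType R) : iso V W -> ann V = ann W.
Proof.
have sub (V' W' : lmodType R) : iso V' W' -> ann V' `<=` ann W'.
  move=> [g [h _ hK]] a aV w; rewrite -[w]hK -linearZ aV; exact: raddf0.
by move=> i; apply/seteqP; split; apply: sub => //; apply: iso_sym.
Qed.

Lemma Lclass_iso M N : Max M -> simple N -> ann N = M -> same_class (Lclass M) (iso N).
Proof.
move=> mM sN aN N'; rewrite (LclassE _ mM); split=> [[sN' aN']|i].
  by apply: simple_iso => //; [apply: finN|rewrite aN aN'].
by split; [apply: iso_simple i sN|rewrite -(iso_ann i)].
Qed.

Lemma max_structure M : Max M ->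
  [/\ matrix_quotient M,
      is_simple_class (@Lclass R M),
      same_class (@Lclass R M) (fun N => simple N /\ is_summand_of N (lquot R M)) &
      same_class (@Lclass R M) (fun N => simple N /\ is_factor_of N (lquot R M))].
Proof.
move=> mM; have [N sN aN] := max_exists_simple mM; split=> [||N'|N'].
- by rewrite -aN; apply: simple_matrix_quotient => //; apply: finN.
- by exists N => //; apply: Lclass_iso.
- by rewrite (LclassE _ mM) (summand_classE _ mM).
- by rewrite (LclassE _ mM) (factor_classE _ mM).
Qed.

Lemma Lclass_inj M M' : Max M -> Max M' ->
  same_class (@Lclass R M) (Lclass M') -> M = M'.
Proof.
move=> mM mM' h; have [N sN aN] := max_exists_simple mM.
have /h : Lclass M N by apply/(LclassE _ mM).
by move/(LclassE _ mM') => -[_ <-].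
Qed.

Lemma simple_Max_ann N : simple N -> Max (ann N) /\ same_class (Lclass (ann N)) (iso N).
Proof.
move=> sN; have mN : Max (ann N) by apply: ann_max => //; apply: finN.
by split=> //; apply: Lclass_iso.
Qed.

Lemma Lclass_surj (C : lmodType R -> Prop) : is_simple_class C ->
  exists2 M, Max M & same_class (@Lclass R M) C.
Proof.
move=> [N sN CN]; have [mN LN] := simple_Max_ann sN.
by exists (ann N) => // N'; rewrite LN CN.
Qed.

End SimpleClasses.

(** * Determinant trick and dimensions *)

Definition spans (R : nzRingType) (V : lmodType R) (T : finType) (e : T -> V) : Prop :=
  forall v, exists c : T -> R, v = \sum_i c i *: e i.

(* For a maximal ideal I of a commutative ring this is a basis over R / I. *)
Definition mod_basis (R : nzRingType) (V : lmodType R) (I : set R) (T : finType)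
    (e : T -> V) : Prop :=
  spans e /\ forall c : T -> R, \sum_i c i *: e i = 0 <-> forall i, I (c i).

Section Determinant.
Variables (A : comNzRingType) (I : set A) (tI : two_sided I).

Lemma ideal_opp a : I a -> I (- a).
Proof. by move=> Ia; rewrite -mulN1r; case: tI => _ _ /(_ (-1) a Ia)[]. Qed.

Lemma ideal_congr_prod (J : Type) (r : seq J) (F G : J -> A) :
  (forall j, I (F j - G j)) -> I (\prod_(j <- r) F j - \prod_(j <- r) G j).
Proof.
have [I0 ID IM] := tI; move=> FG; elim/big_rec2: _ => [|j a b _ h]; first by rewrite subrr.
have -> : F j * b - G j * a = (F j - G j) * b + G j * (b - a).
  by rewrite mulrBl mulrBr addrA subrK.
by apply: ID; [apply: (IM _ _ _).2; apply: FG|apply: (IM _ _ _).1].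
Qed.

Lemma det_congr n (B C : 'M[A]_n) : (forall i j, I (B i j - C i j)) ->
  I (\det B - \det C).
Proof.
have [I0 ID IM] := tI; move=> BC; rewrite -sumrB; elim/big_ind: _ => // s _.
by rewrite -mulrBr; apply: (IM _ _ _).1; apply: ideal_congr_prod.
Qed.

(** Cramer's rule: apply the adjugate matrix to the system. *)
Lemma det_kill (V : lmodType A) n (M : 'M[A]_n) (g : 'I_n -> V) :
  (forall i, \sum_j M i j *: g j = 0) -> forall k, \det M *: g k = 0.
Proof.
move=> Mg k; have : \sum_i (\adj M) k i *: (\sum_j M i j *: g j) = 0.
  by rewrite big1 // => i _; rewrite Mg scaler0.
under eq_bigr do rewrite scaler_sumr.
rewrite exchange_big /=.
under eq_bigr => j _.
  under eq_bigr do rewrite scalerA.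
  rewrite -scaler_suml.
  have -> : \sum_i (\adj M) k i * M i j = (\adj M *m M) k j by rewrite mxE.
  rewrite mul_adj_mx mxE; over.
rewrite (bigD1 k) //= eqxx big1 ?addr0 // => j jk.
by rewrite eq_sym (negPf jk) scale0r.
Qed.

(** The matrix [b - c] kills the family, so its determinant does too, and modulo [I] that
    determinant is [b ^+ n]. With [b = 1] this is Nakayama's lemma; a general [b] allows relations
    that hold only after clearing a denominator. *)
Lemma nakayama (V : lmodType A) n (g : 'I_n -> V) (b : A) (c : 'I_n -> 'I_n -> A) :
  (forall i j, I (c i j)) -> (forall i, b *: g i = \sum_j c i j *: g j) ->
  exists2 h, I h & forall k, (b ^+ n + h) *: g k = 0.
Proof.
move=> Ic gE; pose M := b%:M - \matrix_(i, j) c i j.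
exists (\det M - b ^+ n).
  rewrite -det_scalar; apply: det_congr => i j.
  by rewrite !mxE addrAC subrr add0r; apply: ideal_opp.
move=> k; rewrite addrC subrK; apply: det_kill => i.
under eq_bigr do rewrite !mxE scalerBl.
rewrite sumrB -gE (bigD1 i) //= eqxx big1 => [|j ji]; first by rewrite addr0 subrr.
by rewrite eq_sym (negPf ji) scale0r.
Qed.

End Determinant.

Lemma span_submodule (R : nzRingType) (V : lmodType R) (T : finType) (e : T -> V) :
  submodule [set v | exists c : T -> R, v = \sum_i c i *: e i].
Proof.
split=> [|a _ _ [c ->] [d ->]].
  by exists (fun=> 0); rewrite big1 // => i _; rewrite scale0r.
exists (fun i => a * c i + d i); rewrite scaler_sumr -big_split.
by apply: eq_bigr => i _; rewrite scalerDl scalerA.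
Qed.

Lemma span_mem (R : nzRingType) (V : lmodType R) (T : finType) (e : T -> V) t :
  exists c : T -> R, e t = \sum_i c i *: e i.
Proof.
exists (fun i => if i == t then 1 else 0); rewrite (bigD1 t) //= eqxx scale1r.
by rewrite big1 ?addr0 // => i /negPf ->; rewrite scale0r.
Qed.

Section ModBasis.
Variables (R : nzRingType) (V : lmodType R) (I : set R).

Lemma mod_basis_kill (T : finType) (e : T -> V) t a :
  I 0 -> mod_basis I e -> I a -> a *: e t = 0.
Proof.
move=> I0 [_ eI] Ia; have := (eI (fun i => if i == t then a else 0)).2.
rewrite (bigD1 t) //= eqxx big1 => [|i it]; last by rewrite (negPf it) scale0r.
by rewrite addr0; apply => i; case: eqP.
Qed.

(** The hypotheses let [V] be treated as a vector space over [R / I] without forming that quotient;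
    a spanning family of least length is then free. *)
Lemma exists_mod_basis n (e : 'I_n -> V) :
  (forall a, I a -> forall v : V, a *: v = 0) ->
  (forall a, ~ I a -> exists b, I (b * a - 1)) ->
  spans e -> exists m (e' : 'I_m -> V), mod_basis I e'.
Proof.
move=> IV Iinv se.
have Pex : exists n, `[< exists e : 'I_n -> V, spans e >].
  by exists n; apply/asboolP; exists e.
case: (ex_minnP Pex) => m /asboolP[e' se'] mmin.
exists m, e'; split=> // c; split=> [c0 j|Ic]; last by rewrite big1 // => i _; apply: IV.
apply: contrapT => /Iinv[b bc]; move: bc; case: m e' se' mmin c c0 j => [|m] e' se' mmin c c0 j bc.
  by case: j bc.
suff : (m.+1 <= m)%N by rewrite ltnn.
apply: mmin; apply/asboolP; exists (e' \o lift j) => v; have [a ->] := se' v.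
(* The coefficient of [e' j] in the relation is invertible modulo [I], so the relation can be solved
   for [e' j]. *)
have ej : e' j = \sum_i (- (b * c (lift j i))) *: e' (lift j i).
  move: c0 => /(congr1 (fun v => b *: v)); rewrite scaler0 scaler_sumr.
  rewrite (bigD1_ord j) //= scalerA => /eqP; rewrite addr_eq0 => /eqP E.
  have := IV _ bc (e' j); rewrite scalerBl scale1r E => /eqP.
  rewrite subr_eq0 => /eqP <-; rewrite -sumrN; apply: eq_bigr => i _.
  by rewrite scalerA scaleNr.
exists (fun i => a (lift j i) + a j * - (b * c (lift j i))).
rewrite (bigD1_ord j) //= {1}ej scaler_sumr addrC -big_split /=.
by apply: eq_bigr => i _; rewrite scalerDl scalerA.
Qed.

Lemma mod_basis_ord (T : finType) (e : T -> V) :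
  mod_basis I e -> mod_basis I (fun i : 'I_#|T| => e (enum_val i)).
Proof.
have E (c : 'I_#|T| -> R) :
    \sum_i c i *: e (enum_val i) = \sum_t c (enum_rank t) *: e t.
  rewrite (reindex _ (onW_bij _ (@enum_val_bij T))) /=.
  by apply: eq_bigr => i _; rewrite enum_valK.
move=> [se eI]; split=> [v|c].
  have [c ->] := se v; exists (c \o enum_val); rewrite E.
  by apply: eq_bigr => t _; rewrite /= enum_rankK.
rewrite E eI; split=> h i; last exact: h.
by have := h (enum_val i); rewrite enum_valK.
Qed.

End ModBasis.

Lemma is_basisP (K : nzRingType) (V : lmodType K) d (e : 'I_d -> V) :
  is_basis e <-> mod_basis [set 0] e.
Proof.
split=> [be|[se e0] v].
  split=> [v|c]; first by have [c [-> _]] := be v; exists (fun i => c 0 i).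
  split=> [c0 i|c0]; last by rewrite big1 // => i _; rewrite c0 scale0r.
  have [c' [_ cu]] := be 0.
  have E1 : c' = \row_i c i by apply: cu; rewrite -[LHS]c0; apply: eq_bigr => j _; rewrite mxE.
  have E2 : c' = 0 by apply: cu; rewrite big1 // => j _; rewrite mxE scale0r.
  by move: E1; rewrite E2 => /matrixP/(_ 0 i); rewrite !mxE.
have [c vE] := se v; exists (\row_i c i); split.
  by rewrite vE; apply: eq_bigr => i _; rewrite mxE.
move=> c' vE'; apply/matrixP => i j; rewrite ord1 !mxE; apply/eqP.
rewrite -subr_eq0; apply/eqP; move: j; apply: (e0 (fun j => c j - c' 0 j)).1.
by under eq_bigr do rewrite scalerBl; rewrite sumrB -vE -vE' subrr.
Qed.

Lemma basis_has_dim (K : nzRingType) (V : lmodType K) (T : finType) (e : T -> V) :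
  mod_basis [set 0] e -> has_dim V #|T|.
Proof. by move=> be; eexists; apply/is_basisP/mod_basis_ord/be. Qed.

Section Dimension.
Variables (K : fieldType) (V : lmodType K).

Lemma spans_has_dim n (e : 'I_n -> V) : spans e -> exists d, has_dim V d.
Proof.
move=> se; have [| |m [e' be]] := @exists_mod_basis _ _ [set 0] _ _ _ _ se.
- by move=> a -> v; rewrite scale0r.
- by move=> a /eqP a0; exists a^-1; rewrite mulVf // subrr.
- by exists m, e'; apply/is_basisP.
Qed.

Lemma free_spans_rank n m (e : 'I_n -> V) (u : 'I_m -> V) : spans e ->
  (forall c : 'I_m -> K, \sum_i c i *: u i = 0 -> forall i, c i = 0) ->
  exists M : 'M[K]_(m, n), row_free M /\ forall i, u i = \sum_j M i j *: e j.
Proof.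
move=> se fu; have [M uE] := choice (fun i => se (u i)).
exists (\matrix_(i, j) M i j); split; last first.
  by move=> i; rewrite uE; apply: eq_bigr => j _; rewrite mxE.
rewrite -kermx_eq0; apply/rowV0P => a /sub_kermxP/matrixP aM.
apply/rowP => i; rewrite [in RHS]mxE; apply: (fu (fun i => a 0 i)).
under eq_bigr do rewrite uE scaler_sumr.
rewrite exchange_big big1 //= => j _; under eq_bigr do rewrite scalerA.
rewrite -scaler_suml; have := aM 0 j; rewrite mxE [in RHS]mxE => h.
rewrite [X in X *: _](_ : _ = 0) ?scale0r // -[RHS]h.
by apply: eq_bigr => l _; rewrite [in RHS]mxE.
Qed.

Lemma has_dim_unique d d' : has_dim V d -> has_dim V d' -> d = d'.
Proof.
have le (a b : nat) : has_dim V a -> has_dim V b -> (a <= b)%N.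
  move=> [u /is_basisP[_ fu]] [e /is_basisP[se _]].
  have [c|M [/eqP Mf _]] := free_spans_rank se (u := u); first by move/fu.
  by rewrite -Mf rank_leq_col.
by move=> h h'; apply/eqP; rewrite eqn_leq !le.
Qed.

Lemma free_basis d (u : 'I_d -> V) : has_dim V d ->
  (forall c : 'I_d -> K, \sum_i c i *: u i = 0 -> forall i, c i = 0) -> is_basis u.
Proof.
move=> [e /is_basisP[se _]] fu; apply/is_basisP; split; last first.
  move=> c; split=> [/fu//|c0]; by rewrite big1 // => i _; rewrite c0 scale0r.
have [M [Mf uE]] := free_spans_rank se fu.
have Mu : M \in unitmx by rewrite -row_free_unit.
have eE j : e j = \sum_i invmx M j i *: u i.
  under eq_bigr do rewrite uE scaler_sumr.
  rewrite exchange_big /= (eq_bigr (fun k => (invmx M *m M) j k *: e k)) => [|k _].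
    rewrite mulVmx // (bigD1 j) //= mxE eqxx scale1r big1 ?addr0 // => k kj.
    by rewrite mxE eq_sym (negPf kj) scale0r.
  by rewrite mxE scaler_suml; apply: eq_bigr => i _; rewrite scalerA.
move=> v; have [c ->] := se v; exists (fun i => \sum_j c j * invmx M j i).
under eq_bigr do rewrite eE scaler_sumr.
rewrite exchange_big; apply: eq_bigr => i _ /=; rewrite scaler_suml.
by apply: eq_bigr => j _; rewrite scalerA.
Qed.

Lemma has_dim_transport (W : lmodType K) (g : V -> W) d :
  bijective g -> linear g -> has_dim V d -> has_dim W d.
Proof.
move=> [h gK hK] gl [e be].
pose G : {linear V -> W} := HB.pack g (GRing.isLinear.Build _ _ _ _ g gl).
have gsum (c : 'rV[K]_d) : g (\sum_i c 0 i *: e i) = \sum_i c 0 i *: (g \o e) i.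
  by rewrite [LHS](raddf_sum G); apply: eq_bigr => i _; apply: (linearZ_LR G).
exists (g \o e) => w; have [c [vE cu]] := be (h w); exists c; split.
  by rewrite -gsum -vE hK.
by move=> c' wE; apply: cu; rewrite wE -gsum gK.
Qed.

Lemma power_has_dim n d : has_dim V d -> has_dim {ffun 'I_n -> V} (n * d)%N.
Proof.
move=> [e /is_basisP[se fe]].
pose E (x : 'I_n * 'I_d) : {ffun 'I_n -> V} := coord_inj x.1 (e x.2).
have sumE (c : 'I_n * 'I_d -> K) i : (\sum_x c x *: E x) i = \sum_k c (i, k) *: e k.
  rewrite sum_ffunE (eq_bigr (fun x => if x.1 == i then c (i, x.2) *: e x.2 else 0)); last first.
    move=> [j k] _; rewrite !ffunE /= eq_sym; case: eqP => [->//|_]; exact: scaler0.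
  rewrite -(pair_bigA _ (fun j k => if j == i then c (i, k) *: e k else 0)) /=.
  rewrite (bigD1 i) //= eqxx [X in _ + X]big1 ?addr0 // => j ji.
  by rewrite big1 // => k _; rewrite (negPf ji).
have -> : (n * d)%N = #|{: 'I_n * 'I_d}| by rewrite card_prod !card_ord.
apply: (@basis_has_dim _ _ _ E); split=> [w|c].
  have [c wE] := choice (fun i => se (w i)); exists (fun x => c x.1 x.2).
  by apply/ffunP => i; rewrite wE sumE.
split=> [/ffunP c0 [i k]|c0]; last by rewrite big1 // => x _; rewrite c0 scale0r.
have := c0 i; rewrite sumE ffunE => /fe; exact.
Qed.

End Dimension.

Section Tower.
Variables (K : fieldType) (A : algType K) (m : set A).
Variables (V : lmodType A) (T : finType) (e : T -> V).

(** Lift a [K]-basis of [A / m] to elements [beta] of [A]; the products [beta_j e_t] form a basis,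
    the choice of lifts being harmless since [m] kills every [e_t]. *)
Lemma tower_has_dimK d : submodule (m : set A^o) -> mod_basis m e ->
  has_dimK (lquot A m) d -> has_dimK V (#|T| * d).
Proof.
move=> sm be [b /is_basisP[sb fb]].
have kill t a : m a -> a *: e t = 0 by apply: mod_basis_kill be; case: sm.
have [beta betaE] := choice (fun j => @cls_surj A A^o m (b j)).
have clsE' (c : 'I_d -> K) :
    \sum_j c j *: b j = (@cls A A^o m (\sum_j c j *: (beta j : A)) : restr (in_alg A) (lquot A m)).
  rewrite raddf_sum; apply: eq_bigr => j _.
  by rewrite -betaE -[in RHS]mulr_algl; symmetry; apply: clsZ.
pose E (x : T * 'I_d) : restr (in_alg A) V := beta x.2 *: e x.1.
have -> : (#|T| * d)%N = #|{: T * 'I_d}| by rewrite card_prod card_ord.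
have sumE (c : T * 'I_d -> K) :
    \sum_x c x *: E x = \sum_t (\sum_j c (t, j) *: beta j) *: e t :> V.
  under [RHS]eq_bigr do rewrite scaler_suml.
  rewrite pair_bigA /=; apply: eq_bigr => -[t j] _ /=.
  by rewrite -[in RHS]mulr_algl -[in RHS]scalerA.
apply: (@basis_has_dim _ _ _ E); split=> [v|c].
  have [a vE] := be.1 (v : V).
  have [c cE] := choice (fun t => sb (@cls A A^o m (a t) : restr (in_alg A) (lquot A m))).
  have aE t : a t *: e t = (\sum_j c t j *: (beta j : A)) *: e t.
    apply/eqP; rewrite -subr_eq0 -scalerBl; apply/eqP/kill.
    rewrite -[m](lspan_id sm); apply/clsE; rewrite -clsE'; exact: cE.
  exists (fun x => c x.1 x.2); rewrite sumE /= vE.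
  by apply: eq_bigr => t _; apply: aE.
split=> [c0 [t j]|c0]; last by rewrite big1 // => x _; rewrite c0 scale0r.
move: c0; rewrite sumE => /(be.2 _).1 /(_ t) mt.
apply: (fb (fun j => c (t, j))).1; rewrite clsE'; apply/cls_eq0.
by rewrite lspan_id.
Qed.

End Tower.

(** * Degrees in y *)

Section OreBasics.
Variables (K : fieldType) (f : {poly K}).
Local Notation L := (ore f).
Local Notation x := (oreC f 'X).
Local Notation y := (oreY f).

Lemma oreC_polyC c : oreC f c%:P = c%:A.
Proof. by apply: ore_inj; rewrite /= alg_polyC. Qed.

Lemma oreC_inj : injective (oreC f).
Proof. by move=> g h [/polyC_inj]. Qed.

Lemma oreYX i : ore_poly (y ^+ i) = 'X^i.
Proof.
elim: i => [|i IH]; first by rewrite expr0.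
by rewrite exprS /= pmulX IH -!(iter_ymul1 f).
Qed.

Lemma ore_expand (a : L) : a = \sum_(i < size (ore_poly a)) oreC f (ore_poly a)`_i * y ^+ i.
Proof.
apply: ore_inj; rewrite raddf_sum /= -[LHS]coefK poly_def; apply: eq_bigr => i _.
by rewrite oreYX pmulC1.
Qed.

Lemma oreC_oreY g : oreC f g * y = y * oreC f g - oreC f (delta f g).
Proof. by rewrite oreY_oreC addrK. Qed.

Lemma oreC_commute g h : oreC f g * oreC f h = oreC f h * oreC f g.
Proof. by rewrite -!rmorphM mulrC. Qed.

Lemma comm_oreC (a : L) : a * x = x * a -> forall g, a * oreC f g = oreC f g * a.
Proof.
move=> ax; elim/poly_ind => [|g c IH]; first by rewrite raddf0 mulr0 mul0r.
rewrite raddfD /= rmorphM /= mulrDr mulrDl mulrA IH -mulrA ax mulrA.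
by congr (_ + _); rewrite oreC_polyC -scalerAl -scalerAr mul1r mulr1.
Qed.

Lemma central_of_gens (a : L) : a * x = x * a -> a * y = y * a -> a \in @centralb K L.
Proof.
move=> ax ay; apply/centralbP => b; rewrite [b]ore_expand mulr_sumr mulr_suml.
apply: eq_bigr => i _; rewrite mulrA comm_oreC // -!mulrA; congr (_ * _).
elim: (i : nat) => [|k IH]; first by rewrite mulr1 mul1r.
by rewrite exprSr mulrA IH -!mulrA ay.
Qed.

Lemma delta_sum_exp g n : delta f (g ^+ n) = g ^+ n.-1 * delta f g *+ n.
Proof. by rewrite /delta deriv_exp mulrnAr (mulrC g^`()) mulrCA. Qed.

(** Coefficients stand on the right and may be anything commuting with [x], in particular
    polynomials in [x] over the centre. This is weaker than a bound on the degree in [y]: the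
    central element [ore_w] below has degree [p] in [y] and satisfies [lower 1]. *)
Definition lower n (a : L) : Prop := exists c : nat -> L,
  (forall l, c l * x = x * c l) /\ a = \sum_(l < n) y ^+ l * c l.

Lemma lower0 n : lower n 0.
Proof. by exists (fun=> 0); split=> [l|]; rewrite ?mul0r ?mulr0 // big1 // => i _; rewrite mulr0. Qed.

Lemma lowerD n a b : lower n a -> lower n b -> lower n (a + b).
Proof.
move=> [c [cx ->]] [d [dx ->]]; exists (fun l => c l + d l); split=> [l|].
  by rewrite mulrDl mulrDr cx dx.
by rewrite -big_split; apply: eq_bigr => l _; rewrite mulrDr.
Qed.

Lemma lowerM n a b : lower n a -> b * x = x * b -> lower n (a * b).
Proof.
move=> [c [cx ->]] bx; exists (fun l => c l * b); split=> [l|].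
  by rewrite -mulrA bx !mulrA cx.
by rewrite mulr_suml; apply: eq_bigr => l _; rewrite mulrA.
Qed.

Lemma lowerN n a : lower n a -> lower n (- a).
Proof. by move=> h; rewrite -mulrN1; apply: lowerM => //; rewrite mulN1r mulrN1. Qed.

Lemma lower_le n m a : (n <= m)%N -> lower n a -> lower m a.
Proof.
move=> nm [c [cx ->]]; exists (fun l => if (l < n)%N then c l else 0); split=> [l|].
  by case: ifP; rewrite ?mul0r ?mulr0.
rewrite (big_ord_widen _ (fun l => y ^+ l * c l) nm) big_mkcond.
by apply: eq_bigr => l _; case: ifP; rewrite ?mulr0.
Qed.

Lemma lower_top n b : b * x = x * b -> lower n.+1 (y ^+ n * b).
Proof.
move=> bx; exists (fun l => if l == n then b else 0); split=> [l|].
  by case: ifP; rewrite ?mul0r ?mulr0.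
rewrite (bigD1 ord_max) //= eqxx big1 ?addr0 // => i; rewrite -val_eqE /= => /negPf ->.
by rewrite mulr0.
Qed.

Lemma lower_sum n (I : Type) (r : seq I) (F : I -> L) :
  (forall i, lower n (F i)) -> lower n (\sum_(i <- r) F i).
Proof. by move=> FF; elim/big_rec: _ => [|i a _]; [exact: lower0|exact: lowerD]. Qed.

Lemma lowerY n a : lower n a -> lower n.+1 (y * a).
Proof.
move=> [c [cx ->]]; rewrite mulr_sumr; apply: lower_sum => l.
by rewrite mulrA -exprS; apply: lower_le (lower_top l.+1 (cx l)); rewrite ltnS.
Qed.

(** Each exchange [g y = y g - delta g] leaves an error with one factor [y] less; induction runs
    over all [g] at once because [delta g] must be moved as well. *)
Lemma oreC_yX_lower g n : lower n (oreC f g * y ^+ n - y ^+ n * oreC f g).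
Proof.
elim: n g => [|n IH] g; first by rewrite mulr1 mul1r subrr; apply: lower0.
have -> : oreC f g * y ^+ n.+1 - y ^+ n.+1 * oreC f g =
    y * (oreC f g * y ^+ n - y ^+ n * oreC f g)
    - ((oreC f (delta f g) * y ^+ n - y ^+ n * oreC f (delta f g))
       + y ^+ n * oreC f (delta f g)).
  rewrite subrK exprS !mulrA oreC_oreY mulrBl mulrBr !mulrA.
  by rewrite -!addrA; congr (_ + _); rewrite addrC.
apply: lowerD; first exact: lowerY.
apply/lowerN/lowerD; first by apply: lower_le (IH _).
by apply: lower_top; rewrite oreC_commute.
Qed.

(** Each of the [n.+1] exchanges of [x] with a factor [y] contributes [- f]; collecting these [f] to
    the right of [y ^+ n] costs only lower terms. *)
Lemma x_yX_lower n :
  lower n (x * y ^+ n.+1 - y ^+ n.+1 * x + y ^+ n * oreC f f *+ n.+1).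
Proof.
have dx : delta f 'X = f by rewrite /delta derivX mulr1.
elim: n => [|n IH].
  rewrite expr0 !expr1 mul1r mulr1n oreC_oreY dx addrAC subrK subrr; exact: lower0.
have -> : x * y ^+ n.+2 - y ^+ n.+2 * x + y ^+ n.+1 * oreC f f *+ n.+2 =
    y * (x * y ^+ n.+1 - y ^+ n.+1 * x + y ^+ n * oreC f f *+ n.+1)
    - (oreC f f * y ^+ n.+1 - y ^+ n.+1 * oreC f f).
  rewrite (exprS y n.+1) !mulrA oreC_oreY dx mulrBl mulrDr mulrBr !mulrA.
  rewrite mulrnAr mulrA -exprS opprB [_ *+ n.+2]mulrS !addrA.
  rewrite -(exprS y n) [RHS]addrAC [X in _ = X + _]addrAC [RHS]addrAC.
  by congr (_ + _ + _); rewrite addrAC.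
by apply: lowerD; [exact: lowerY|apply/lowerN/oreC_yX_lower].
Qed.

Definition leading n (a c : L) : Prop := c * x = x * c /\ lower n (a - y ^+ n * c).

Lemma lower_adx n a : lower n.+1 a -> lower n (x * a - a * x).
Proof.
move=> [c [cx ->]]; rewrite mulr_sumr mulr_suml -sumrB; apply: lower_sum => l.
rewrite -[y ^+ l * c l * x]mulrA cx !mulrA -mulrBl; apply: lowerM => //.
by apply: lower_le (oreC_yX_lower _ _); rewrite -ltnS.
Qed.

(** Commutation with [x] acts like a derivative in [y], up to the factor [- f]. This is the engine
    that isolates leading coefficients. *)
Lemma leading_adx n a c : leading n.+1 a c ->
  leading n (x * a - a * x) (- (oreC f f * c *+ n.+1)).
Proof.
move=> [cx la]; split.
  rewrite mulNr mulrN mulrnAl mulrnAr; congr (- (_ *+ _)).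
  by rewrite -mulrA cx !mulrA oreC_commute.
rewrite -[a](subrK (y ^+ n.+1 * c)); move: (a - _) la => l la.
have -> : x * (l + y ^+ n.+1 * c) - (l + y ^+ n.+1 * c) * x - y ^+ n * - (oreC f f * c *+ n.+1)
    = (x * l - l * x) + (x * y ^+ n.+1 - y ^+ n.+1 * x + y ^+ n * oreC f f *+ n.+1) * c.
  rewrite [x * (_ + _)]mulrDr [(l + _) * x]mulrDl opprD addrACA -[LHS]addrA; congr (_ + _).
    rewrite mulrDl mulrBl mulrN opprK -[y ^+ n.+1 * c * x]mulrA cx !mulrA.
  by rewrite mulrnAr mulrnAl mulrA.
by apply: lowerD; [exact: lower_adx|apply: lowerM => //; apply: x_yX_lower].
Qed.

End OreBasics.

(** * The centre *)

Section OreCharP.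
Variables (K : fieldType) (p : nat) (hp : p \in [pchar K]) (f : {poly K}) (f0 : f != 0).
Local Notation L := (ore f).
Local Notation x := (oreC f 'X).
Local Notation y := (oreY f).
Local Notation Z := (centre L).

Lemma pchar_gt0 : (0 < p)%N. Proof. exact/prime_gt0/(pcharf_prime hp). Qed.
Lemma pchar_gt1 : (1 < p)%N. Proof. exact/prime_gt1/(pcharf_prime hp). Qed.

Lemma ore_mulrn_p (a : L) : a *+ p = 0.
Proof. by rewrite -scaler_nat (pcharf0 hp) scale0r. Qed.

Lemma natr_small j : (0 < j < p)%N -> j%:R != 0 :> K.
Proof. by case/andP=> j0 jp; rewrite -(dvdn_pcharf hp) gtnNdvd. Qed.

Definition lmul (a : L) : L -> L := fun b => a * b.
Definition rmul (a : L) : L -> L := fun b => b * a.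
Lemma lmul_linear a : linear (lmul a).
Proof. by move=> k u v; rewrite /lmul mulrDr scalerAr. Qed.
Lemma rmul_linear a : linear (rmul a).
Proof. by move=> k u v; rewrite /rmul mulrDl scalerAl. Qed.

(* In characteristic p the commuting left and right multiplications by y
   satisfy (l - r)^p = l^p - r^p, so ad(y)^p = ad(y^p). *)
Lemma oreYp_oreC g : y ^+ p * oreC f g - oreC f g * y ^+ p = oreC f (iter p (delta f) g).
Proof.
have N0 : exists v : L, v != 0 by exists 1; apply: oner_neq0.
pose ly := Endo N0 (lmul_linear y); pose ry := Endo N0 (rmul_linear y).
have chD : p \in [pchar (endo N0)].
  rewrite inE (pcharf_prime hp); apply/eqP/endoP => v.
  have -> : forall n, (n%:R : endo N0) v = v *+ n.
    by elim=> // n IH; rewrite !mulrS -IH.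
  exact: ore_mulrn_p.
have ad n : ((ly - ry) ^+ n) (oreC f g) = oreC f (iter n (delta f) g).
  elim: n => //= n IH; rewrite exprSr.
  rewrite -[LHS]/(y * (((ly - ry) ^+ n) (oreC f g)) - (((ly - ry) ^+ n) (oreC f g)) * y).
  by rewrite IH oreY_oreC addrAC subrr add0r.
have comm_lr : GRing.comm ly ry by apply: endoP => v; rewrite /= /lmul /rmul mulrA.
have := ad p; rewrite -(pFrobenius_autE chD) pFrobenius_autB_comm //.
rewrite !pFrobenius_autE => <-.
have lX n v : (ly ^+ n) v = y ^+ n * v.
  elim: n v => [|n IH] v; first by rewrite mul1r.
  by rewrite exprSr /= /lmul IH mulrA -exprS.
have rX n v : (ry ^+ n) v = v * y ^+ n.
  elim: n v => [|n IH] v; first by rewrite mulr1.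
  by rewrite exprSr /= /rmul IH -mulrA -exprSr.
by rewrite -[RHS]/((ly ^+ p) (oreC f g) - (ry ^+ p) (oreC f g)) lX rX.
Qed.

(** In characteristic [p] the power [delta^p] is again a derivation, determined by
    [delta^p x = f (delta^(p-1) x)']; hence [delta^p = e delta] with this [e]. *)
Definition ore_e : {poly K} := (iter p.-1 (delta f) 'X)^`().

Lemma deltaX : delta f 'X = f.
Proof. by rewrite /delta derivX mulr1. Qed.

Lemma iter_deltaX : iter p (delta f) 'X = f * ore_e.
Proof. by rewrite -[in LHS](prednK pchar_gt0). Qed.

(** On [K[x]], commutation with [y^p - e y] is [delta^p - e delta], which vanishes by the choice of
    [e]. *)
Definition ore_w : L := y ^+ p - oreC f ore_e * y.

Lemma ore_w_comm g : ore_w * oreC f g = oreC f g * ore_w.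
Proof.
move: g; apply: comm_oreC.
have /eqP := oreYp_oreC 'X; rewrite subr_eq iter_deltaX rmorphM /= => /eqP E.
rewrite mulrBl mulrBr E -mulrA oreY_oreC deltaX mulrDr !mulrA opprD.
by rewrite (oreC_commute f ore_e) [oreC f f * _ + _]addrC -(oreC_commute f f) addrACA subrr addr0.
Qed.

Lemma iter_delta_p g : iter p (delta f) g = ore_e * delta f g.
Proof.
have /eqP := ore_w_comm g; rewrite mulrBl mulrBr subr_eq addrAC -addrA => /eqP E.
apply: (@oreC_inj _ f); rewrite -oreYp_oreC E [LHS]addrC addKr -mulrA oreY_oreC mulrDr.
by rewrite !mulrA (oreC_commute _ g) addrAC subrr add0r -rmorphM -mulrA.
Qed.

(** Compute [delta^p f] twice. As [f = delta x] it is [delta (delta^p x) = delta (f e)], and by the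
    previous lemma it is [e delta f]. The product rule leaves [f delta e = 0]. *)
Lemma delta_ore_e : delta f ore_e = 0.
Proof.
have := iter_delta_p f; rewrite -{2}deltaX -iterSr iterS iter_deltaX deltaM mulrC.
move/(canRL (addKr _)); rewrite addNr => /eqP; rewrite mulf_eq0 (negPf f0).
by move/eqP.
Qed.

Lemma deriv_ore_e : ore_e^`() = 0.
Proof. by move/eqP: delta_ore_e; rewrite mulf_eq0 (negPf f0) => /eqP. Qed.

Lemma delta_expp g : delta f (g ^+ p) = 0.
Proof.
rewrite delta_sum_exp -mulr_natr -(rmorph_nat (@polyC K)) (pcharf0 hp) raddf0.
by rewrite mulr0.
Qed.

Lemma oreC_central g : delta f g = 0 -> oreC f g \in @centralb K L.
Proof.
move=> dg; apply: central_of_gens; first exact: oreC_commute.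
by rewrite oreY_oreC dg raddf0 addr0.
Qed.

Lemma ore_w_central : ore_w \in @centralb K L.
Proof.
apply: central_of_gens; first exact: ore_w_comm.
rewrite /ore_w mulrBl mulrBr -exprSr -exprS !mulrA.
by rewrite [y * oreC f _]oreY_oreC delta_ore_e raddf0 addr0.
Qed.

Definition centre_x : Z := Centre (oreC_central (delta_expp 'X)).
Definition centre_e : Z := Centre (oreC_central delta_ore_e).
Definition centre_w : Z := Centre ore_w_central.

Lemma oreYp : y ^+ p = ore_w + oreC f ore_e * y.
Proof. by rewrite subrK. Qed.

Definition xy_monomial (k : 'I_p * 'I_p) : L := y ^+ k.1 * x ^+ k.2.

Lemma centreC (z : Z) (a : L) : a * val z = val z * a.
Proof. by have /centralbP -> := centre_valP z. Qed.

Section Spanning.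
Variable Q : set L.
Hypotheses (Qcentral : forall z, Q z -> z \in @centralb K L).
Hypotheses (QC : forall c, Q c%:A) (QD : forall z t, Q z -> Q t -> Q (z + t)).
Hypotheses (QM : forall z t, Q z -> Q t -> Q (z * t)).
Hypotheses (Qx : Q (oreC f ('X ^+ p))) (Qe : Q (oreC f ore_e)) (Qw : Q ore_w).

(** The coefficient set [Q] is kept abstract because it is taken to be the whole centre in one use
    and the image of a polynomial ring in two variables in the other. The span of the monomials
    [y^j x^i] is stable under left multiplication by [y] and right multiplication by [x], which
    suffices to reach every element. *)
Lemma xy_spans_over (a : L) : exists2 z : 'I_p * 'I_p -> L,
  forall k, Q (z k) & a = \sum_k z k * xy_monomial k.
Proof.
pose S (a : L) := exists2 z : 'I_p * 'I_p -> L,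
  forall k, Q (z k) & a = \sum_k z k * xy_monomial k.
have Q0 : Q 0 by rewrite -(scale0r 1); apply: QC.
have S0 : S 0 by exists (fun=> 0) => //; rewrite big1 // => k _; rewrite mul0r.
have SD u v : S u -> S v -> S (u + v).
  move=> [c cQ ->] [d dQ ->]; exists (fun k => c k + d k) => [k|]; first exact: QD.
  by rewrite -big_split; apply: eq_bigr => k _; rewrite mulrDl.
have SZ z u : Q z -> S u -> S (z * u).
  move=> zQ [c cQ ->]; exists (fun k => z * c k) => [k|]; first exact: QM.
  by rewrite mulr_sumr; apply: eq_bigr => k _; rewrite mulrA.
have Smon i j : (i < p)%N -> (j < p)%N -> S (y ^+ i * x ^+ j).
  move=> ip jp; exists (fun k => if k == (Ordinal ip, Ordinal jp) then 1 else 0) => [k|].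
    by case: ifP => _ //; rewrite -(scale1r 1); apply: QC.
  rewrite (bigD1 (Ordinal ip, Ordinal jp)) //= eqxx mul1r big1 ?addr0 // => k /negPf ->.
  by rewrite mul0r.
have Ssum (c : 'I_p * 'I_p -> L) (F : 'I_p * 'I_p -> L) : (forall k, Q (c k)) ->
    (forall k, S (F k)) -> S (\sum_k c k * F k).
  move=> cQ SF; elim/big_rec: _ => [|k u _ Su]; last by apply: SD => //; apply: SZ.
  exact: S0.
have S1 : S 1 by rewrite -[1]mulr1; apply: (Smon 0%N 0%N); apply: pchar_gt0.
have Qcomm z a' : Q z -> a' * z = z * a' by move=> /Qcentral/centralbP ->.
have Sy u : S u -> S (y * u).
  move=> [c cQ ->]; rewrite mulr_sumr.
  under eq_bigr => k _ do rewrite mulrA (Qcomm (c k)) // -mulrA.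
  apply: Ssum => // -[i j]; rewrite /xy_monomial /= mulrA -exprS.
  have [ip|] := ltnP i.+1 p; first exact: Smon.
  move=> pi; have -> : i.+1 = p by apply/eqP; rewrite eqn_leq pi ltn_ord.
  (* At the top exponent, [y^p x^j = w x^j + e y x^j]; the second term is a monomial because
     [1 < p]. *)
  rewrite oreYp mulrDl -mulrA; apply: SD; apply: SZ => //; last first.
    by apply: (Smon 1%N) => //; apply: pchar_gt1.
  by rewrite -[x ^+ _]mul1r; apply: (Smon 0%N) => //; apply: pchar_gt0.
have Sx u : S u -> S (u * x).
  move=> [c cQ ->]; rewrite mulr_suml; under eq_bigr do rewrite -mulrA.
  apply: Ssum => // -[i j]; rewrite /xy_monomial /= -mulrA -exprSr.
  have [jp|] := ltnP j.+1 p; first exact: Smon.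
  move=> pj; have -> : j.+1 = p by apply/eqP; rewrite eqn_leq pj ltn_ord.
  rewrite -rmorphXn /= (Qcomm (oreC f _)) //; apply: SZ => //; rewrite -[y ^+ _]mulr1.
  by apply: (Smon _ 0%N) => //; apply: pchar_gt0.
have SC g : S (oreC f g).
  elim/poly_ind: g => [|g c IH]; first by rewrite raddf0.
  rewrite raddfD /= rmorphM /=; apply: SD; first exact: Sx.
  by rewrite oreC_polyC -[c%:A]mulr1; apply: SZ.
(* Powers of [y] stand on the right here, so they are exchanged with [g] one at a time, using
   stability under left multiplication by [y]. *)
have SCy i : forall g, S (oreC f g * y ^+ i).
  elim: i => [|i IH] g; first by rewrite mulr1.
  rewrite exprS mulrA oreC_oreY mulrBl -mulrA; apply: SD; first exact: Sy.
  by rewrite -mulNr -raddfN; apply: IH.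
rewrite [a]ore_expand; elim/big_rec: _ => [|i u _ Su]; last exact: SD.
exact: S0.
Qed.

End Spanning.

Lemma xy_spans (a : L) :
  exists z : 'I_p * 'I_p -> Z, a = \sum_k val (z k) * xy_monomial k.
Proof.
have [||||||| z zQ ->] := @xy_spans_over (fun z => z \in @centralb K L) _ _ _ _ _ _ _ a => //.
- by move=> c; apply: (valP (c%:A : Z)).
- by move=> z t hz ht; apply: (valP (Centre hz + Centre ht : Z)).
- by move=> z t hz ht; apply: (valP (Centre hz * Centre ht : Z)).
- exact: (valP centre_x).
- exact: (valP centre_e).
- exact: (valP centre_w).
by exists (fun k => Centre (zQ k)).
Qed.

Section LeftIdeal.
Variable J : set L.
Hypotheses (sJ : submodule (J : set L^o)).
Hypothesis Jx : forall a, J a -> J (x * a - a * x).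
Hypothesis Jf : forall c : L, c * x = x * c -> J (oreC f f * c) -> J c.

(** Commuting [n] times with [x] leaves the coefficient multiplied by [n! f^n] up to sign; [n < p]
    makes the integer invertible and [Jf] cancels the powers of [f]. In degree 0 the remainder is an
    empty sum, so that the element is its own coefficient. *)
Lemma leading_mem n a c : (n < p)%N -> leading n a c -> J a -> J c.
Proof.
elim: n a c => [|n IH] a c np.
  by case=> _ [d [_]]; rewrite big_ord0 mul1r => /eqP; rewrite subr_eq0 => /eqP ->.
move=> la Ja; have lx := la.1; have la' := leading_adx la.
have : J (- (oreC f f * c *+ n.+1)) by apply: (IH _ _ (ltnW np) la'); apply: Jx.
have n0 : n.+1%:R != 0 :> K by apply: natr_small.
move=> h; apply: Jf => //.
have -> : oreC f f * c = (- (n.+1%:R^-1)%:A : L) * - (oreC f f * c *+ n.+1).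
  by rewrite mulrNN mulr_algl -scaler_nat scalerA mulVf // scale1r.
exact: (@submoduleZ L L^o).
Qed.

Lemma y_coords_mem n (c : nat -> L) : (n <= p)%N -> (forall l, c l * x = x * c l) ->
  (forall l, J (c l) -> J (y ^+ l * c l)) ->
  J (\sum_(l < n) y ^+ l * c l) -> forall l, (l < n)%N -> J (c l).
Proof.
move=> np cx cJ; elim: n np => // n IH np; rewrite big_ord_recr /=.
move=> Js; have Jn : J (c n).
  apply: (leading_mem np _ Js); split=> //; rewrite addrK; by exists c.
move=> l; rewrite ltnS leq_eqVlt => /predU1P[->//|ln]; apply: IH => //.
  exact: ltnW.
by rewrite -[X in J X](addrK (y ^+ n * c n)); apply: (@submoduleB _ L^o) => //; apply: cJ.
Qed.

End LeftIdeal.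

End OreCharP.

(** * Finite dimensionality of simple modules *)

Lemma multiples_two_sided (A : comNzRingType) (a : A) :
  two_sided [set b | exists q, b = a * q].
Proof.
split=> [|_ _ [q ->] [r ->]|b _ [q ->]]; first by exists 0; rewrite mulr0.
  by exists (q + r); rewrite mulrDr.
by split; exists (q * b); rewrite mulrA // mulrC -mulrA.
Qed.

Section CentralAction.
Variables (K : fieldType) (A : algType K) (N : lmodType A) (sN : simple N).

Lemma central_kill (z : A) (v : N) : (forall a, z * a = a * z) -> v != 0 ->
  z *: v = 0 -> forall u : N, z *: u = 0.
Proof.
move=> zc v0 zv u; have [a ->] := simple_gen sN v0 u.
by rewrite scalerA zc -scalerA zv scaler0.
Qed.

Lemma central_onto (z : A) (v : N) : (forall a, z * a = a * z) -> z *: v != 0 ->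
  forall u : N, exists w, u = z *: w.
Proof.
move=> zc zv u; have [a ->] := simple_gen sN zv u; exists (a *: v).
by rewrite !scalerA zc.
Qed.

Section TwoCentral.
Variables (z1 z2 : A).
Hypotheses (c1 : forall a, z1 * a = a * z1) (c2 : forall a, z2 * a = a * z2).

Definition eval1 : {rmorphism {poly K} -> A} := horner_alg z1.

Lemma eval2_comm : commr_rmorph eval1 z2.
Proof. by move=> q; rewrite /GRing.comm c2. Qed.

(** The inner variable goes to [z1] and the outer one to [z2], so that pseudo-division in the outer
    variable bounds the powers of [z2] over [K[z1]]. *)
Definition eval2 : {rmorphism {poly {poly K}} -> A} := horner_morph eval2_comm.

Lemma eval1E n (q : {poly K}) : (size q <= n)%N ->
  eval1 q = \sum_(i < n) q`_i *: z1 ^+ i.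
Proof.
move=> qn; rewrite /eval1 /= /horner_alg /horner_morph (@horner_coef_wide _ n).
  by apply: eq_bigr => i _; rewrite coef_map /= mulr_algl.
exact: leq_trans (size_poly _ _) qn.
Qed.

Lemma eval1_central q a : eval1 q * a = a * eval1 q.
Proof.
rewrite (eval1E (leqnn _)) mulr_suml mulr_sumr; apply: eq_bigr => i _.
rewrite -scalerAl -scalerAr; congr (_ *: _).
elim: (i : nat) => [|k IH]; first by rewrite mul1r mulr1.
by rewrite exprS -mulrA IH !mulrA c1.
Qed.

Lemma eval2E n (q : {poly {poly K}}) : (size q <= n)%N ->
  eval2 q = \sum_(i < n) eval1 q`_i * z2 ^+ i.
Proof.
move=> qn; rewrite /eval2 /= /horner_morph (@horner_coef_wide _ n); last first.
  exact: leq_trans (size_poly _ _) qn.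
by apply: eq_bigr => i _; rewrite coef_map.
Qed.

Lemma eval2C q : eval2 q%:P = eval1 q.
Proof. exact: horner_morphC. Qed.

Variables (r : nat) (g : 'I_r -> N).
Hypothesis g_span : spans (g : 'I_r -> restr eval2 N).

(* Zariski's lemma for two generators: if every nonzero polynomial in z1 acted
   invertibly, then N would be a K(z1)-module that is finitely generated over
   some localization K[z1][1 / phi], and a polynomial prime to phi cannot act
   invertibly on such a module. *)
Lemma central_algebraic : exists2 psi : {poly K}, psi != 0 & forall v : N, eval1 psi *: v = 0.
Proof.
have [[v0 v0N] _] := sN.
have kill1 psi : eval1 psi *: v0 = 0 -> forall v : N, eval1 psi *: v = 0.
  by move=> h; apply: (central_kill (eval1_central psi) v0N h).
have [z1v|z1v] := eqVneq (z1 *: v0) 0.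
  exists 'X; first by rewrite polyX_eq0.
  by apply: kill1; rewrite /eval1 /= /horner_alg horner_morphX.
have [G [G0 Gv]] : exists G : {poly {poly K}}, G != 0 /\ forall i, eval2 G *: g i = 0.
  have hX k : exists c : 'I_r -> {poly {poly K}}, g k = \sum_j eval2 ('X%:P * c j) *: g j.
    have [w gw] := central_onto c1 z1v (g k); have [c wE] := g_span w; exists c.
    rewrite gw [w]wE scaler_sumr; apply: eq_bigr => j _.
    rewrite rmorphM /= eval2C -scalerA; congr (_ *: _).
    by rewrite /eval1 /= /horner_alg horner_morphX.
  have [c cE] := choice hX.
  (* Nakayama's lemma for [N = z1 N]. The polynomial obtained is 1 when the inner variable is set to
     0, hence nonzero. *)
  have [|k|h [q ->] hg] := @nakayama _ _ (multiples_two_sided ('X%:P : {poly {poly K}}))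
    (restr eval2 N) r g 1 (fun i j => 'X%:P * c i j).
  - by move=> i j; exists (c i j).
  - by rewrite scale1r [LHS]cE.
  exists (1 + 'X%:P * q); split; last by move=> k; have := hg k; rewrite expr1n.
  apply/eqP => /(congr1 (map_poly (horner_eval 0))).
  rewrite rmorphD rmorphM rmorph1 rmorph0 /= map_polyC /= horner_evalE hornerX mul0r addr0.
  by move/eqP; rewrite oner_eq0.
set phi := lead_coef G; have phi0 : phi != 0 by rewrite lead_coef_eq0.
pose T := ('I_r * 'I_(size G))%type.
pose E (j : 'I_#|{: T}|) : N := z2 ^+ (enum_val j).2 *: g (enum_val j).1.
pose U (v : N) := exists d : 'I_#|{: T}| -> {poly K}, v = \sum_j eval1 (d j) *: E j.
have UD u v : U u -> U v -> U (u + v).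
  move=> [c ->] [d ->]; exists (fun j => c j + d j); rewrite -big_split.
  by apply: eq_bigr => j _; rewrite raddfD scalerDl.
have UZ q u : U u -> U (eval1 q *: u).
  move=> [c ->]; exists (fun j => q * c j); rewrite scaler_sumr.
  by apply: eq_bigr => j _; rewrite rmorphM scalerA.
have U0 : U 0 by exists (fun=> 0); rewrite big1 // => j _; rewrite raddf0 scale0r.
have UE i k : (k < size G)%N -> U (z2 ^+ k *: g i).
  move=> kG; exists (fun j => if j == enum_rank (i, Ordinal kG) then 1 else 0).
  rewrite (bigD1 (enum_rank (i, Ordinal kG))) //= eqxx rmorph1 scale1r.
  rewrite /E enum_rankK big1 ?addr0 // => j /negPf ->.
  by rewrite raddf0 scale0r.
have Uphi v : exists M, U (eval1 (phi ^+ M) *: v).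
  have [c ->] := g_span v.
  apply: (big_rec (fun v : N => exists M, U (eval1 (phi ^+ M) *: v))) => [|i u _ [M Mu]].
    by exists 0%N; rewrite scaler0.
  (* [phi ^+ s] is the factor introduced by pseudo-division by [G]; the remainder involves only
     powers of [z2] allowed in [U]. *)
  pose s := Pdiv.Idomain.scalp (c i) G.
  exists (M + s)%N; rewrite scalerDr; apply: (UD); last first.
    by rewrite addnC exprD rmorphM -scalerA; apply: (UZ).
  rewrite exprD rmorphM -scalerA; apply: (UZ).
  have -> : eval1 (phi ^+ s) *: (c i *: (g i : restr eval2 N)) =
      eval2 (Pdiv.Idomain.modp (c i) G) *: g i.
    transitivity (eval2 (phi ^+ s *: c i) *: g i).
      by rewrite -mul_polyC rmorphM /= eval2C -scalerA.
    by rewrite Pdiv.Idomain.divp_eq rmorphD rmorphM scalerDl -scalerA Gv scaler0 add0r.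
  rewrite (@eval2E (size G)); last by apply/ltnW; rewrite Pdiv.Idomain.ltn_modp.
  rewrite scaler_suml; apply: (big_ind U) => // k _.
  by rewrite -scalerA; apply/UZ/UE.
(* A nonconstant polynomial visibly prime to [phi], by the identity [pi - phi X = 1]. *)
pose pi := phi * 'X + 1.
have pi_size : (1 < size pi)%N.
  by rewrite size_polyDl size_mulX ?size_poly1 // ltnS size_poly_gt0.
have pi_coprime M : coprimep pi (phi ^+ M).
  by apply: coprimep_expr; apply/Bezout_coprimepP; exists (1, - 'X);
    rewrite mul1r mulNr mulrC addrAC subrr add0r eqpxx.
have [pv|pv] := eqVneq (eval1 pi *: v0) 0.
  exists pi; first by rewrite -size_poly_gt0 ltnW.
  exact: kill1.
have hE j : exists M (d : 'I_#|{: T}| -> {poly K}),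
    eval1 (phi ^+ M) *: E j = \sum_l eval1 (pi * d l) *: E l.
  have [u uE] := central_onto (eval1_central pi) pv (E j).
  have [M [d dE]] := Uphi u; exists M, d.
  rewrite uE scalerA eval1_central -scalerA dE scaler_sumr.
  by apply: eq_bigr => l _; rewrite rmorphM scalerA.
have [M /choice[d dE]] := choice hE.
(* A common exponent for the denominators. The relations now read [phi ^+ Mt E_j] in [pi] times the
   span, ready for the determinant trick with [b = phi ^+ Mt]. *)
pose Mt := (\sum_j M j)%N.
pose c j l := phi ^+ (Mt - M j) * (pi * d j l).
have [|j|h [q ->] hE0] := @nakayama _ _ (multiples_two_sided pi)
    (restr eval1 N) _ E (phi ^+ Mt) c.
- by move=> i j; exists (phi ^+ (Mt - M i) * d i j); rewrite /c mulrCA.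
- have Mj : (M j <= Mt)%N by rewrite /Mt (bigD1 j) //= leq_addr.
  transitivity (eval1 (phi ^+ (Mt - M j) * phi ^+ M j) *: E j).
    by rewrite -exprD subnK.
  rewrite rmorphM -scalerA dE scaler_sumr; apply: eq_bigr => l _.
  by rewrite scalerA -rmorphM.
set psi := phi ^+ Mt ^+ _ + pi * q in hE0.
(* Otherwise [pi] would divide a power of [phi], to which it is prime. *)
have psi0 : psi != 0.
  apply/eqP => psi0; have : pi %| phi ^+ (Mt * #|{: T}|).
    move/eqP: psi0; rewrite /psi -exprM addr_eq0 => /eqP ->.
    by rewrite -mulrN dvdp_mulr.
  move=> pd; have := pi_coprime (Mt * #|{: T}|)%N.
  by rewrite /coprimep (eqp_size (dvdp_gcd_idl pd)) gtn_eqF.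
(* [psi] kills the generators of [U], and [v0] enters [U] only after multiplication by a further
   power of [phi]. *)
have [M' [d' d'E]] := Uphi v0.
exists (psi * phi ^+ M'); first by rewrite mulf_neq0 // expf_neq0.
apply: kill1; rewrite rmorphM -scalerA d'E scaler_sumr big1 // => j _.
by rewrite scalerA eval1_central -scalerA [_ *: E j]hE0 scaler0.
Qed.

(** Division by [psi1] and [psi2] bounds the exponents of [z1] and [z2], so finitely many products
    [z1^l z2^k g_i] span over [K]. *)
Lemma central_finite (psi1 psi2 : {poly K}) : psi1 != 0 -> psi2 != 0 ->
  (forall v : N, eval1 psi1 *: v = 0) -> (forall v : N, horner_alg z2 psi2 *: v = 0) ->
  exists n (e : 'I_n -> restr (in_alg A) N), spans e.
Proof.
move=> psi1_0 psi2_0 k1 k2.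
pose T := ('I_r * 'I_(size psi1) * 'I_(size psi2))%type.
pose E (j : 'I_#|{: T}|) : restr (in_alg A) N :=
  let: (i, l, k) := enum_val j in z1 ^+ l *: (z2 ^+ k *: g i).
exists #|{: T}|, E; pose U := [set v | exists c : 'I_#|{: T}| -> K, v = \sum_j c j *: E j].
have sU : submodule U := span_submodule E.
move=> v; rewrite -/(U v).
have UE i l k : (l < size psi1)%N -> (k < size psi2)%N -> U (z1 ^+ l *: (z2 ^+ k *: g i)).
  move=> lp kp; have <- : E (enum_rank (i, Ordinal lp, Ordinal kp)) = z1 ^+ l *: (z2 ^+ k *: g i).
    by rewrite /E enum_rankK.
  exact: span_mem.
have UZ (c : K) (u : N) : U u -> U (c%:A *: u).
  exact: (@submoduleZ K (restr (in_alg A) N)).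
have U1 i k q : (k < size psi2)%N -> U (eval1 q *: (z2 ^+ k *: g i)).
  move=> kp; rewrite [q](divp_eq _ psi1) rmorphD rmorphM scalerDl -scalerA k1 scaler0 add0r.
  rewrite (@eval1E (size psi1)); last by rewrite ltnW // ltn_modp.
  rewrite scaler_suml; apply: (submodule_sum _ sU) => l.
  by rewrite -mulr_algl -scalerA; apply/UZ/UE.
have U2 i q : U (eval2 q *: g i).
  pose Psi : {poly {poly K}} := map_poly polyC psi2.
  have sizePsi : size Psi = size psi2 by rewrite size_map_poly.
  have Psi0 : Psi != 0 by rewrite -size_poly_gt0 sizePsi size_poly_gt0.
  have ePsi (u : N) : eval2 Psi *: u = 0.
    rewrite -[RHS](k2 u); congr (_ *: _); rewrite (@eval2E (size psi2)) ?sizePsi //.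
    rewrite /horner_alg /horner_morph (@horner_coef_wide _ (size psi2)) ?size_poly //.
    by apply: eq_bigr => k _; rewrite !coef_map /= /horner_alg horner_morphC.
  have lP : lead_coef Psi = (lead_coef psi2)%:P by rewrite lead_coef_map.
  have l0 : lead_coef psi2 ^+ Pdiv.Idomain.scalp q Psi != 0 by rewrite expf_neq0 // lead_coef_eq0.
  (* [psi2] need not be monic, but its leading coefficient is a nonzero constant of [K], so the
     pseudo-division factor can be inverted. *)
  have E2 : eval2 q *: g i = ((lead_coef psi2 ^+ Pdiv.Idomain.scalp q Psi)^-1)%:A *:
      (eval2 (Pdiv.Idomain.modp q Psi) *: g i).
    have -> : eval2 (Pdiv.Idomain.modp q Psi) *: g i =
        (lead_coef psi2 ^+ Pdiv.Idomain.scalp q Psi)%:A *: (eval2 q *: g i).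
      transitivity (eval2 (lead_coef Psi ^+ Pdiv.Idomain.scalp q Psi *: q) *: g i).
        by rewrite Pdiv.Idomain.divp_eq rmorphD rmorphM scalerDl -scalerA ePsi scaler0 add0r.
      rewrite lP -rmorphXn -mul_polyC rmorphM /= eval2C -scalerA; congr (_ *: _).
      by rewrite /eval1 /= /horner_alg horner_morphC.
    by rewrite [RHS]scalerA mulr_algl (scalerA _ _ (1 : A)) mulVf // !scale1r.
  rewrite E2; apply: (UZ); rewrite (@eval2E (size psi2)); last first.
    by rewrite ltnW // -sizePsi Pdiv.Idomain.ltn_modp.
  rewrite scaler_suml; apply: (submodule_sum _ sU) => k.
  by rewrite -scalerA; apply: U1.
have [c ->] := g_span v; apply: (@submodule_sum K (restr (in_alg A) N) U) => // i.
exact: U2.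
Qed.

End TwoCentral.
End CentralAction.

Lemma deriv_eq0_pchar (K : fieldType) (p : nat) (g : {poly K}) : p \in [pchar K] ->
  g^`() = 0 -> exists h : {poly K}, g = h \Po 'X^p.
Proof.
move=> hp dg; have p0 := prime_gt0 (pcharf_prime hp).
exists (\poly_(i < size g) g`_(i * p)); apply/polyP => n.
rewrite coef_comp_poly_Xn //; case: ifP => [/dvdnP[k ->]|pn].
  rewrite mulnK // coef_poly; case: ltnP => // gk; rewrite nth_default //.
  by apply: leq_trans gk _; rewrite leq_pmulr.
case: n pn => [|n] pn; first by rewrite dvdn0 in pn.
have /eqP := congr1 (fun h : {poly K} => h`_n) dg.
by rewrite coef0 coef_deriv -mulr_natr mulf_eq0 -(dvdn_pcharf hp) pn orbF => /eqP.
Qed.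

Lemma spans_separates (K : fieldType) (A : algType K) (N : lmodType A) n
  (e : 'I_n -> restr (in_alg A) N) : spans e -> separates (e : 'I_n -> N).
Proof.
move=> se a ae v; have [c ->] := se v.
rewrite (_ : \sum_i _ = \sum_i (c i)%:A *: (e i : N)) // scaler_sumr big1 // => i _.
by rewrite scalerA mulr_algr -mulr_algl -scalerA ae scaler0.
Qed.

Section SimpleOreModules.
Variables (K : fieldType) (p : nat) (hp : p \in [pchar K]) (f : {poly K}) (f0 : f != 0).
Local Notation L := (ore f).

(** [N] is generated by [v0], and [Lambda] is finite over the subalgebra generated by [x^p] and [w],
    which contains [e] as a polynomial in [x^p]. The hypotheses ask only that [x^p] and [w] be
    values of polynomials, so that they may be taken in either order. *)
Lemma eval2_spans (N : lmodType L) (v0 : N) (z1 z2 : L)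
  (c1 : forall a, z1 * a = a * z1) (c2 : forall a, z2 * a = a * z2) :
  simple N -> v0 != 0 ->
  (exists q, eval2 z1 c2 q = oreC f ('X ^+ p)) -> (exists q, eval2 z1 c2 q = ore_w p f) ->
  exists r (g : 'I_r -> N), spans (g : 'I_r -> restr (eval2 z1 c2) N).
Proof.
move=> sN v0N [qx qxE] [qw qwE].
pose Q := [set z | exists q, z = eval2 z1 c2 q].
have QX : Q (oreC f ('X ^+ p)) by exists qx.
have QC c : Q c%:A.
  by exists c%:P%:P; rewrite eval2C /eval1 /= /horner_alg horner_morphC.
have QD z t : Q z -> Q t -> Q (z + t) by move=> [q ->] [r ->]; exists (q + r); rewrite raddfD.
have QM z t : Q z -> Q t -> Q (z * t) by move=> [q ->] [r ->]; exists (q * r); rewrite rmorphM.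
have Qe : Q (oreC f (ore_e p f)).
  have [h ->] := deriv_eq0_pchar hp (deriv_ore_e hp f0).
  elim/poly_ind: h => [|h c IH]; first by rewrite comp_poly0 raddf0; exists 0; rewrite raddf0.
  rewrite comp_polyD comp_polyM comp_polyX comp_polyC raddfD /= rmorphM /= oreC_polyC.
  by apply: (QD) => //; apply: QM.
have Qc z : Q z -> z \in @centralb K L.
  move=> [q ->]; apply/centralbP => a; rewrite (eval2E z1 c2 (leqnn _)) mulr_suml mulr_sumr.
  apply: eq_bigr => i _; rewrite -mulrA [RHS]mulrA -(eval1_central c1) -[RHS]mulrA; congr (_ * _).
  elim: (i : nat) => [|k IH]; first by rewrite mul1r mulr1.
  by rewrite exprS -mulrA IH !mulrA c2.
exists #|{: 'I_p * 'I_p}|, (fun k => xy_monomial f (enum_val k) *: v0) => v.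
have [a ->] := simple_gen sN v0N v.
have [|z zQ ->] := @xy_spans_over K p hp f Q Qc QC QD QM QX Qe _ a; first by exists qw.
have [q qE] := choice zQ; exists (q \o enum_val).
rewrite scaler_suml (reindex _ (onW_bij _ (@enum_val_bij ('I_p * 'I_p)%type))) /=.
by apply: eq_bigr => k _; rewrite qE -scalerA.
Qed.

Lemma ore_simple_finite (N : lmodType L) : simple N ->
  exists n (e : 'I_n -> restr (in_alg L) N), spans e.
Proof.
move=> sN; have [[v0 v0N] _] := sN.
have cx a : oreC f ('X ^+ p) * a = a * oreC f ('X ^+ p).
  by have /centralbP := oreC_central (delta_expp hp f 'X).
have cw a : ore_w p f * a = a * ore_w p f.
  by have /centralbP := ore_w_central hp f0.
have evX z1 z2 c2 : @eval2 K L z1 z2 c2 'X = z2 by apply: horner_morphX.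
have evC z1 z2 c2 : @eval2 K L z1 z2 c2 'X%:P = z1.
  by rewrite eval2C /eval1 /= /horner_alg horner_morphX.
(* The algebraicity lemma concerns the inner variable only; it is applied to both orders of [x^p]
   and [w]. *)
have [|| r [g gs]] := @eval2_spans N v0 _ _ cx cw sN v0N; [by exists 'X%:P|by exists 'X|].
have [|| r' [g' gs']] := @eval2_spans N v0 _ _ cw cx sN v0N; [by exists 'X|by exists 'X%:P|].
have [psi1 psi1_0 k1] := central_algebraic sN cx gs.
have [psi2 psi2_0 k2] := central_algebraic sN cw gs'.
exact: (central_finite gs psi1_0 psi2_0 k1 k2).
Qed.

Lemma ore_simple_separates (N : lmodType L) : simple N ->
  exists n (v : 'I_n -> N), separates v.
Proof.
move=> /ore_simple_finite[n [e se]]; exists n, e; exact: spans_separates.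
Qed.

End SimpleOreModules.

(** * Maximal ideals of the centre *)

Lemma max_comm_inv (A : comNzRingType) (m : set A) (a : A) : Max m -> ~ m a ->
  exists b, m (b * a - 1).
Proof.
move=> [tm [m1 mmax]] ma; have [m0 mD mM] := tm.
pose J := [set u | exists s z, m s /\ u = s + z * a].
have tJ : two_sided J.
  split=> [|_ _ [s [z [ms ->]]] [s' [z' [ms' ->]]]|b _ [s [z [ms ->]]]].
  - by exists 0, 0; rewrite mul0r addr0.
  - by exists (s + s'), (z + z'); split; [exact: mD|rewrite mulrDl addrACA].
  - have h : J (b * (s + z * a)).
      by exists (b * s), (b * z); split; [exact: (mM _ _ _).1|rewrite mulrDr mulrA].
    by split=> //; rewrite mulrC.
have [[s [z [ms E]]]|J1] := pselect (J 1).
  exists z; have -> : z * a - 1 = - s by rewrite E opprD addrCA subrr addr0.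
  exact: ideal_opp.
case: ma; rewrite -(mmax J tJ J1) => [|s ms]; first by exists 0, 1; rewrite mul1r add0r.
by exists s, 0; rewrite mul0r addr0.
Qed.

Lemma max_comm_prime (A : comNzRingType) (m : set A) : Max m -> prime_ideal m.
Proof.
move=> mm; have [[m0 mD mM] [m1 _]] := mm; split=> // a b mab.
have [|/(max_comm_inv mm)[c mc]] := pselect (m a); [by left|right].
have -> : b = c * (a * b) - (c * a - 1) * b by rewrite mulrBl mul1r mulrA opprB addrC subrK.
apply: (mD); first exact: (mM _ _ mab).1.
by apply: ideal_opp => //; apply: (mM _ _ mc).2.
Qed.

Lemma lspan_central_two_sided (R : nzRingType) (X : set R) :
  (forall z a, X z -> z * a = a * z) -> two_sided (lspan (X : set R^o)).
Proof.
move=> Xc; have sX := lspan_submodule (X : set R^o).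
have [X0 XD] := sX.
split=> // [a b Xa Xb|a b Xb]; first exact: (@submoduleD R R^o).
split; first exact: (@submoduleZ R R^o).
case: Xb => n [c [e [Xe ->]]]; rewrite mulr_suml; apply: (@submodule_sum R R^o _ _ _ _ sX) => i.
rewrite -[c i *: e i]/(c i * e i) -mulrA (Xc _ _ (Xe i)) mulrA; apply: (@submoduleZ R R^o) => //.
exact: lspan_sub.
Qed.

Section MaximalCentral.
Variables (K : fieldType) (p : nat) (hp : p \in [pchar K]) (f : {poly K}) (f0 : f != 0).
Local Notation L := (ore f).
Local Notation x := (oreC f 'X).
Local Notation y := (oreY f).
Local Notation Z := (centre L).

Lemma extend_two_sided (m : set Z) : two_sided (extend m).
Proof.
apply: lspan_central_two_sided => _ a [z mz <-].
by have /centralbP := centre_valP z.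
Qed.

Lemma extend_mem (m : set Z) z : m z -> extend m (val z).
Proof. by move=> mz; apply: lspan_sub; exists z. Qed.

(** The commutator with [y] is [f] times the derivative in [x]. By induction the coefficients of the
    derivative lie in [J]; the integers [i.+1 < p] are invertible, and the constant coefficient is
    what remains. *)
Lemma x_coords_mem (J : set L) (z : nat -> Z) n : two_sided J ->
  (forall c : L, J (oreC f f * c) -> J c) -> (n <= p)%N ->
  J (\sum_(i < n) x ^+ i * val (z i)) -> forall i, (i < n)%N -> J (val (z i)).
Proof.
move=> tJ Jf; have sJ := two_sided_submodule tJ; have [_ _ JM] := tJ.
elim: n z => // n IH z np Jz.
have Jsucc i : (i < n)%N -> J (val (z i.+1)).
  move=> lin; have Jd : J (\sum_(i < n) x ^+ i * val (z i.+1 *+ i.+1)).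
    apply: Jf; have -> : oreC f f * \sum_(i < n) x ^+ i * val (z i.+1 *+ i.+1) =
        y * (\sum_(i < n.+1) x ^+ i * val (z i)) - (\sum_(i < n.+1) x ^+ i * val (z i)) * y.
      rewrite !mulr_sumr mulr_suml -sumrB big_ord_recl /= mul1r centreC subrr add0r.
      apply: eq_bigr => j _; rewrite -mulrA -[val _ * y]centreC !mulrA -mulrBl.
      rewrite /bump /= add1n -(rmorphXn (oreC f) j.+1) /= oreY_oreC addrAC subrr add0r.
      rewrite delta_sum_exp deltaX raddfMn /= rmorphM /= -(rmorphXn (oreC f) j) /= (oreC_commute f f).
      have -> : centre_val (z j.+1 *+ j.+1) = centre_val (z j.+1) *+ j.+1 by apply: (raddfMn val).
      by rewrite mulrnAr mulrnAl.
    by apply: (@submoduleB _ L^o) => //; [apply: (JM _ _ Jz).1|apply: (JM _ _ Jz).2].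
  have := IH (fun i => z i.+1 *+ i.+1) (ltnW np) Jd i lin.
  rewrite raddfMn /= -scaler_nat => Jz'.
  have i0 : i.+1%:R != 0 :> K by apply: (natr_small hp); rewrite /= (leq_trans _ np).
  rewrite -[val _]scale1r -(mulVf i0) -scalerA -mulr_algl; exact: (JM _ _ _).1.
move=> [|i] ni; last exact: Jsucc.
move: Jz; rewrite big_ord_recl /= mul1r => Jz.
rewrite -[val _](addrK (\sum_(i < n) x ^+ (bump 0 i) * val (z (bump 0 i)))).
apply: (@submoduleB _ L^o) => //; apply: (@submodule_sum _ L^o) => // j.
by apply: (JM _ _ _).1; apply: Jsucc.
Qed.

(** Two layers: commuting with [x] isolates the coefficients of the powers of [y], which are
    polynomials in [x] over the centre, then commuting with [y] isolates their coefficients. *)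
Lemma coords_mem (J : set L) (z : 'I_p * 'I_p -> Z) nu : two_sided J ->
  J (nu * oreC f f - 1) -> J (\sum_k val (z k) * xy_monomial f k) ->
  forall k, J (val (z k)).
Proof.
move=> tJ Jnu; have sJ := two_sided_submodule tJ; have [_ _ JM] := tJ.
have Jf c : J (oreC f f * c) -> J c.
  move=> Jc; have -> : c = nu * (oreC f f * c) - (nu * oreC f f - 1) * c.
    by rewrite mulrBl mul1r mulrA opprB addrC subrK.
  by apply: (@submoduleB _ L^o) => //; [apply: (JM _ _ Jc).1|apply: (JM _ _ Jnu).2].
(* Extension by 0 to all natural indices, since the coefficient lemmas use families over [nat]. *)
pose zz j i := if (insub j, insub i) is (Some j', Some i') then z (j', i') else 0.
have zzE (j i : 'I_p) : zz j i = z (j, i) by rewrite /zz !valK.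
pose c j := \sum_(i < p) x ^+ i * val (zz j i).
have -> : \sum_k val (z k) * xy_monomial f k = \sum_(j < p) y ^+ j * c j.
  under [RHS]eq_bigr do rewrite /c mulr_sumr.
  rewrite pair_bigA; apply: eq_bigr => -[j i] _ /=.
  by rewrite /xy_monomial zzE -centreC mulrA.
have cx l : c l * x = x * c l.
  rewrite mulr_suml mulr_sumr; apply: eq_bigr => i _.
  by rewrite -[LHS]mulrA -centreC !mulrA -exprSr -exprS.
move=> Jc [j i].
have Jcl : forall l, (l < p)%N -> J (c l).
  apply: (@y_coords_mem K p hp f J sJ) => //.
  - by move=> a Ja; apply: (@submoduleB _ L^o) => //; [apply: (JM _ _ Ja).1|apply: (JM _ _ Ja).2].
  - by move=> a _; apply: Jf.
  - by move=> l Jl; apply: (JM _ _ Jl).1.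
by rewrite -zzE; apply: (@x_coords_mem J (zz j) p) => //; apply: Jcl.
Qed.

Lemma extend_coords (m : set Z) (a : L) : two_sided m -> extend m a ->
  exists z : 'I_p * 'I_p -> Z, (forall k, m (z k)) /\ a = \sum_k val (z k) * xy_monomial f k.
Proof.
move=> tm; have [m0 mD mM] := tm.
pose S : set L^o := [set a | exists z : 'I_p * 'I_p -> Z,
  (forall k, m (z k)) /\ a = \sum_k val (z k) * xy_monomial f k].
have S0 : S 0 by exists (fun=> 0); split=> //; rewrite big1 // => k _; rewrite raddf0 mul0r.
have SD u v : S u -> S v -> S (u + v).
  move=> [c [cm ->]] [d [dm ->]]; exists (fun k => c k + d k); split=> [k|]; first exact: mD.
  by rewrite -big_split; apply: eq_bigr => k _; rewrite raddfD mulrDl.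
have Sm z u : m z -> S (val z * u).
  move=> mz; have [c ->] := xy_spans hp f0 u; exists (fun k => z * c k); split=> [k|].
    exact: (mM _ _ mz).2.
  by rewrite mulr_sumr; apply: eq_bigr => k _; rewrite rmorphM mulrA.
apply: (@lspan_min _ L^o _ S) => [|_ [z mz <-]]; last by rewrite -[val z]mulr1; apply: Sm.
split=> // b u v Su Sv; apply: (SD) => //; case: Su => z [zm ->].
rewrite -[_ *: _]/(b * _) mulr_sumr; apply: (big_ind S) => // k _.
by rewrite mulrA centreC -mulrA; apply: Sm.
Qed.

Section OneIdeal.
Variables (m : set Z) (mm : Max m) (mf : ~ Vset (oreC f f ^+ p) m).
Local Notation I := (extend m).

Lemma centre_expf : exists2 c : Z, val c = oreC f f ^+ p & ~ m c.
Proof.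
pose c : Z := Centre (oreC_central (delta_expp hp f f)).
have cE : val c = oreC f f ^+ p by rewrite /= rmorphXn.
by exists c => // mc; apply: mf; split; [exact: max_comm_prime|exists c].
Qed.

Lemma extend_expf_inv : exists u : Z, I (val u * oreC f f ^+ p - 1).
Proof.
have [c cE mc] := centre_expf; have [u mu] := max_comm_inv mm mc.
by exists u; have := extend_mem mu; rewrite -cE.
Qed.

Lemma extend_f_inv : exists nu : L, I (nu * oreC f f - 1).
Proof.
have [u mu] := extend_expf_inv; exists (val u * oreC f f ^+ p.-1).
by rewrite -mulrA -exprSr prednK // (pchar_gt0 hp).
Qed.

(** Were [Lambda = Lambda m], Nakayama's lemma over the centre would give [h] in [m] with [1 + h]
    killing the monomials, among them 1; then [1 + h = 0] and [m] would not be proper. *)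
Lemma extend_proper : ~ I 1.
Proof.
move=> I1; have [tm [m1 _]] := mm.
have [_ _ IM] := extend_two_sided m.
have Ik (k : 'I_p * 'I_p) : I (xy_monomial f k) by rewrite -[xy_monomial f k]mulr1; apply: (IM _ _ I1).1.
have [c cE] := choice (fun k => extend_coords tm (Ik k)).
pose T := ('I_p * 'I_p)%type.
have [||h mh hk] := @nakayama _ m tm (restr val L^o) #|{: T}|
    (fun i => xy_monomial f (enum_val i)) 1 (fun i j => c (enum_val i) (enum_val j)).
- by move=> i j; case: (cE (enum_val i)).
- move=> i; rewrite scale1r [LHS](cE _).2.
  by rewrite (reindex _ (onW_bij _ (@enum_val_bij T))).
have := hk (enum_rank (Ordinal (pchar_gt0 hp), Ordinal (pchar_gt0 hp))).
rewrite expr1n enum_rankK /xy_monomial /= => E; apply: m1.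
have : 1 + h = 0.
  apply: val_inj; transitivity (val (1 + h) * (y ^+ 0 * x ^+ 0) : L); last exact: E.
  by rewrite !expr0 !mulr1.
by move/eqP; rewrite addr_eq0 => /eqP ->; apply: ideal_opp.
Qed.

Lemma extend_val z : I (val z) -> m z.
Proof.
move=> Iz; apply: contrapT => /(max_comm_inv mm)[b mb]; apply: extend_proper.
have [_ ID IM] := extend_two_sided m.
have -> : 1 = val b * val z - val (b * z - 1).
  by rewrite /= opprB addrC subrK.
apply: (@submoduleB _ L^o); [exact/two_sided_submodule/extend_two_sided| |exact: extend_mem].
exact: (IM _ _ Iz).1.
Qed.

Lemma extend_max : Max I.
Proof.
have tI := extend_two_sided m; split=> //; split=> [|J tJ J1 IJ]; first exact: extend_proper.
apply/seteqP; split=> // a Ja; have [z aE] := xy_spans hp f0 a.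
have [nu Inu] := extend_f_inv; have [_ ID IM] := tI; have [_ JD JM] := tJ.
have Jz k : J (val (z k)) by rewrite aE in Ja; exact: (coords_mem tJ (IJ _ Inu) Ja).
have mz k : m (z k).
  apply: contrapT => /(max_comm_inv mm)[b mb]; apply: J1.
  have -> : 1 = val b * val (z k) - val (b * z k - 1).
    by rewrite /= opprB addrC subrK.
  apply: (@submoduleB _ L^o); [exact/two_sided_submodule| |exact/IJ/extend_mem].
  exact: (JM _ _ _).1.
rewrite aE; apply: (@submodule_sum _ L^o) => [|k]; first exact: two_sided_submodule.
by apply: (IM _ _ _).2; apply: extend_mem.
Qed.

Lemma quot_mod_basis :
  mod_basis m (fun k : 'I_p * 'I_p => @cls L L^o I (xy_monomial f k) : restr val (lquot L I)).
Proof.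
have tI := extend_two_sided m.
have sumE (z : 'I_p * 'I_p -> Z) :
    \sum_k z k *: (@cls L L^o I (xy_monomial f k) : restr val (lquot L I)) =
    @cls L L^o I (\sum_k val (z k) * xy_monomial f k).
  by rewrite [RHS]raddf_sum; apply: eq_bigr => k _;
    exact: (esym (@clsZ L L^o I (val (z k)) (xy_monomial f k))).
split=> [q|z].
  have [a <-] := cls_surj (q : lquot L I); have [z ->] := xy_spans hp f0 a.
  by exists z; rewrite sumE.
rewrite sumE; split=> [/cls_eq0|mz]; last first.
  apply/cls_eq0/lspan_sub; apply: (@submodule_sum _ L^o) => [|k]; first exact: two_sided_submodule.
  by case: tI => _ _ IM; apply: (IM _ _ _).2; apply: extend_mem.
rewrite lspan_id; last exact: two_sided_submodule.
have [nu Inu] := extend_f_inv => Iz k; apply: extend_val.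
exact: (coords_mem tI Inu Iz).
Qed.

End OneIdeal.
End MaximalCentral.

(** * Dimension of a simple module over the residue field of the centre and over [K] *)

Lemma has_dimK_centre (K : fieldType) (A : algType K) (N : lmodType A) d :
  has_dimK (restr (val : {rmorphism centre A -> A}) N) d -> has_dimK N d.
Proof.
apply: (@has_dim_transport _ _ (restr (in_alg A) N) (fun v => v)); first by exists (fun v => v).
by move=> a u v.
Qed.

Lemma has_dimK_iso (K : fieldType) (A : algType K) (V W : lmodType A) d :
  iso V W -> has_dimK V d -> has_dimK W d.
Proof.
move=> [g gb]; apply: (@has_dim_transport K (restr (in_alg A) V) (restr (in_alg A) W) g _ gb).
by move=> a u v; rewrite raddfD; congr (_ + _); exact: (linearZ_LR g (in_alg A a) u).
Qed.

Lemma has_dimK_power (K : fieldType) (A : algType K) (N : lmodType A) n d :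
  has_dimK N d -> has_dimK {ffun 'I_n -> N} (n * d)%N.
Proof.
move/(power_has_dim n).
apply: (@has_dim_transport _ _ (restr (in_alg A) {ffun 'I_n -> N}) (fun v => v)).
  by exists (fun v => v).
by move=> a u v; apply/ffunP => i; rewrite !ffunE.
Qed.

Section SimpleOverMaximal.
Variables (K : fieldType) (p : nat) (hp : p \in [pchar K]) (f : {poly K}) (f0 : f != 0).
Local Notation L := (ore f).
Local Notation x := (oreC f 'X).
Local Notation y := (oreY f).
Local Notation Z := (centre L).
Variables (m : set Z) (mm : Max m) (mf : ~ Vset (oreC f f ^+ p) m).
Local Notation I := (extend m).

Let finN := ore_simple_separates hp f0.

Lemma simple_mod_basis (N : lmodType L) : simple N -> ann N = I ->
  exists r (e : 'I_r -> restr val N), mod_basis m e.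
Proof.
move=> sN aN; have [n [e se]] := ore_simple_finite hp f0 sN.
have [||v|r [e' be]] := @exists_mod_basis Z (restr val N) m n e.
- move=> a ma v; have : ann N (val a) by rewrite aN; apply: extend_mem.
  exact.
- by move=> a; apply: max_comm_inv.
- have [c ->] := se v; exists (fun i => (c i)%:A); apply: eq_bigr => i _.
  by [].
- by exists r, e'.
Qed.

(** A simple module [N] killed by [Lambda m] is free over [Z / m] and finitely spanned over [K]. The
    coordinates along one basis vector [e_0] of a finite [K]-spanning family of [N] span [Z / m]
    over [K], as one sees by expanding [z e_0]. *)
Lemma residue_has_dim : exists2 d, (0 < d)%N & has_dimK (lquot Z m) d.
Proof.
have [N sN aN] := max_exists_simple (extend_max hp f0 mm mf).
have [r [e [se fe]]] := simple_mod_basis sN aN.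
have [n [u su]] := ore_simple_finite hp f0 sN.
have [m0 [m1 _]] := mm; have sm := two_sided_submodule m0.
case: r => [|r] in e se fe *.
  have [[v /eqP v0] _] := sN; case: v0; have [c ->] := se v.
  by rewrite big_ord0.
have [t tE] := choice (fun k => se (u k)).
have [|d hd] := @spans_has_dim K (restr (in_alg Z) (lquot Z m)) n
    (fun k => @cls Z Z^o m (t k ord0)).
  move=> q; have [z <-] := @cls_surj Z Z^o m q.
  have [c cE] := su (z *: e ord0); exists c.
  transitivity (@cls Z Z^o m (\sum_k c k *: t k ord0)); last first.
    rewrite [LHS]raddf_sum; apply: eq_bigr => k _.
    rewrite -(mulr_algl (c k) (t k ord0)); exact: (@clsZ Z Z^o).
  apply/clsE; rewrite lspan_id //.
  have : \sum_i ((if i == ord0 then z else 0) - \sum_k c k *: t k i) *: e i = 0.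
    under eq_bigr do rewrite scalerBl.
    rewrite sumrB (bigD1 ord0) //= big1 ?addr0 => [|i /negPf ->]; last exact: scale0r.
    apply/eqP; rewrite subr_eq0 cE; apply/eqP.
    under [RHS]eq_bigr do rewrite scaler_suml.
    rewrite exchange_big /=; apply: eq_bigr => k _.
    transitivity (((c k)%:A : Z) *: (u k : restr (val : {rmorphism Z -> L}) N)) => //.
    rewrite (tE k) scaler_sumr.
    by apply: eq_bigr => i _; rewrite scalerA mulr_algl.
  by move/fe/(_ ord0); rewrite eqxx.
exists d => //; case: d hd => // -[b /is_basisP[sb _]].
case: m1; have [c] := sb (@cls Z Z^o m 1).
by rewrite big_ord0 => /cls_eq0; rewrite lspan_id.
Qed.

Lemma simple_has_dimK (N : lmodType L) r (e : 'I_r -> restr val N) d :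
  mod_basis m e -> has_dimK (lquot Z m) d -> has_dimK N (r * d).
Proof.
move=> be hd; apply: has_dimK_centre.
have := tower_has_dimK (two_sided_submodule mm.1) be hd.
by rewrite card_ord.
Qed.

(** The dimension over [K] of [Lambda / Lambda m] is computed twice, as [n r d] from the power of
    [N] and as [p^2 d] from the monomial basis; [d] is positive and cancels. *)
Lemma dense_rank (N : lmodType L) r (e : 'I_r -> restr val N) n (v : 'I_n -> N) :
  ann N = I -> mod_basis m e -> separates v -> dense_in v -> (n * r = p ^ 2)%N.
Proof.
move=> aN be sv dv; have [d d0 hd] := residue_has_dim.
have h1 := has_dimK_power n (simple_has_dimK be hd).
have := quot_ann_iso sv dv; rewrite aN => /iso_sym/has_dimK_iso/(_ h1) h2.
have h3 := tower_has_dimK (two_sided_submodule mm.1) (quot_mod_basis hp f0 mm mf) hd.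
have := has_dim_unique h2 (has_dimK_centre h3).
rewrite card_prod card_ord mulnA => /eqP; rewrite eqn_pmul2r //.
by move/eqP => ->; rewrite mulnn.
Qed.

Lemma rank_neq1 (N : lmodType L) (e : 'I_1 -> restr val N) : simple N ->
  ann N = I -> ~ mod_basis m e.
Proof.
move=> sN aN be; have [[v0 /eqP v0N] _] := sN.
have gen (w : N) : exists z : Z, w = val z *: (e ord0 : N).
  by have [c cE] := be.1 w; exists (c ord0); rewrite [LHS]cE big_ord1.
have [zx xE] := gen (x *: (e ord0 : N)); have [zy yE] := gen (y *: (e ord0 : N)).
have fe : oreC f f *: (e ord0 : N) = 0.
  have -> : oreC f f = y * x - x * y by rewrite oreY_oreC deltaX addrAC subrr add0r.
  rewrite scalerBl -!scalerA xE yE [y *: _]scalerA [x *: _]scalerA !centreC.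
  by rewrite -!scalerA xE yE !scalerA centreC subrr.
have [nu Inu] := extend_f_inv hp mm mf.
have e0 : (e ord0 : N) = 0.
  have : ann N (nu * oreC f f - 1) by rewrite aN.
  move=> /(_ (e ord0)); rewrite scalerBl -scalerA fe scaler0 scale1r => /eqP.
  by rewrite sub0r oppr_eq0 => /eqP.
by apply: v0N; have [z ->] := gen v0; rewrite e0 scaler0.
Qed.

Lemma simple_dimK_p (N : lmodType L) d : simple N -> ann N = I ->
  has_dimK (lquot Z m) d -> ~ division_quotient I -> has_dimK N (p * d).
Proof.
move=> sN aN hd nd; have [r [e be]] := simple_mod_basis sN aN.
have [n [v [sv dv]]] := dense_family sN (finN sN).
have := dense_rank aN be sv dv => nr.
suff <- : r = p by apply: (simple_has_dimK be hd).
have rp : (r %| p ^ 2)%N by rewrite -nr dvdn_mull.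
have [k k2 rE] : exists2 k, (k <= 2)%N & r = (p ^ k)%N by apply/dvdn_pfactor => //; apply: pcharf_prime hp.
case: k => [|[|[|//]]] in k2 rE.
- rewrite expn0 in rE; rewrite rE in e be; by case: (rank_neq1 sN aN be).
- by rewrite rE expn1.
(* The family has [n.+1] vectors, so [r = p ^ 2] leaves exactly one. An element outside [ann N] then
   moves this vector to a generator and has a left inverse modulo [ann N]. *)
- have n0 : n = 0%N.
    move: nr; rewrite rE -{2}[(p ^ 2)%N]mul1n => /eqP.
    by rewrite eqn_pmul2r ?expn_gt0 ?(pchar_gt0 hp) // => /eqP[].
  case: nd; rewrite n0 in v sv dv; rewrite -aN.
  have left_inv a : ~ ann N a -> exists b, ann N (b * a - 1).
    move=> aN'; have av : a *: v ord0 != 0.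
      by apply/eqP => av; apply: aN'; apply: sv => i; rewrite ord1.
    have [b bE] := simple_gen sN av (v ord0); exists b; apply: sv => i.
    by rewrite ord1 scalerBl -scalerA -bE scale1r subrr.
  have [_ AD AM] := ann_two_sided N.
  have sA := two_sided_submodule (ann_two_sided N).
  move=> a aa; have [b ba] := left_inv a aa; exists b; split=> //.
  have bN : ~ ann N b.
    move=> bb; have [v1 /eqP v1N] := sN.1; apply: v1N.
    have := ba v1; rewrite scalerBl scale1r ((AM _ _ bb).2 : ann N (b * a)) sub0r.
    by move/eqP; rewrite oppr_eq0 => /eqP.
  have [c cb] := left_inv b bN.
  (* The left inverse [c] of the left inverse [b] is congruent to [a], which makes [b] two-sided. *)
  have acE : c * (b * a - 1) - (c * b - 1) * a = a - c.
    by rewrite mulrBr mulrBl mulr1 mul1r !mulrA opprB addrC addrA subrK.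
  have -> : a * b - 1 = (c * (b * a - 1) - (c * b - 1) * a) * b + (c * b - 1).
    by rewrite acE mulrBl addrA subrK.
  apply: (AD) => //; apply: (AM _ _ _).2; apply: (@submoduleB _ L^o _ _ _ sA).
    exact: (AM _ _ _).1.
  exact: (AM _ _ _).2.
Qed.

End SimpleOverMaximal.

(** * Residue fields of the centre over perfect and over algebraically closed fields *)

Lemma closed_field_root (K : fieldType) (q : {poly K}) : GRing.closed_field_axiom K ->
  (1 < size q)%N -> exists a, root q a.
Proof.
move=> cK sq; pose n := (size q).-1.
have sqE : size q = n.+1 by rewrite prednK // ltnW.
have l0 : q`_n != 0 by rewrite -/(lead_coef q) lead_coef_eq0 -size_poly_gt0 ltnW.
have [|a aE] := cK n (fun i => - (q`_i / q`_n)); first by rewrite -ltnS -sqE.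
exists a; rewrite /root horner_coef sqE big_ord_recr /= aE mulr_sumr -big_split /=.
by rewrite big1 // => i _; rewrite mulNr mulrN mulrA mulrCA divff // mulr1 subrr.
Qed.

Section Residue.
Variables (K : fieldType) (A : algType K) (m : set (centre A)) (mm : Max m).
Variables (d : nat) (hd : has_dimK (lquot (centre A) m) d).
Local Notation Z := (centre A).

(** A finite extension of a perfect field is perfect. The [p]-th powers of a basis are again free:
    with [c_j = l_j^p], a relation [\sum_j c_j beta_j^p] is the [p]-th power of [\sum_j l_j beta_j],
    and [m] is prime. By dimension they form a basis, so each class is a combination of them, that
    is, a [p]-th power. *)
Lemma perfect_residue_root (p : nat) : p \in [pchar K] ->
  (forall a : K, exists b, b ^+ p = a) -> forall z : Z, exists w, m (z - w ^+ p).
Proof.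
move=> hp perf z; have chZ : p \in [pchar Z] by rewrite pchar_lalg.
have [_ _ mprime] := max_comm_prime mm; have [tm [m1 _]] := mm.
have sm := two_sided_submodule tm; have [m0 _ _] := tm.
have [b bb] := hd; have /is_basisP[sb fb] := bb.
have [beta betaE] := choice (fun j => @cls_surj Z Z^o m (b j)).
have clsE' (c : 'I_d -> K) (e : 'I_d -> Z) :
    \sum_j c j *: (@cls Z Z^o m (e j) : restr (in_alg Z) (lquot Z m)) =
    (@cls Z Z^o m (\sum_j c j *: e j) : restr (in_alg Z) (lquot Z m)).
  rewrite [RHS]raddf_sum; apply: eq_bigr => j _; rewrite -(mulr_algl (c j) (e j)).
  exact: (esym (@clsZ Z Z^o m _ _)).
have frob (l : 'I_d -> K) : (\sum_j l j *: (beta j : Z)) ^+ p = \sum_j l j ^+ p *: (beta j : Z) ^+ p.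
  rewrite -(pFrobenius_autE chZ) rmorph_sum /=; apply: eq_bigr => j _.
  by rewrite pFrobenius_autE exprZn.
have mX (w : Z) n : m (w ^+ n) -> m w.
  by elim: n => [|n IH]; [move/m1|rewrite exprS => /mprime[]].
pose u (j : 'I_d) : restr (in_alg Z) (lquot Z m) := @cls Z Z^o m ((beta j : Z) ^+ p).
have /is_basisP[su _] : is_basis u.
  apply: free_basis => // c; rewrite clsE' => /cls_eq0; rewrite lspan_id // => mc.
  have [l lE] := choice (fun j => perf (c j)).
  have : m (\sum_j l j *: (beta j : Z)).
    apply: (mX _ p); rewrite frob; under eq_bigr do rewrite lE; exact: mc.
  move=> ml j; suff -> : c j = 0 by [].
  rewrite -lE; have -> : l j = 0; last by rewrite expr0n gtn_eqF // (prime_gt0 (pcharf_prime hp)).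
  move: j; apply: (fb l).1.
  under eq_bigr do rewrite -betaE; rewrite clsE'; apply/cls_eq0.
  by rewrite lspan_id.
have [c cE] := su (@cls Z Z^o m z); have [l lE] := choice (fun j => perf (c j)).
exists (\sum_j l j *: (beta j : Z)); rewrite frob; under eq_bigr do rewrite lE.
by rewrite -[m](lspan_id sm); apply/clsE; rewrite -clsE'.
Qed.

(** The [d.+1] first powers of [z] are dependent modulo [m]. The resulting polynomial splits into
    linear factors over [K], and one of them lies in the prime ideal [m]. *)
Lemma closed_residue (z : Z) : GRing.closed_field_axiom K -> exists k : K, m (z - k%:A).
Proof.
move=> cK; have [_ _ mprime] := max_comm_prime mm; have [tm [m1 _]] := mm.
have sm := two_sided_submodule tm; have [m0 mD mM] := tm.
have [q q0 mq] : exists2 q : {poly K}, q != 0 & m (horner_alg z q).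
  apply: contrapT => nq; have [b /is_basisP[sb _]] := hd.
  have [c c0 j|M [/eqP Mf _]] := free_spans_rank sb
    (u := fun j : 'I_d.+1 => @cls Z Z^o m (z ^+ j) : restr (in_alg Z) (lquot Z m)).
    have [//|cj] := eqVneq (c j) 0; case: nq; exists (\poly_(i < d.+1) c (inord i)).
      apply/eqP => /(congr1 (fun q : {poly K} => q`_j)).
      by rewrite coef_poly ltn_ord inord_val coef0; apply/eqP.
    have -> : horner_alg z (\poly_(i < d.+1) c (inord i)) = \sum_(i < d.+1) c i *: z ^+ i.
      rewrite (@eval1E K Z z d.+1) ?size_poly //; apply: eq_bigr => i _.
      by rewrite coef_poly ltn_ord inord_val.
    rewrite -[m](lspan_id sm); apply/(@cls_eq0 Z Z^o); rewrite -[RHS]c0 raddf_sum.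
    apply: eq_bigr => i _; rewrite -(mulr_algl (c i) (z ^+ i)); exact: (@clsZ Z Z^o).
  by have := rank_leq_col M; rewrite Mf ltnn.
have [n sq] : exists n, (size q <= n)%N by exists (size q).
elim: n q q0 mq sq => [|n IH] q q0 mq sq.
  by move: q0; rewrite -size_poly_leq0 sq.
have [s1|] := leqP (size q) 1.
  case: m1; move: mq; rewrite (size1_polyC s1) /horner_alg horner_morphC /= => mq.
  have c0 : q`_0 != 0.
    by apply: contra q0 => /eqP c0; rewrite (size1_polyC s1) c0 polyC0.
  by rewrite -[1](scale1r) -(mulVf c0) -scalerA -mulr_algl; apply: (mM _ _ mq).1.
move=> /(closed_field_root cK)[a /factor_theorem[q' qE]].
have q'0 : q' != 0 by apply: contra q0 => /eqP q'0; rewrite qE q'0 mul0r.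
have : m (horner_alg z q' * (z - a%:A)).
  by move: mq; rewrite qE rmorphM rmorphB /= /horner_alg horner_morphX horner_morphC.
case/mprime => [mq'|]; last by exists a.
apply: (IH q') => //; rewrite -ltnS; apply: leq_trans sq.
by rewrite qE size_mul ?polyXsubC_eq0 // size_XsubC addn2 /=.
Qed.

End Residue.

Section PerfectCase.
Variables (K : fieldType) (p : nat) (hp : p \in [pchar K]) (f : {poly K}) (f0 : f != 0).
Local Notation L := (ore f).
Local Notation x := (oreC f 'X).
Local Notation y := (oreY f).
Variables (m : set (centre L)) (mm : Max m) (mf : ~ Vset (oreC f f ^+ p) m).
Local Notation I := (extend m).

(* If x^p is congruent to w^p then x - w is a nonzero nilpotent of the quotient. *)
Lemma perfect_not_division : (forall a : K, exists b, b ^+ p = a) -> ~ division_quotient I.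
Proof.
move=> perf div; have [d d0 hd] := residue_has_dim hp f0 mm mf.
have [w mw] := perfect_residue_root mm hd hp perf (centre_x hp f).
have tI := extend_two_sided m; have [_ ID IM] := tI; have sI := two_sided_submodule tI.
pose a := x - val w.
have chL : p \in [pchar L] by rewrite pchar_lalg.
have Iap : I (a ^+ p).
  have -> : a ^+ p = val (centre_x hp f - w ^+ p).
    rewrite /a -!(pFrobenius_autE chL) pFrobenius_autB_comm; last exact: centreC.
    rewrite !pFrobenius_autE raddfB; congr (_ - _); first by rewrite /= -rmorphXn.
    exact: (esym (rmorphXn val p w)).
  exact: extend_mem.
(* The commutator of [y] with [a] is [f], invertible modulo [I]. *)
have Ia : ~ I a.
  move=> Ia; apply: (extend_proper hp f0 mm); have [nu Inu] := extend_f_inv hp mm mf.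
  have If : I (oreC f f).
    have -> : oreC f f = y * a - a * y.
      by rewrite /a mulrBr mulrBl centreC opprB addrA subrK oreY_oreC deltaX addrAC subrr add0r.
    by apply: (@submoduleB _ L^o _ _ _ sI); [apply: (IM _ _ Ia).1|apply: (IM _ _ Ia).2].
  have -> : 1 = nu * oreC f f - (nu * oreC f f - 1) by rewrite opprB addrC subrK.
  by apply: (@submoduleB _ L^o _ _ _ sI) => //; apply: (IM _ _ If).1.
have [b [ba _]] := div a Ia.
(* The factors [b a] cancel from the inside outwards, so a nilpotent [a] would force 1 into [I]. *)
have bak k : I (b ^+ k * a ^+ k - 1).
  elim: k => [|k IH]; first by rewrite mulr1 subrr; case: tI.
  have -> : b ^+ k.+1 * a ^+ k.+1 - 1 = b * (b ^+ k * a ^+ k - 1) * a + (b * a - 1).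
    by rewrite [b * (_ - _)]mulrBr [(_ - _) * a]mulrBl mulr1 addrA subrK exprS exprSr !mulrA.
  by apply: (ID) => //; apply: (IM _ _ _).2; apply: (IM _ _ _).1.
apply: (extend_proper hp f0 mm).
have -> : 1 = b ^+ p * a ^+ p - (b ^+ p * a ^+ p - 1) by rewrite opprB addrC subrK.
by apply: (@submoduleB _ L^o _ _ _ sI) => //; apply: (IM _ _ Iap).1.
Qed.

End PerfectCase.

(** * The module induced from a root of the central character *)

Section Induced.
Variables (K : fieldType) (p : nat) (hp : p \in [pchar K]) (f : {poly K}) (f0 : f != 0).
Local Notation L := (ore f).
Local Notation x := (oreC f 'X).
Local Notation y := (oreY f).
Local Notation Z := (centre L).
Variables (m : set Z) (mm : Max m) (mf : ~ Vset (oreC f f ^+ p) m).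
Local Notation I := (extend m).
Hypothesis resK : forall z : Z, exists k : K, m (z - k%:A).
Variable r : K.
Hypothesis mr : m (centre_x hp f - (r ^+ p)%:A).

Definition induced_gens : set L := (val @` m) `|` [set oreC f ('X - r%:P)].
Local Notation X := induced_gens.
Local Notation chi := (oreC f ('X - r%:P)).
Local Notation J := (lspan (X : set L^o)).
Local Notation V := (lquot L X).

Lemma induced_chiE : chi = x - r%:A.
Proof. by rewrite raddfB /= oreC_polyC. Qed.

Lemma induced_submodule : submodule (J : set L^o). Proof. exact: lspan_submodule. Qed.

Lemma extend_sub_induced : I `<=` J.
Proof.
by apply: (@lspan_min _ L^o) => [|z mz]; [exact: induced_submodule|apply: lspan_sub; left].
Qed.

Lemma chi_induced : J chi. Proof. by apply: lspan_sub; right. Qed.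

Lemma induced_decomp a : J a -> exists b, I (a - b * chi).
Proof.
have tI := extend_two_sided m; have sI := two_sided_submodule tI; have [I0 ID IM] := tI.
apply: (@lspan_min _ L^o _ [set a | exists b, I (a - b * chi)]).
  split=> [|c u v [b hb] [b' hb']]; first by exists 0; rewrite mul0r subrr.
  exists (c * b + b'); rewrite mulrDl opprD addrACA; apply: (ID) => //.
  by rewrite -[c *: u]/(c * u) -mulrA -mulrBr; apply: (IM _ _ hb).1.
move=> _ [[z mz <-]|->]; last by exists 1; rewrite mul1r subrr.
by exists 0; rewrite mul0r subr0; apply: extend_mem.
Qed.

(** [J] is [Lambda m + Lambda chi] with [Lambda m] two-sided. This right stability makes [J] stable
    under commutation with [x], which replaces two-sidedness in the lowering argument. *)
Lemma induced_mul_chi a : J a -> J (a * chi).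
Proof.
move=> /induced_decomp[b hb]; have [_ _ IM] := extend_two_sided m.
have -> : a * chi = (a - b * chi) * chi + b * chi * chi by rewrite mulrBl subrK.
apply: (@submoduleD _ L^o _ _ _ induced_submodule); first exact/extend_sub_induced/(IM _ _ hb).2.
by apply: (@submoduleZ _ L^o _ _ _ induced_submodule); apply: chi_induced.
Qed.

(** If [1 = b chi] modulo [Lambda m], then [1 = b^k chi^k] for all [k]; but [chi^p = x^p - r^p] lies
    in [m]. *)
Lemma induced_proper : ~ J 1.
Proof.
have tI := extend_two_sided m; have sI := two_sided_submodule tI; have [I0 ID IM] := tI.
move=> /induced_decomp[b hb]; apply: (extend_proper hp f0 mm).
have hk k : I (1 - b ^+ k * chi ^+ k).
  elim: k => [|k IH]; first by rewrite mulr1 subrr.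
  have -> : 1 - b ^+ k.+1 * chi ^+ k.+1 =
      (1 - b ^+ k * chi ^+ k) + b ^+ k * (1 - b * chi) * chi ^+ k.
    by rewrite mulrBr mulrBl mulr1 addrA subrK exprSr exprS !mulrA.
  by apply: (ID) => //; apply: (IM _ _ _).2; apply: (IM _ _ _).1.
have chL : p \in [pchar L] by rewrite pchar_lalg.
have Ichi : I (chi ^+ p).
  have -> : chi ^+ p = val (centre_x hp f - (r ^+ p)%:A).
    rewrite induced_chiE -!(pFrobenius_autE chL) pFrobenius_autB_comm; last first.
      by rewrite /GRing.comm mulr_algl mulr_algr.
    by rewrite !pFrobenius_autE exprZn expr1n /= rmorphXn.
  exact: extend_mem.
rewrite -[1](subrK (b ^+ p * chi ^+ p)); apply: (ID) => //.
exact: (IM _ _ Ichi).1.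
Qed.

Lemma cls_y_combination (v : V) : exists k : 'I_p -> K,
  v = @cls L L^o X (\sum_j k j *: y ^+ j).
Proof.
have [a <-] := cls_surj v; have [z ->] := xy_spans hp f0 a.
have [zeta zetaE] := choice (fun k => resK (z k)).
exists (fun j => \sum_i zeta (j, i) * r ^+ i); apply/clsE.
have -> : \sum_j (\sum_i zeta (j, i) * r ^+ i) *: y ^+ j =
    \sum_k (zeta k * r ^+ k.2) *: y ^+ k.1.
  under eq_bigr do rewrite scaler_suml.
  by rewrite pair_bigA; apply: eq_bigr => -[j i] _.
rewrite -sumrB; apply: (@submodule_sum _ L^o _ _ _ _ induced_submodule) => -[j i] /=.
have xr : J (x ^+ i - (r ^+ i)%:A).
  elim: (i : nat) => [|n IH]; first by rewrite !expr0 scale1r subrr; case: induced_submodule.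
  have -> : x ^+ n.+1 - (r ^+ n.+1)%:A = x ^+ n * chi + r%:A * (x ^+ n - (r ^+ n)%:A).
    rewrite induced_chiE mulrBr -exprSr mulr_algr mulr_algl scalerBr addrA subrK.
    by rewrite scalerA -exprS.
  apply: (@submoduleD _ L^o _ _ _ induced_submodule);
    apply: (@submoduleZ _ L^o _ _ _ induced_submodule) => //; exact: chi_induced.
(* First [x] is replaced by [r] modulo [chi], then the central coefficient by its scalar [zeta]
   modulo [m]. *)
have -> : val (z (j, i)) * xy_monomial f (j, i) - (zeta (j, i) * r ^+ i) *: y ^+ j =
    y ^+ j * (val (z (j, i)) * (x ^+ i - (r ^+ i)%:A)
      + (r ^+ i)%:A * val (z (j, i) - (zeta (j, i))%:A)).
  rewrite /xy_monomial /= mulr_algl scalerBr mulrBr mulr_algr addrA subrK.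
  rewrite mulrBr !mulrA centreC; congr (_ - _).
  by rewrite scalerA -scalerAr mulr1 mulrC.
apply: (@submoduleZ _ L^o _ _ _ induced_submodule); apply: (@submoduleD _ L^o _ _ _ induced_submodule).
  exact: (@submoduleZ _ L^o _ _ _ induced_submodule).
by apply: (@submoduleZ _ L^o _ _ _ induced_submodule); apply/extend_sub_induced/extend_mem.
Qed.

(* Commuting with x lowers the degree in y, so a left ideal above J containing a
   combination of low powers of y contains the leading coefficient. *)
Lemma y_combination_proper (H : set L) n (k : nat -> K) : submodule (H : set L^o) ->
  J `<=` H -> (forall a, H a -> H (a * chi)) -> ~ H 1 -> (n <= p)%N ->
  H (\sum_(j < n) k j *: y ^+ j) -> forall j, (j < n)%N -> k j = 0.
Proof.
move=> sH JH Hchi H1; have [nu Inu] := extend_f_inv hp mm mf.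
have [_ _ IM] := extend_two_sided m.
have Hx a : H a -> H (x * a - a * x).
  move=> Ha; have -> : x * a - a * x = chi * a - a * chi.
    by rewrite induced_chiE mulrBl mulrBr mulr_algl mulr_algr opprB addrA subrK.
  by apply: (@submoduleB _ L^o) => //; [apply: (@submoduleZ _ L^o)|apply: Hchi].
have Hf c : c * x = x * c -> H (oreC f f * c) -> H c.
  move=> _ Hc; have -> : c = nu * (oreC f f * c) - (nu * oreC f f - 1) * c.
    by rewrite mulrBl mul1r mulrA opprB addrC subrK.
  apply: (@submoduleB _ L^o) => //; first exact: (@submoduleZ _ L^o).
  by apply/JH/extend_sub_induced; apply: (IM _ _ Inu).2.
elim: n => // n IH np; rewrite big_ord_recr /= => Hs.
have kn : k n = 0.
  have [//|kn] := eqVneq (k n) 0; case: H1.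
  have Hk : H (k n)%:A.
    apply: (leading_mem hp sH Hx Hf np _ Hs); split; first by rewrite mulr_algl mulr_algr.
    rewrite mulr_algr addrK; exists (fun l => (k l)%:A); split=> [l|].
      by rewrite mulr_algl mulr_algr.
    by apply: eq_bigr => l _; rewrite mulr_algr.
  have -> : 1 = (k n)^-1%:A * (k n)%:A :> L by rewrite mulr_algl scalerA mulVf // scale1r.
  exact: (@submoduleZ _ L^o).
move: Hs; rewrite kn scale0r addr0 => Hs j; rewrite ltnS leq_eqVlt => /predU1P[->//|].
by apply: IH => //; apply: ltnW.
Qed.

Lemma induced_sum_cls (c : 'I_p -> K) :
  \sum_j c j *: (y ^+ j *: cls _ 1 : restr (in_alg L) V) = @cls L L^o X (\sum_j c j *: y ^+ j).
Proof.
rewrite [RHS]raddf_sum; apply: eq_bigr => j _.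
rewrite -(mulr_algl (c j) (y ^+ j)) -[in RHS](mulr1 (y ^+ j)).
by rewrite [RHS](@clsZ L L^o) (@clsZ L L^o X (y ^+ j) 1).
Qed.

Lemma ord_extend (c : 'I_p -> K) : exists k : nat -> K, forall j : 'I_p, k j = c j.
Proof. by exists (fun j => if insub j is Some j' then c j' else 0) => j; rewrite valK. Qed.

Lemma induced_basis :
  is_basis (fun i : 'I_p => y ^+ i *: cls _ 1 : restr (in_alg L) V).
Proof.
apply/is_basisP; split=> [v|c].
  by have [c ->] := cls_y_combination v; exists c; rewrite induced_sum_cls.
split=> [|c0]; last by rewrite big1 // => j _; rewrite c0 scale0r.
rewrite induced_sum_cls => /cls_eq0 Jc j; have [k kE] := ord_extend c.
rewrite -kE; apply: (@y_combination_proper J p k) => //.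
- exact: induced_submodule.
- exact: induced_mul_chi.
- exact: induced_proper.
- by under eq_bigr do rewrite kE.
Qed.

(** The preimage [H] of a submodule missing the class of 1 is a proper left ideal above [J], and
    [H chi] already lies in [J]. Hence [H] contains no nontrivial combination of the powers of [y]
    below [p], although these represent all classes. *)
Lemma induced_simple : simple V.
Proof.
split; first by exists (cls _ 1); apply/eqP => /cls_eq0; apply: induced_proper.
move=> S sS; have [S1|S1] := pselect (S (cls _ 1)).
  right; apply/seteqP; split=> // v _; have [a <-] := cls_surj v.
  have -> : @cls L L^o X a = a *: cls _ 1.
    by rewrite -[in LHS](mulr1 a); exact: (@clsZ L L^o).
  exact: submoduleZ.
left; apply/seteqP; split=> [v Sv|_ ->]; last by case: sS.
pose H : set L := [set a | S (@cls L L^o X a)].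
have sH : submodule (H : set L^o).
  split=> [|a u w Hu Hw]; rewrite /H /=; first by rewrite raddf0; case: sS.
  have -> : @cls L L^o X (a *: u + w) = a *: @cls L L^o X u + @cls L L^o X w by rewrite linearP.
  by case: sS => _; apply.
have JH : J `<=` H by move=> a /cls_eq0 Ja; rewrite /H /= Ja; case: sS.
have [c vE] := cls_y_combination v; have [k kE] := ord_extend c.
suff kz j : (j < p)%N -> k j = 0.
  by rewrite vE big1 ?raddf0 // => j _; rewrite -kE kz // scale0r.
move: j; apply: (@y_combination_proper H p k) => //; last first.
  by under eq_bigr do rewrite kE; rewrite /H /= -vE.
move=> a _; apply: JH; exact: (@submoduleZ _ L^o _ a _ induced_submodule chi_induced).
Qed.

Lemma induced_ann : ann V = I.
Proof.
apply: ann_simple_max; [exact: (extend_max hp f0 mm mf)|exact: induced_simple|].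
move=> a Ia v; have [b <-] := cls_surj v; rewrite -(@clsZ L L^o); apply/cls_eq0/extend_sub_induced.
by have [_ _ IM] := extend_two_sided m; apply: (IM b a Ia).2.
Qed.

End Induced.

(** * Localization *)

Section WeylEmbedding.
Variables (K : fieldType) (f : {poly K}) (f0 : f != 0).
Local Notation W := (Weyl K).

Lemma to_weyl_oreC g : to_weyl (oreC f g) = oreC 1 g.
Proof. by rewrite /to_weyl /= map_polyC hornerC. Qed.

Lemma to_weyl_oreY : to_weyl (oreY f) = fd f.
Proof. by rewrite /to_weyl /= map_polyX hornerX. Qed.

(** The [i]-th power of [f d] is [f^i d^i] plus terms of lower order in [d]. This triangular shape
    gives injectivity of the embedding. *)
Lemma fd_exp_coef i :
  (size (ore_poly (fd f ^+ i)) <= i.+1)%N /\ (ore_poly (fd f ^+ i))`_i = f ^+ i.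
Proof.
elim: i => [|i [IHs IHc]]; first by rewrite !expr0 size_poly1 coef1.
rewrite exprS {1 3}/fd -mulrA /= pmulC1 pmulX /ymul.
split; last first.
  rewrite coefZ coefD coefMX /= IHc coef_map nth_default // (raddf0 (delta 1)).
  by rewrite addr0 -exprS.
apply: leq_trans (size_scale_leq _ _) _; apply: leq_trans (size_polyD _ _) _.
rewrite geq_max; apply/andP; split.
  by apply: leq_trans (size_polyMleq _ _) _; rewrite size_polyX addn2.
by apply: leq_trans (size_poly _ _) _; apply: leqW.
Qed.

Lemma to_weyl_inj : injective (@to_weyl K f).
Proof.
apply: raddf_inj => a a0; apply/eqP; rewrite -(inj_eq (@ore_inj K f)); apply/negPn/negP.
move=> an0; pose n := (size (ore_poly a)).-1.
have sa : size (ore_poly a) = n.+1 by rewrite prednK // size_poly_gt0.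
have : (ore_poly (to_weyl a))`_n = 0 by rewrite a0 coef0.
rewrite /to_weyl (@horner_coef_wide _ n.+1); last by rewrite -sa size_poly.
rewrite big_ord_recr /= raddf_sum coefD coef_sum big1 => [|i _]; last first.
  rewrite coef_map /= pmulC1 coefZ [X in _ * X]nth_default ?mulr0 //.
  by have [h _] := fd_exp_coef i; apply: leq_trans h (ltn_ord i).
rewrite add0r coef_map /= pmulC1 coefZ (fd_exp_coef n).2 => /eqP.
rewrite mulf_eq0 expf_eq0 (negPf f0) andbF orbF.
by rewrite -[n]/((size (ore_poly a)).-1) -/(lead_coef _) lead_coef_eq0 (negPf an0).
Qed.

Lemma weyl_expf_reg N (a : W) : (oreC 1 f ^+ N) * a = 0 -> a = 0.
Proof.
rewrite -rmorphXn => /(congr1 (@ore_poly _ _)) /=; rewrite pmulC1 -mul_polyC => /eqP.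
by rewrite mulf_eq0 polyC_eq0 expf_eq0 (negPf f0) andbF => /eqP; exact: (@ore_inj _ _ a 0).
Qed.

End WeylEmbedding.

Section Localization.
Variables (K : fieldType) (p : nat) (hp : p \in [pchar K]) (f : {poly K}) (f0 : f != 0).
Local Notation L := (ore f).
Local Notation W := (Weyl K).
Variables (B : nzRingType) (iota : {rmorphism W -> B}).
Hypothesis loc : is_localization (oreC 1 f ^+ p) iota.
Definition locmap : {rmorphism L -> B} := iota \o @to_weyl K f.
Local Notation g := locmap.
Local Notation F := (oreC f f ^+ p).
Local Notation c := (oreC 1 f ^+ p : W).

Lemma weyl_c_comm (w : W) : c * w = w * c.
Proof.
have := @oreC_central K 1 (f ^+ p) (delta_expp hp 1 f).
by rewrite rmorphXn => /centralbP/(_ w).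
Qed.

Lemma to_weyl_F N : to_weyl (F ^+ N) = c ^+ N.
Proof. by rewrite !rmorphXn /= to_weyl_oreC. Qed.

Lemma loc_F_comm N (b : B) : g (F ^+ N) * b = b * g (F ^+ N).
Proof.
have [[u [uc cu]] /(_ b)[n [a bE]] _] := loc.
have gF M : g (F ^+ M) = iota c ^+ M by rewrite /= to_weyl_F rmorphXn.
have uX : iota c ^+ n * u ^+ n = 1.
  elim: n {bE} => [|n IH]; first by rewrite mulr1.
  by rewrite exprSr exprS mulrA -[_ * _ * u]mulrA cu mulr1.
have cX (w : W) M : c ^+ M * w = w * c ^+ M.
  elim: M => [|M IH]; first by rewrite mulr1 mul1r.
  by rewrite exprSr -mulrA weyl_c_comm mulrA IH mulrA.
have -> : b = iota a * u ^+ n by rewrite -bE -mulrA uX mulr1.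
rewrite gF; have uF : u ^+ n * iota c ^+ N = iota c ^+ N * u ^+ n.
  elim: n {bE uX} => [|n IH]; first by rewrite mulr1 mul1r.
  rewrite exprS -mulrA IH !mulrA; congr (_ * _).
  elim: N {IH} => [|N IHN]; first by rewrite mulr1 mul1r.
  by rewrite exprS mulrA uc mul1r -mulrA -IHN mulrA cu mul1r.
rewrite -[RHS]mulrA uF !mulrA; congr (_ * _).
by rewrite -(rmorphXn iota) -!(rmorphM iota); congr (iota _); apply: cX.
Qed.

(** Since [f^p] is central, [d f^p = f^(p-1) (f d)] lies in the image of [Lambda]; so [d], and with
    it all of the Weyl algebra, consists of fractions over [Lambda]. *)
Lemma weyl_denominator (w : W) : exists N a, w * c ^+ N = to_weyl (a : L).
Proof.
pose S (w : W) := exists N a, w * c ^+ N = to_weyl (a : L).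
have S0 : S 0 by exists 0%N, 0; rewrite mul0r raddf0.
have SD u v : S u -> S v -> S (u + v).
  move=> [N [a aE]] [M [b bE]]; exists (N + M)%N, (a * F ^+ M + b * F ^+ N).
  rewrite raddfD /= !rmorphM /= !to_weyl_F -aE -bE mulrDl -!mulrA -!exprD.
  by rewrite [(M + N)%N]addnC.
have SC h u : S u -> S (oreC 1 h * u).
  move=> [N [a aE]]; exists N, (oreC f h * a).
  by rewrite -mulrA aE rmorphM /= to_weyl_oreC.
have SY u : S u -> S (oreY 1 * u).
  move=> [N [a aE]]; exists N.+1, (oreC f f ^+ p.-1 * oreY f * a).
  rewrite exprS -mulrA [u * _]mulrA -weyl_c_comm -mulrA aE mulrA -weyl_c_comm.
  rewrite !rmorphM rmorphXn /= to_weyl_oreC to_weyl_oreY /fd !mulrA; congr (_ * _ * _).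
  by rewrite -exprSr prednK // (pchar_gt0 hp).
rewrite -/(S w) [w]ore_expand; apply: (big_ind S) => // i _; apply: (SC).
elim: (i : nat) => [|k IH]; first by exists 0%N, 1; rewrite mulr1 rmorph1.
by rewrite exprS; apply: SY.
Qed.

Lemma loc_denominator (b : B) : exists N a, b * g (F ^+ N) = g a.
Proof.
have [_ /(_ b)[n [w wE]] _] := loc; have [N [a aE]] := weyl_denominator w.
exists (n + N)%N, a; rewrite /= to_weyl_F exprD rmorphM mulrA rmorphXn wE.
by rewrite -rmorphM aE.
Qed.

Lemma loc_inj (a : L) : g a = 0 -> a = 0.
Proof.
have [_ _ ker] := loc; move=> /= /ker[n]; rewrite -exprM => /(weyl_expf_reg f0).
by move=> h; apply: (to_weyl_inj f0); rewrite h raddf0.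
Qed.

Variables (m : set (centre L)) (mm : Max m) (mf : ~ Vset (oreC f f ^+ p) m).
Local Notation I := (extend m).
Hypothesis resK : forall z : centre L, exists k : K, m (z - k%:A).
Variable r : K.
Hypothesis mr : m (centre_x hp f - (r ^+ p)%:A).
Local Notation X := (induced_gens m r).
Local Notation J := (lspan (X : set L^o)).
Local Notation V := (lquot L X).
Local Notation gX := (g @` X).
Local Notation JB := (lspan (gX : set B^o)).
Local Notation Y := (restr g (lquot B gX)).

Lemma loc_submodule : submodule (JB : set B^o). Proof. exact: lspan_submodule. Qed.

Lemma loc_induced a : J a -> JB (g a).
Proof.
apply: (@lspan_min _ L^o _ [set a | JB (g a)]) => [|b Xb]; last by apply: lspan_sub; exists b.
split=> [|b u v Ju Jv]; rewrite /mkset; first by rewrite rmorph0; case: loc_submodule.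
have -> : g (b *: u + v) = g b * g u + g v by rewrite -[b *: u]/(b * u) rmorphD rmorphM.
by case: loc_submodule => _; apply.
Qed.

Lemma expf_inv N : exists u : L, I (u * F ^+ N - 1).
Proof.
have [u Iu] := extend_expf_inv hp mm mf; exists (val u ^+ N).
have [_ ID IM] := extend_two_sided m.
elim: N => [|N IH]; first by rewrite mulr1 subrr; case: (extend_two_sided m).
have -> : val u ^+ N.+1 * F ^+ N.+1 - 1 =
    (val u ^+ N * (val u * F - 1)) * F ^+ N + (val u ^+ N * F ^+ N - 1).
  rewrite [_ ^+ _ * (_ - _)]mulrBr [(_ - _) * F ^+ N]mulrBl mulr1 addrA subrK.
  by rewrite exprSr exprS !mulrA.
by apply: ID => //; apply: (IM _ _ _).2; apply: (IM _ _ _).1.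
Qed.

(** Clearing denominators in an expression of 1 would put a power of [f^p] into [J]; that power is
    invertible modulo [Lambda m], contradicting properness of [J]. *)
Lemma loc_proper : ~ JB 1.
Proof.
have sJ := lspan_submodule (X : set L^o).
pose S : set B^o := [set b : B | exists N a, J a /\ b * g (F ^+ N) = g a].
have SJ : JB `<=` S.
  apply: lspan_min => [|_ [a Xa <-]]; last first.
    by exists 0%N, a; split; [exact: lspan_sub|rewrite expr0 rmorph1 mulr1].
  split=> [|b u v [N [a [Ja aE]]] [M [a' [Ja' a'E]]]].
    by exists 0%N, 0; split; [case: sJ|rewrite mul0r rmorph0].
  have [P [q qE]] := loc_denominator b.
  exists (P + N + M)%N, (F ^+ M * (q * a) + F ^+ (P + N) * a'); split.
    apply: (@submoduleD _ L^o _ _ _ sJ); last exact: (@submoduleZ _ L^o _ _ _ sJ).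
    by apply: (@submoduleZ _ L^o _ _ _ sJ); apply: (@submoduleZ _ L^o _ _ _ sJ).
  rewrite rmorphD !rmorphM -qE -aE -a'E -[b *: u]/(b * u) mulrDl; congr (_ + _).
    rewrite [RHS]loc_F_comm !exprD !rmorphM !mulrA; congr (_ * _ * _).
    by rewrite -!mulrA loc_F_comm.
  by rewrite [RHS]loc_F_comm [(P + N + M)%N]addnC exprD rmorphM mulrA.
move=> /SJ[N [a [Ja]]]; rewrite mul1r => /eqP; rewrite -subr_eq0 -rmorphB => /eqP/loc_inj/eqP.
rewrite subr_eq0 => /eqP Fa; have [u Iu] := expf_inv N.
apply: (induced_proper f0 mm mr).
have -> : 1 = u * F ^+ N - (u * F ^+ N - 1) by rewrite opprB addrC subrK.
apply: (@submoduleB _ L^o _ _ _ sJ); last exact: extend_sub_induced.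
by rewrite Fa; apply: (@submoduleZ _ L^o _ _ _ sJ).
Qed.

(** Injectivity: [V] is simple, so a nonzero kernel would contain the class of 1. Surjectivity:
    powers of [f^p] are already invertible modulo [Lambda m], so each fraction is congruent to an
    element of [Lambda]. *)
Lemma loc_iso : iso V Y.
Proof.
pose h (a : L^o) : Y := @cls B B^o gX (g a).
have h_lin : linear h.
  move=> b u v; rewrite /h; have -> : g (b *: u + v) = g b *: (g u : B^o) + g v.
    by rewrite -[b *: u]/(b * u) rmorphD rmorphM.
  exact: (@linearP B B^o).
pose H : {linear L^o -> Y} := HB.pack h (GRing.isLinear.Build _ _ _ _ h h_lin).
have [a Xa|k kE] := @quot_lift L L^o Y X H.
  by apply/(@cls_eq0 B B^o)/lspan_sub; exists a.
exists k; apply: inj_surj_bij => [|w].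
  apply: raddf_inj => v kv; apply/eqP/negPn/negP => v0; apply: loc_proper.
  have [a aE] := simple_gen (induced_simple f0 mm mf resK mr) v0 (cls _ 1).
  have : k (cls _ 1) = 0 by rewrite aE linearZ /= kv scaler0.
  by rewrite kE => /(@cls_eq0 B B^o); rewrite rmorph1.
have [b <-] := @cls_surj B B^o gX w; have [N [a aE]] := loc_denominator b.
have [u Iu] := expf_inv N.
exists (@cls L L^o X (a * u)); rewrite kE; apply/(@clsE B B^o).
have -> : g (a * u) - b = b * g (u * F ^+ N - 1).
  rewrite rmorphB !rmorphM rmorph1 mulrBr mulr1; congr (_ - _).
  by rewrite -aE -mulrA loc_F_comm.
by apply: (@submoduleZ _ B^o _ _ _ loc_submodule); apply/loc_induced/extend_sub_induced.
Qed.

(** The dimension [p] is transported from [V], so freeness is enough. It follows from [[d, x - r] =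
    1], which makes commutation with [chi] the formal derivative in [d]. *)
Lemma loc_basis :
  is_basis (fun i : 'I_p => iota (oreY 1) ^+ i *: cls _ 1 : restr (in_alg L) Y).
Proof.
pose D := iota (oreY 1); pose kap (a : K) : B := iota a%:A.
pose chi := iota (oreC 1 ('X - r%:P)).
have hdim : has_dimK Y p.
  apply: has_dimK_iso loc_iso _; eexists; exact: (induced_basis f0 mm mf resK mr).
have gk a : g a%:A = kap a.
  by rewrite /= /kap -!oreC_polyC to_weyl_oreC.
have kapC a (b : W) : iota b * kap a = kap a * iota b.
  by rewrite /kap -!rmorphM mulr_algl mulr_algr.
have induced_chiE : chi = g (oreC f ('X - r%:P)) by rewrite /= to_weyl_oreC.
have JBchi b : JB b -> JB (b * chi).
  apply: (@lspan_min _ B^o _ [set b | JB (b * chi)]).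
    split=> [|e u v Ju Jv]; first by rewrite /= mul0r; case: loc_submodule.
    by rewrite /= mulrDl -[e *: u]/(e * u) -mulrA; case: loc_submodule => _; apply.
  move=> _ [a Xa <-]; rewrite /mkset induced_chiE -rmorphM; apply: loc_induced.
  by apply: induced_mul_chi; apply: (@lspan_sub L L^o).
have adD n : D ^+ n.+1 * chi = chi * D ^+ n.+1 + D ^+ n *+ n.+1.
  have one : D * chi = chi * D + 1.
    rewrite /D /chi -!(rmorphM iota) oreY_oreC (rmorphD iota); congr (_ + _).
    by rewrite -(rmorph1 iota) -(rmorph1 (oreC 1)); congr (iota (oreC 1 _)); rewrite /delta mul1r derivXsubC.
  elim: n => [|n IH]; first by rewrite !expr1 one.
  rewrite exprS -mulrA IH mulrDr mulrA one mulrDl mul1r -mulrA -exprS.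
  by rewrite -addrA mulrnAr -exprS -mulrS.
(* The commutator with [chi] replaces the coefficients [k_i] by [(i+1) k_(i+1)]. By induction only
   the constant [k_0] survives, and a nonzero one would put 1 into [JB]. *)
have main n (k : nat -> K) : (n <= p)%N -> JB (\sum_(i < n) D ^+ i * kap (k i)) ->
    forall i, (i < n)%N -> k i = 0.
  elim: n k => // n IH k np Jk.
  have ksucc i : (i < n)%N -> k i.+1 = 0.
    move=> lin; have : k i.+1 *+ i.+1 = 0.
      apply: (IH (fun i => k i.+1 *+ i.+1) (ltnW np) _ i lin).
      have -> : \sum_(i < n) D ^+ i * kap (k i.+1 *+ i.+1) =
          (\sum_(i < n.+1) D ^+ i * kap (k i)) * chi - chi * (\sum_(i < n.+1) D ^+ i * kap (k i)).
        rewrite mulr_suml mulr_sumr -sumrB big_ord_recl /= mul1r -kapC subrr add0r.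
        apply: eq_bigr => j _; rewrite /bump /= add1n -mulrA -kapC !mulrA -mulrBl adD.
        rewrite addrAC subrr add0r mulrnAl -mulrnAr; congr (_ * _).
        by rewrite /kap -scalerMnl raddfMn.
      apply: (@submoduleB _ B^o _ _ _ loc_submodule); first exact: JBchi.
      exact: (@submoduleZ _ B^o _ _ _ loc_submodule).
    rewrite -mulr_natr => /eqP; rewrite mulf_eq0 => /orP[/eqP//|].
    by rewrite (negPf (natr_small hp _)) //= (leq_trans _ np).
  move=> [|i] ni; last exact: ksucc.
  move: Jk; rewrite big_ord_recl /= mul1r big1 ?addr0 => [|j _]; last first.
    by rewrite /bump /= add1n ksucc // /kap scale0r raddf0 mulr0.
  move=> Jk; have [//|k0] := eqVneq (k 0%N) 0; case: loc_proper.
  have -> : 1 = kap (k 0%N)^-1 * kap (k 0%N).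
    by rewrite /kap -rmorphM mulr_algl scalerA mulVf // scale1r rmorph1.
  exact: (@submoduleZ _ B^o _ _ _ loc_submodule).
apply: free_basis => // k ksum j.
have [k' k'E] := ord_extend k; rewrite -k'E; apply: (main p k') => //.
apply/(@cls_eq0 B B^o); rewrite -[RHS]ksum raddf_sum; apply: eq_bigr => i _.
have -> : D ^+ i * kap (k' i) = g (k i)%:A * (D ^+ i * 1).
  by rewrite k'E gk mulr1 /D -rmorphXn kapC.
etransitivity; first exact: (@clsZ B B^o gX (g (k i)%:A) (D ^+ i * 1)).
exact: (congr1 (fun u => g (k i)%:A *: u) (@clsZ B B^o gX (D ^+ i) 1)).
Qed.

End Localization.

(** * Points of V(f) *)

Lemma in_qpoly_eq0 (F : fieldType) (q h : {poly F}) : q \is monic -> (1 < size q)%N ->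
  in_qpoly q h = 0 <-> q %| h.
Proof.
(* [{poly %/ q}] reduces by [mk_monic q], which is [q] itself only when [q] is monic and
   nonconstant. *)
move=> qm sq; have qE : mk_monic q = q by rewrite /mk_monic sq qm.
have E : (in_qpoly q h : {poly F}) = h %% q.
  by rewrite /= qE Pdiv.IdomainMonic.modpE.
split=> [/(congr1 val)/= h0|]; first by apply/eqP; rewrite -E -[RHS]h0.
by move=> /eqP h0; apply: val_inj; rewrite /= -h0 -E.
Qed.

Lemma in_qpoly_val (F : fieldType) (q : {poly F}) (u : {poly %/ q}) : in_qpoly q (val u) = u.
Proof. by apply: val_inj; apply: in_qpoly_small; apply: size_mk_monic. Qed.

Lemma qpoly_has_dim (F : fieldType) (q : {poly F}) : q \is monic -> (1 < size q)%N ->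
  has_dim {poly %/ q} (size q).-1.
Proof.
move=> qm sq; have qE : mk_monic q = q by rewrite /mk_monic sq qm.
have sumE (c : 'I_(size q).-1 -> F) : \sum_i c i *: in_qpoly q 'X^i =
    in_qpoly q (\sum_(i < (size q).-1) c i *: 'X^i).
  by rewrite raddf_sum /=; apply: eq_bigr => i _; rewrite in_qpolyZ.
exists (fun i => in_qpoly q 'X^i); apply/is_basisP; split=> [v|c].
  exists (fun i : 'I__ => (val v)`_i); rewrite sumE -{1}[v]in_qpoly_val; congr (in_qpoly q _).
  rewrite -(poly_def _ (fun i => (val v)`_i)); apply/polyP => i; rewrite coef_poly.
  case: ltnP => // iv; rewrite [LHS]nth_default //; apply: leq_trans iv.
  rewrite -ltnS prednK ?(ltnW sq) //.
  by have := size_mk_monic v; rewrite [in X in (_ < X)%N -> _]qE.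
split=> [|c0]; last by rewrite big1 // => i _; rewrite c0 scale0r.
have [k kE] := ord_extend c; rewrite sumE.
under eq_bigr do rewrite -kE.
rewrite -(poly_def (size q).-1 k) => /(congr1 val) c0 i.
have E : val (in_qpoly q (\poly_(i < (size q).-1) k i)) = \poly_(i < (size q).-1) k i.
  apply: in_qpoly_small; rewrite qE.
  by apply: leq_ltn_trans (size_poly _ _) _; rewrite prednK // ltnW.
have : (\poly_(i < (size q).-1) k i)`_i = 0 by rewrite -E c0 coef0.
by rewrite coef_poly ltn_ord kE.
Qed.

Section CommutativeQuotient.
Variables (R : nzRingType) (E : comNzRingType) (Phi : {rmorphism R -> E}).
Hypothesis Phi_surj : forall b, exists a, Phi a = b.
Variable I : set R.
Hypothesis Phi_ker : forall a, Phi a = 0 <-> I a.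

Lemma kernel_two_sided : two_sided I.
Proof.
split=> [|a b|a b]; first by apply/Phi_ker; rewrite rmorph0.
  by move=> /Phi_ker Ia /Phi_ker Ib; apply/Phi_ker; rewrite rmorphD Ia Ib addr0.
by move=> /Phi_ker Ib; split; apply/Phi_ker; rewrite rmorphM Ib ?mul0r ?mulr0.
Qed.

Lemma quot_iso_restr : exists h : {linear lquot R I -> restr Phi E^o},
  bijective h /\ forall a : R, h (@cls R R^o I a) = Phi a.
Proof.
pose g (a : R^o) : restr Phi E^o := Phi a.
have g_lin : linear g by move=> a u v; rewrite /g rmorphD rmorphM.
pose G : {linear R^o -> restr Phi E^o} := HB.pack g (GRing.isLinear.Build _ _ _ _ g g_lin).
apply: (@quot_iso R R^o _ I G) => [a|]; last exact: Phi_surj.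
by rewrite lspan_id; [exact: Phi_ker|exact/two_sided_submodule/kernel_two_sided].
Qed.

Lemma quot_morphism : exists phi : {additive lquot R I -> E},
  [/\ bijective phi, phi (@cls R R^o I 1) = 1 &
      forall (a : R) (v : lquot R I), phi (a *: v) = Phi a * phi v].
Proof.
have [h [hb hE]] := quot_iso_restr.
pose phi (v : lquot R I) : E := h v.
have phi_zmod : zmod_morphism phi by move=> u v; rewrite /phi raddfB.
exists (HB.pack phi (GRing.isZmodMorphism.Build _ _ phi phi_zmod) : {additive lquot R I -> E}).
split=> //=; first by rewrite /phi hE rmorph1.
by move=> a v; rewrite /phi linearZ.
Qed.

Hypothesis Efield : forall b : E, b != 0 -> exists c, c * b = 1.

Lemma field_quot_simple : simple (lquot R I).
Proof.
have [h [hb _]] := quot_iso_restr.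
apply: (@iso_simple _ (restr Phi E^o)); first by apply: iso_sym; exists h.
apply: simple_cyclic; first by exists (1 : E); apply: oner_neq0.
move=> v v0 u; have [c cv] := Efield v0; have [a aE] := Phi_surj ((u : E) * c).
by exists a; rewrite -[RHS]/(Phi a * (v : E)) aE -mulrA cv mulr1.
Qed.

Lemma quot_ann : ann (lquot R I) = I.
Proof.
have tI := kernel_two_sided; apply/seteqP; split=> a; last exact: ann_quot.
move=> /(_ (@cls R R^o I 1)); have -> : a *: @cls R R^o I 1 = @cls R R^o I a.
  by rewrite -[in RHS](mulr1 a); exact: (esym (@clsZ R R^o I a 1)).
by move/cls_eq0; rewrite lspan_id //; apply: two_sided_submodule.
Qed.

Lemma field_quot_max : Max I.
Proof.
rewrite -quot_ann; apply: ann_max; first exact: field_quot_simple.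
exists 1%N, (fun=> @cls R R^o I 1) => a /(_ ord0) a1.
have : I a; last by rewrite quot_ann.
have : @cls R R^o I a = 0.
  by rewrite -[a](mulr1 a) -[RHS]a1; exact: (@clsZ R R^o I a 1).
by move/cls_eq0; rewrite lspan_id //; apply/two_sided_submodule/kernel_two_sided.
Qed.

Lemma field_quot_Lclass : Lclass I (lquot R I).
Proof. by split; [exact: field_quot_simple|exists idfun]. Qed.

End CommutativeQuotient.

Section CoefficientReduction.
Variables (K : fieldType) (f : {poly K}) (R : comNzRingType) (theta : {rmorphism {poly K} -> R}).
Hypothesis theta_f : theta f = 0.

Definition coef_reduce (a : ore f) : {poly R} := map_poly theta (ore_poly a).

Lemma coef_reduce_zmod : zmod_morphism coef_reduce.
Proof. by move=> a b; rewrite /coef_reduce /= raddfB. Qed.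

(** As [theta f = 0], the term with [delta] disappears and left multiplication by [y] becomes
    multiplication by a commuting variable. It is used for the residue map modulo [P] and for
    evaluation at a root of a linear [P]. *)
Lemma coef_reduce_monoid : monoid_morphism coef_reduce.
Proof.
have ymulE b : map_poly theta (ymul f b) = map_poly theta b * 'X.
  rewrite /ymul rmorphD rmorphM /= map_polyX -[RHS]addr0; congr (_ + _).
  apply/polyP => i; rewrite coef_map coef_map coef0 /= /delta rmorphM theta_f.
  exact: mul0r.
have iterE i b : map_poly theta (iter i (ymul f) b) = map_poly theta b * 'X^i.
  elim: i => [|i IH] /=; first by rewrite mulr1.
  by rewrite ymulE IH exprSr mulrA.
split=> [|a b]; rewrite /coef_reduce /=; first by rewrite rmorph1.
rewrite rmorph_sum /= [X in _ = X * _](_ : _ = \poly_(i < size (ore_poly a)) theta (ore_poly a)`_i).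
  rewrite poly_def mulr_suml; apply: eq_bigr => i _.
  by rewrite map_polyZ /= iterE -scalerAl mulrC.
by [].
Qed.

End CoefficientReduction.

Section CoefReduceMorphism.
Variables (K : fieldType) (f : {poly K}) (R : fieldType) (theta : {rmorphism {poly K} -> R}).
Hypothesis theta_f : theta f = 0.
Variables (q : {poly R}).

Definition reduce_mod (a : ore f) : {poly %/ q} := in_qpoly q (coef_reduce theta a).

Lemma reduce_mod_zmod : zmod_morphism reduce_mod.
Proof. by move=> a b; rewrite /reduce_mod coef_reduce_zmod raddfB. Qed.

Lemma reduce_mod_monoid : monoid_morphism reduce_mod.
Proof.
have [c1 cM] := @coef_reduce_monoid K f R theta theta_f.
by split=> [|a b]; rewrite /reduce_mod ?c1 ?cM ?rmorph1 ?rmorphM.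
Qed.

Definition reduce_mod_rmorph : {rmorphism ore f -> {poly %/ q}} := HB.pack reduce_mod
  (GRing.isZmodMorphism.Build _ _ reduce_mod reduce_mod_zmod)
  (GRing.isMonoidMorphism.Build _ _ reduce_mod reduce_mod_monoid).

Lemma reduce_mod_surj : (forall b, exists a, theta a = b) ->
  forall b, exists a, reduce_mod_rmorph a = b.
Proof.
move=> /choice[sec secK] b.
exists (Ore f (\poly_(i < size (val b)) sec (val b)`_i)).
rewrite /= /reduce_mod -[RHS]in_qpoly_val; congr (in_qpoly q _).
apply/polyP => i; rewrite /coef_reduce coef_map coef_poly /=.
case: ltnP => [_|ib]; first exact: secK.
by rewrite raddf0 nth_default.
Qed.

End CoefReduceMorphism.

Section NonAzumayaPoints.
Variables (K : fieldType) (f P : {poly K}) (hP : monic_irreducible_poly P).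
Hypothesis Pf : P %| f.
Local Notation L := (ore f).
Local Notation F := {poly %/ P with hP}.

Definition residue : {rmorphism {poly K} -> F} := in_qpoly P.

Lemma irreducible_size (R : idomainType) (h : {poly R}) :
  monic_irreducible_poly h -> (1 < size h)%N.
Proof. by case=> -[]. Qed.

Lemma residueE g : residue g = 0 <-> P %| g.
Proof. exact: (in_qpoly_eq0 g hP.2 (irreducible_size hP)). Qed.

Lemma residue_f : residue f = 0. Proof. exact/residueE. Qed.

Lemma residue_surj (b : F) : exists a, residue a = b.
Proof. by exists (val b); apply: in_qpoly_val. Qed.

Variables (q : {poly F}) (hq : monic_irreducible_poly q).
Local Notation I := (pq_ideal q : set L).
Local Notation V := (lquot L I).
Let Phi : {rmorphism L -> {poly %/ q}} := reduce_mod_rmorph residue_f q.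

Let Phi_surj (b : {poly %/ q}) : exists a, Phi a = b.
Proof. exact: (reduce_mod_surj residue_f residue_surj). Qed.

Let Phi_ker (a : L) : Phi a = 0 <-> I a.
Proof. exact: (in_qpoly_eq0 _ hq.2 (irreducible_size hq)). Qed.

Let Phi_field (b : {poly %/ q}) : b != 0 -> exists c, c * b = 1.
Proof. by move=> b0; exists ((b : {poly %/ q with hq})^-1); apply: (@mulVf {poly %/ q with hq}). Qed.

Lemma pq_max : Max I.
Proof. exact: (field_quot_max Phi_surj Phi_ker Phi_field). Qed.

Lemma pq_Lclass : Lclass I V.
Proof. exact: (field_quot_Lclass Phi_surj Phi_ker Phi_field). Qed.

Lemma pq_morphism : exists phi : {additive V -> {poly %/ q}},
  [/\ bijective phi, phi (@cls L L^o I 1) = 1 &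
      forall (a : L) (v : V), phi (a *: v) = in_qpoly q (reduce hP a) * phi v].
Proof. exact: (quot_morphism Phi_surj Phi_ker). Qed.

Lemma pq_has_dim : has_dim {poly %/ q} (size q).-1.
Proof. exact: (qpoly_has_dim hq.2 (irreducible_size hq)). Qed.

Lemma residueC (c : K) : residue c%:P = c%:A.
Proof.
rewrite -alg_polyC; etransitivity; first exact: (in_qpolyZ P c 1).
exact: (congr1 (fun u : F => c *: u) (rmorph1 residue)).
Qed.

Lemma pq_has_dimK : has_dimK V ((size P).-1 * (size q).-1).
Proof.
have hF : has_dim (F : lmodType K) (size P).-1.
  exact: (qpoly_has_dim hP.2 (irreducible_size hP)).
have s0 : submodule ([set 0] : set F^o).
  by split=> // a _ _ -> ->; rewrite scaler0 addr0.
(* The tower lemma expects a quotient [A / m]; the residue field is presented as its own quotient by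
   0. *)
have hF0 : has_dimK (lquot F [set 0]) (size P).-1.
  apply: (@has_dim_transport K F (restr (in_alg F) (lquot F [set 0])) (@cls F F^o [set 0])) hF.
    apply: inj_surj_bij => [u v /clsE|w]; last exact: (@cls_surj F F^o [set 0] w).
    by rewrite lspan_id // => /eqP; rewrite subr_eq0 => /eqP.
  move=> c u v; rewrite raddfD; congr (_ + _).
  rewrite -(mulr_algl c u); exact: (@clsZ F F^o).
have [e /is_basisP be] := pq_has_dim.
have := tower_has_dimK s0 be hF0; rewrite card_ord mulnC.
have [phi [[h phiK hK] _ phiM]] := pq_morphism.
apply: (@has_dim_transport K (restr (in_alg F) {poly %/ q}) (restr (in_alg L) V) h).
  by exists phi.
move=> c u v; apply: (can_inj phiK); rewrite raddfD !hK; congr (_ + _).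
rewrite phiM hK.
 have -> : reduce hP (in_alg L c) = residue c%:P *: 1.
  by rewrite /reduce /= -[in RHS](rmorph1 (map_poly residue)) -map_polyZ.
have -> : in_qpoly q (residue c%:P *: 1) = (residue c%:P)%:A.
  by etransitivity; [exact: in_qpolyZ|rewrite in_qpoly1].
by rewrite mulr_algl residueC.
Qed.

Section RationalPoint.
Hypothesis sP : size P = 2%N.
Variables (q0 : {poly K}) (qE : q = map_poly (in_qpoly P \o polyC) q0).

Let rho := - P`_0.

Lemma linear_irreducibleE : P = 'X - rho%:P.
Proof.
apply/polyP => -[|[|i]]; rewrite coefB coefX coefC /= ?sub0r ?subr0 ?opprK //.
  by have /monicP := hP.2; rewrite /lead_coef sP.
by rewrite oppr0 nth_default ?sP.
Qed.

Lemma rational_residue g : residue g = residue (g.[rho])%:P.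
Proof.
apply/eqP; rewrite -subr_eq0 -rmorphB; apply/eqP/residueE.
by rewrite linear_irreducibleE dvdp_XsubCl rootE !hornerE subrr.
Qed.

Let sigma : {rmorphism K -> F} := residue \o polyC.

Lemma rational_map_reduce (a : L) :
  reduce hP a = map_poly sigma (coef_reduce (horner_eval rho) a).
Proof.
rewrite /reduce /coef_reduce -map_poly_comp; apply: eq_map_poly => g.
exact: rational_residue.
Qed.

Lemma rational_monic : q0 \is monic.
Proof.
have /monicP := hq.2; rewrite qE (lead_coef_map sigma) => h.
by apply/monicP/(fmorph_inj sigma); rewrite rmorph1.
Qed.

Lemma rational_size : (1 < size q0)%N.
Proof. by rewrite -(size_map_poly sigma) -[map_poly _ _]qE irreducible_size. Qed.

(** When [P] is linear its residue map is evaluation at the root [rho], so [I] is also the kernel of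
    [ore f -> K[y] / (q0)] obtained by evaluating the coefficients. *)
Lemma rational_morphism : exists phi : {additive V -> {poly %/ q0}},
  [/\ bijective phi, phi (@cls L L^o I 1) = 1 &
      forall (g : {poly K}) (v : V),
        phi (Ore f (map_poly polyC g) *: v) = in_qpoly q0 g * phi v].
Proof.
have ev_f : horner_eval rho f = 0.
  by apply/eqP; rewrite -[_ == 0]/(root f rho) -dvdp_XsubCl -linear_irreducibleE.
have ev_surj b : exists a : {poly K}, horner_eval rho a = b.
  by exists b%:P; rewrite horner_evalE hornerC.
have [a|phi [phib phi1 phiM]] := @quot_morphism L _ (reduce_mod_rmorph ev_f q0)
  (reduce_mod_surj ev_f ev_surj) I.
  rewrite (in_qpoly_eq0 _ rational_monic rational_size) /pq_ideal /= rational_map_reduce.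
  by rewrite {1}qE (dvdp_map sigma).
exists phi; split=> // g v; rewrite phiM; congr (_ * _).
rewrite /= /reduce_mod; congr (in_qpoly q0 _); apply/polyP => i.
by rewrite /coef_reduce !coef_map /= horner_evalE hornerC.
Qed.

End RationalPoint.

End NonAzumayaPoints.

Theorem theorem2p4 (K : fieldType) (p : nat) (hp : p \in [pchar K])
    (f : {poly K}) (hf : (1 < size f)%N)
    (s : nat) (P : 'I_s -> {poly K}) (n : 'I_s -> nat) (c : K)
    (hP : forall i, monic_irreducible_poly (P i))
    (hn : forall i, (0 < n i)%N)
    (hcop : forall i j, i != j -> coprimep (P i) (P j))
    (hc : c != 0)
    (hfact : f = c *: \prod_(i < s) P i ^+ n i) :
  [/\ forall M : set (ore f), Max M ->
        [/\ matrix_quotient M,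
            is_simple_class (Lclass M),
            same_class (Lclass M)
              (fun N => simple N /\ is_summand_of N (lquot (ore f) M)) &
            same_class (Lclass M)
              (fun N => simple N /\ is_factor_of N (lquot (ore f) M))],
      (forall M M' : set (ore f), Max M -> Max M' ->
        same_class (Lclass M) (Lclass M') -> M = M') /\
      (forall C : lmodType (ore f) -> Prop, is_simple_class C ->
        exists2 M : set (ore f), Max M & same_class (Lclass M) C),
      (forall (M : set (ore f)) (N : lmodType (ore f)),
        Max M -> Lclass M N -> ann N = M) /\
      (forall N : lmodType (ore f), simple N ->
        Max (ann N) /\ same_class (Lclass (ann N)) (iso N)) &
      forall m : set (centre (ore f)), (Max `\` Vset (oreC f f ^+ p)) m ->
        Max (extend m) /\
        exists2 d, has_dimK (lquot (centre (ore f)) m) d &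
          forall N : lmodType (ore f), Lclass (extend m) N ->
            (exists e, has_dimK N e) /\
            ((forall a : K, exists b, b ^+ p = a) \/
               ~ division_quotient (extend m) ->
             has_dimK N (p * d))]
  /\
  (forall (i : 'I_s) (q : {poly {poly %/ P i with hP i}}),
    monic_irreducible_poly q ->
    let L : lmodType (ore f) := lquot (ore f) (pq_ideal q) in
    [/\ Max (pq_ideal q : set (ore f)),
        Lclass (pq_ideal q) L,
        exists phi : {additive L -> {poly %/ q}},
          [/\ bijective phi, phi (cls _ 1) = 1 &
              forall (a : ore f) (v : L),
                phi (a *: v) = in_qpoly q (reduce (hP i) a) * phi v],
        has_dim {poly %/ q} (size q).-1 /\
        has_dimK L ((size (P i)).-1 * (size q).-1) &
        size (P i) = 2%N ->
        has_dimK L (size q).-1 /\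
        forall q0 : {poly K}, q = map_poly (in_qpoly (P i) \o polyC) q0 ->
        exists phi : {additive L -> {poly %/ q0}},
          [/\ bijective phi, phi (cls _ 1) = 1 &
              forall (g : {poly K}) (v : L),
                phi (Ore f (map_poly polyC g) *: v) = in_qpoly q0 g * phi v]])
  /\
  (GRing.closed_field_axiom K ->
   forall m : set (centre (ore f)), (Max `\` Vset (oreC f f ^+ p)) m ->
   exists xi r : K,
   [/\ unique (fun z : K => (val @` m) (oreC f ('X^p - z%:P))) xi,
       r ^+ p = xi,
       forall N : lmodType (ore f), Lclass (extend m) N -> has_dimK N p &
       let X : set (ore f) := (val @` m) `|` [set oreC f ('X - r%:P)] in
       [/\ Lclass (extend m) (lquot (ore f) X),
           is_basis (fun i : 'I_p =>
             oreY f ^+ i *: cls _ 1 : restr (in_alg (ore f)) (lquot (ore f) X)) &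
           forall (B : nzRingType) (iota : {rmorphism Weyl K -> B}),
             is_localization (oreC 1 f ^+ p) iota ->
             let g : {rmorphism ore f -> B} := (iota \o @to_weyl K f) in
             let Y : lmodType (ore f) := restr g (lquot B (g @` X)) in
             iso (lquot (ore f) X) Y /\
             is_basis (fun i : 'I_p =>
               iota (oreY 1) ^+ i *: cls _ 1 : restr (in_alg (ore f)) Y)]]).
Proof.
have f0 : f != 0 by rewrite -size_poly_gt0 ltnW.
have finN := @ore_simple_separates K p hp f f0.
split; [|split].
- split.
  + by move=> M; apply: max_structure.
  + split; first by move=> M M'; apply: Lclass_inj.
    by move=> C; apply: Lclass_surj.
  + split; first by move=> M N mM /(LclassE finN N mM)[].
    by move=> N; apply: simple_Max_ann.
  + move=> m [mm mf]; have mI := extend_max hp f0 mm mf; split=> //.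
    have [d d0 hd] := residue_has_dim hp f0 mm mf; exists d => // N /(LclassE finN N mI)[sN aN].
    have [r [e be]] := simple_mod_basis hp f0 mm sN aN.
    split; first by exists (r * d)%N; apply: (simple_has_dimK mm be hd).
    move=> h; apply: (simple_dimK_p hp f0 mm mf) => //.
    by case: h => // /(perfect_not_division hp f0 mm mf).
- move=> i q hq L.
  have Pf : P i %| f by rewrite hfact dvdpZr // (bigD1 i) //= dvdp_mulr // dvdp_exp.
  split.
  + exact: pq_max.
  + exact: pq_Lclass.
  + exact: pq_morphism.
  + by split; [exact: pq_has_dim|exact: pq_has_dimK].
  + move=> sP; split; last by move=> q0 qE; apply: rational_morphism.
    by have := pq_has_dimK Pf hq; rewrite sP mul1n.
- move=> cK m [mm mf]; have mI := extend_max hp f0 mm mf.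
  have [d d0 hd] := residue_has_dim hp f0 mm mf.
  have resK z : exists k : K, m (z - k%:A) by apply: (closed_residue mm hd).
  have [xi mxi] := resK (centre_x hp f).
  have [r rE] : exists r : K, r ^+ p = xi.
    (* The closedness axiom applied to [t^p = xi]: only the constant coefficient is nonzero. *)
    have [r rE] := cK p (fun i => if i == 0%N then xi else 0) (pchar_gt0 hp); exists r.
    rewrite rE (bigD1 (Ordinal (pchar_gt0 hp))) //= mulr1 big1 ?addr0 // => j.
    by rewrite -val_eqE /= => /negPf ->; rewrite mul0r.
  have mr : m (centre_x hp f - (r ^+ p)%:A) by rewrite rE.
  have valE z : val (centre_x hp f - z%:A) = oreC f ('X^p - z%:P).
    by rewrite [RHS]raddfB /= oreC_polyC.
  have mprime := max_comm_prime mm; have [tm [m1 _]] := mm; have [m0 mD mM] := tm.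
  have sV := induced_simple f0 mm mf resK mr.
  have bV := induced_basis f0 mm mf resK mr.
  have aV := induced_ann f0 mm mf resK mr.
  exists xi, r; split=> //.
  + split; first by exists (centre_x hp f - xi%:A).
    move=> z [t mt tE]; have {}tE : t = centre_x hp f - z%:A by apply: val_inj; rewrite tE valE.
    (* Two different values would differ by a nonzero scalar lying in [m]. *)
    have [//|neq] := eqVneq xi z; case: m1.
    have dz : z - xi != 0 by rewrite subr_eq0 eq_sym.
    have -> : 1 = (z - xi)^-1%:A * ((centre_x hp f - xi%:A) + - t) :> centre (ore f).
      rewrite tE opprB [_ - _ + _]addrC addrA subrK -scalerBl mulr_algl scalerA mulVf // scale1r.
      by [].
    by apply: (mM _ _ _).1; apply: mD => //; apply: ideal_opp.
  + move=> N /(LclassE finN N mI)[sN aN].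
    have : iso (lquot (ore f) (induced_gens m r)) N.
      by apply: simple_iso => //; [apply: finN|rewrite aV aN].
    by move/has_dimK_iso; apply; eexists; exact: bV.
  + split; [by apply/(LclassE finN _ mI)|exact: bV|].
    move=> B iota loc; split.
      exact: (loc_iso f0 loc mm mf resK mr).
    exact: (loc_basis f0 loc mm mf resK mr).
Qed.
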